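(* Let $\{x^k\}$ be the sequence generated by algorithm PSNP or PCSNP with $\alpha_k\equiv\alpha\in\left(0,\min\{\tau,\frac{1}{\sigma+\sigma_0}\}\right]$. Suppose that $f$ is $SC^1$ on $\mathbb{N}(0,c_0)$, that $f$ is coercive if $q=0$, and that at an accumulation point $x^*$ of $\{x^k\}$, with $S^*:=\mathrm{supp}(x^* )$, one has $\langle M^*v,v\rangle>0$ for all $M^*\in\partial^2_{S^*}E(x^* )$ and all nonzero $v\in\mathbb{R}^{|S^*|}$. Suppose also that $\sigma\in(0,\sigma_* )$, where $$\sigma_*:=\tfrac12\inf_{M^*\in\partial^2_{S^*}E(x^* )}\ \inf_{v\in\mathbb{R}^{|S^*|},\|v\|=1}\langle M^*v,v\rangle .$$ Then $\{x^k\}$ converges to $x^*$ superlinearly, i.e. $\|x^{k+1}-x^*\|=o(\|x^k-x^*\|)$. If moreover $f$ is $SC^2$ on $\mathbb{N}(0,c_0)$, then $\{x^k\}$ converges to $x^*$ quadratically, i.e. $\|x^{k+1}-x^*\|=O(\|x^k-x^*\|^2)$.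
   Context: Problem: $f:\mathbb{R}^n\to\mathbb{R}$ is continuously differentiable and bounded from below, $\lambda>0$, $q\in[0,1)$, and $F(x):=f(x)+\lambda\|x\|_q^q$ with $\|x\|_q^q:=\sum_i|x_i|^q$, where $|t|^0=1$ for $t\ne0$ and $|0|^0=0$. $\|\cdot\|$ is the Euclidean/spectral norm. $\mathrm{supp}(x)$ is the set of indices of nonzero entries; $x_T$ denotes the sub-vector indexed by $T$, $H_T$ the principal sub-matrix indexed by $T$, $\overline T$ the complement of $T$. $\mathbb{N}(x,\epsilon):=\{w:\|x-w\|^2<\epsilon\}$. $f$ is coercive if $f(x)\to\infty$ as $\|x\|\to\infty$. Smoothness classes: $f$ is $LC^1$ on an open set $\Omega$ if it is continuously differentiable and $\nabla f$ is Lipschitz on $\Omega$ (with some constant). A map $g$ that is locally Lipschitz at $x$ is semismooth at $x$ if $\lim_{H\in\partial g(x+td'),\,d'\to d,\,t\downarrow0}Hd'$ exists for every $d$ ($\partial g$ the Clarke generalized Jacobian); then the directional derivative $g'(x;d)$ exists and $Hd=g'(x;d)+o(\|d\|)$ for $H\in\partial g(x+d)$, $d\to0$. It is strongly semismooth at $x$ if moreover $Hd=g'(x;d)+O(\|d\|^2)$ for $H\in\partial g(x+d)$, $d\to0$. $f$ is $SC^1$ (resp. $SC^2$) on $\Omega$ if it is $LC^1$ on $\Omega$ and $\nabla f$ is semismooth (resp. strongly semismooth) at every $x\in\Omega$. Generalized Hessian: $\partial^2 g(x)$ is the convex hull of all $H=\lim\nabla^2g(x^i)$ over sequences $x^i\to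 x$ of points at which $g$ is twice differentiable. $E(x;T):=f(x)+\lambda\|x_T\|_q^q$; for $S=\mathrm{supp}(x)$, $\nabla_SE(x):=(\nabla E(\cdot;S)(x))_S$ and $\partial^2_SE(x):=\{M_S:M\in\partial^2E(\cdot;S)(x)\}$. $\mathrm{Prox}_{r}(z):=\operatorname{argmin}_{w}\frac12\|z-w\|^2+r(w)$ (set of global minimizers). Constants: for the initial point $x^0$ and a given $\tau>0$, $\Omega^0:=\{x:F(x)\le F(x^0)\}$, $c_0:=\sup_{x\in\Omega^0}5(\|x\|^2+\tau^2\|\nabla f(x)\|^2+\tau\lambda\|x\|_q^q)$, $\sigma_0:=\sup_{x\in\mathbb{N}(0,c_0)}\sup_{H\in\partial^2f(x)}\|H\|$. Algorithm PSNP: given $x^0\in\mathbb{R}^n$, $\sigma>0$, $\gamma\in(0,1)$, for $k=0,1,2,\dots$: (i) take $w^k\in\mathrm{Prox}_{\alpha_k\lambda\|\cdot\|_q^q}(x^k-\alpha_k\nabla f(x^k))$ and set $S^k=\mathrm{supp}(w^k)$; the step $\alpha_k$ is to be such that $F(w^k)\le F(x^k)-\frac\sigma4\|w^k-x^k\|^2$ (this holds for the choice of $\alpha_k$ above); (ii) choose $M^k\in\partial^2_{S^k}E(w^k)$; if the equations $M^kd^k_{S^k}=\nabla_{S^k}E(w^k)$, $d^k_{\overline{S^k}}=0$ have a solution $d^k$ and there is an integer $s\in\{0,1,2,\dots\}$ with $F(w^k-\gamma^{s}d^k)\le F(w^k)-\frac\sigma2\|\gamma^{s}d^k\|^2$,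 let $s_k$ be the smallest such integer, set $\beta_k=\gamma^{s_k}$ and $x^{k+1}=w^k-\beta_kd^k$; otherwise set $x^{k+1}=w^k$. Algorithm PCSNP is the same except that step (ii) is tried only when $S^k=\mathrm{supp}(x^k)$; otherwise $x^{k+1}=w^k$. Standing assumption: $\nabla f(0)\neq0$ and $\lambda<\frac{\alpha^{1-q}}{2}\|\nabla f(0)\|_\infty^{2-q}$. *)

(* Defs.v *)
From HB Require Import structures.
From mathcomp Require Export all_boot all_order all_algebra.
From mathcomp Require Export all_classical all_reals all_analysis.

Set Implicit Arguments.
Unset Strict Implicit.
Unset Printing Implicit Defensive.

Import Order.TTheory GRing.Theory Num.Theory.
Import numFieldNormedType.Exports.
Export numFieldNormedType.Exports.

Local Open Scope classical_set_scope.
Local Open Scope ring_scope.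

(* Vectors of R^n are row vectors, and a matrix H acts on a vector d as
   d *m H, in accordance with the library's [jacobian]: 'D_d g x = d *m 'J g x.
   So the entry (i, j) of a Jacobian is the derivative of the j-th component
   along the i-th coordinate. Hessians being symmetric, the convention is
   immaterial for them. *)

Section Euclidean.
Context {R : realType}.

Definition dot n (u v : 'rV[R]_n) : R := \sum_i u 0 i * v 0 i.

(* The library norm `|x| on 'rV[R]_n is the maximum norm. *)
Definition enorm n (x : 'rV[R]_n) : R := Num.sqrt (\sum_i x 0 i ^+ 2).

Definition specnorm m n (H : 'M[R]_(m, n)) : R :=
  sup [set enorm (v *m H) | v in [set v : 'rV[R]_m | enorm v <= 1]].

(* The radius bounds the squared distance, and may be infinite. *)
Definition sqball n (x : 'rV[R]_n) (eps : \bar R) : set 'rV[R]_n :=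
  [set w | ((enorm (x - w) ^+ 2)%:E < eps)%E].

Definition supp n (x : 'rV[R]_n) : {set 'I_n} := [set i | x 0 i != 0].

Definition subvec n (T : {set 'I_n}) (x : 'rV[R]_n) : 'rV[R]_#|T| :=
  \row_j x 0 (enum_val j).

Definition principal_submx n (T : {set 'I_n}) (H : 'M[R]_n) : 'M[R]_#|T| :=
  \matrix_(i, j) H (enum_val i) (enum_val j).

(* The library's powR has 0 `^ 0 = 1, whereas here |0|^0 = 0. *)
Definition abspow (q t : R) : R := if t == 0 then 0 else `|t| `^ q.

Definition lqq (q : R) n (x : 'rV[R]_n) : R := \sum_i abspow q (x 0 i).

Definition coercive n (f : 'rV[R]_n -> R) : Prop :=
  forall A : R, \forall r \near +oo, forall x, r <= enorm x -> A <= f x.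

Definition prox n (r : 'rV[R]_n -> R) (z : 'rV[R]_n) : set 'rV[R]_n :=
  [set w | forall y, 2^-1 * enorm (z - w) ^+ 2 + r w
                  <= 2^-1 * enorm (z - y) ^+ 2 + r y].

End Euclidean.

Section Nonsmooth.
Context {R : realType}.

Definition grad n (f : 'rV[R]_n -> R) (x : 'rV[R]_n) : 'rV[R]_n :=
  \row_i 'D_(delta_mx 0 i) f x.

Definition twice_differentiable n (f : 'rV[R]_n -> R) (x : 'rV[R]_n) : Prop :=
  (\forall y \near x, differentiable f y) /\ differentiable (grad f) x.

Definition hessian n (f : 'rV[R]_n -> R) (x : 'rV[R]_n) : 'M[R]_n :=
  'J (grad f) x.

Definition convex_hull (V : lmodType R) (A : set V) : set V :=
  smallest (@convex_set R V) A.

Definition limit_set m n (D : set 'rV[R]_n) (J : 'rV[R]_n -> 'M[R]_(n, m))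
    (x : 'rV[R]_n) : set 'M[R]_(n, m) :=
  [set H | exists u : nat -> 'rV[R]_n,
    [/\ forall i, D (u i), u @ \oo --> x & (fun i => J (u i)) @ \oo --> H]].

Definition clarke_jacobian n m (g : 'rV[R]_n -> 'rV[R]_m) (x : 'rV[R]_n) :
    set 'M[R]_(n, m) :=
  convex_hull (limit_set [set y | differentiable g y] (fun y => 'J g y) x).

Definition gen_hessian n (f : 'rV[R]_n -> R) (x : 'rV[R]_n) : set 'M[R]_n :=
  convex_hull (limit_set [set y | twice_differentiable f y] (hessian f) x).

Definition locally_lipschitz_at n m (g : 'rV[R]_n -> 'rV[R]_m)
    (x : 'rV[R]_n) : Prop :=
  exists2 U, nbhs x U & [lipschitz g y | y in U].

Definition semismooth n m (g : 'rV[R]_n -> 'rV[R]_m) (x : 'rV[R]_n) : Prop :=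
  locally_lipschitz_at g x /\
  forall d : 'rV[R]_n, exists l : 'rV[R]_m, forall e : R, 0 < e ->
    \forall d' \near d & t \near 0^'+,
      forall H, clarke_jacobian g (x + t *: d') H -> enorm (d' *m H - l) < e.

(* One-sided, unlike the library's 'D_d g x. *)
Definition dirderiv n m (g : 'rV[R]_n -> 'rV[R]_m) (x d : 'rV[R]_n) :
    'rV[R]_m :=
  lim ((fun t : R => t^-1 *: (g (x + t *: d) - g x)) @ 0^'+).

Definition strongly_semismooth n m (g : 'rV[R]_n -> 'rV[R]_m)
    (x : 'rV[R]_n) : Prop :=
  semismooth g x /\
  exists C : R, \forall d \near (0 : 'rV[R]_n),
    forall H, clarke_jacobian g (x + d) H ->
      enorm (d *m H - dirderiv g x d) <= C * enorm d ^+ 2.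

Definition C1_on n (f : 'rV[R]_n -> R) (Omega : set 'rV[R]_n) : Prop :=
  forall x, Omega x -> differentiable f x /\ {for x, continuous (grad f)}.

Definition LC1_on n (f : 'rV[R]_n -> R) (Omega : set 'rV[R]_n) : Prop :=
  C1_on f Omega /\ [lipschitz grad f y | y in Omega].

Definition SC1_on n (f : 'rV[R]_n -> R) (Omega : set 'rV[R]_n) : Prop :=
  LC1_on f Omega /\ forall x, Omega x -> semismooth (grad f) x.

Definition SC2_on n (f : 'rV[R]_n -> R) (Omega : set 'rV[R]_n) : Prop :=
  LC1_on f Omega /\ forall x, Omega x -> strongly_semismooth (grad f) x.

End Nonsmooth.

Section Problem.
Context {R : realType} {n : nat}.
Variables (f : 'rV[R]_n -> R) (lambda q : R).

Definition objective (x : 'rV[R]_n) : R := f x + lambda * lqq q x.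

Definition restricted_objective (T : {set 'I_n}) (x : 'rV[R]_n) : R :=
  f x + lambda * lqq q (subvec T x).

Definition grad_supp (x : 'rV[R]_n) : 'rV[R]_#|supp x| :=
  subvec (supp x) (grad (restricted_objective (supp x)) x).

Definition gen_hessian_supp (x : 'rV[R]_n) : set 'M[R]_#|supp x| :=
  [set principal_submx (supp x) M
     | M in gen_hessian (restricted_objective (supp x)) x].
Arguments gen_hessian_supp x M : clear implicits.

Definition sublevel (x0 : 'rV[R]_n) : set 'rV[R]_n :=
  [set x | objective x <= objective x0].

Definition c0_bound (tau : R) (x0 : 'rV[R]_n) : \bar R :=
  ereal_sup [set (5 * (enorm x ^+ 2 + tau ^+ 2 * enorm (grad f x) ^+ 2
                       + tau * lambda * lqq q x))%:E | x in sublevel x0].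

Definition sigma0_bound (tau : R) (x0 : 'rV[R]_n) : \bar R :=
  ereal_sup [set ereal_sup [set (specnorm H)%:E | H in gen_hessian f x]
            | x in sqball 0 (c0_bound tau x0)].

(* As extended reals, so that an infimum over an empty set is +oo. *)
Definition sigma_star (xstar : 'rV[R]_n) : \bar R :=
  ((2^-1)%R%:E * ereal_inf
     [set ereal_inf [set (dot (v *m M) v)%R%:E
                    | v in [set v : 'rV[R]_#|supp xstar| | enorm v = 1%R]]
     | M in gen_hessian_supp xstar])%E.

Variables (sigma gamma : R).

Definition prox_step (a : R) (x w : 'rV[R]_n) : Prop :=
  prox (fun y => a * lambda * lqq q y) (x - a *: grad f x) w /\
  objective w <= objective x - sigma / 4 * enorm (w - x) ^+ 2.

Definition newton_eq (w : 'rV[R]_n) (M : 'M[R]_#|supp w|) (d : 'rV[R]_n) :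
    Prop :=
  subvec (supp w) d *m M = grad_supp w /\
  forall i, i \notin supp w -> d 0 i = 0.

Definition armijo (w d : 'rV[R]_n) (s : nat) : Prop :=
  objective (w - gamma ^+ s *: d)
    <= objective w - sigma / 2 * enorm (gamma ^+ s *: d) ^+ 2.

(* A singular Newton equation may have several solutions d. Any of them may be
   chosen, and the fallback x' = w applies if there is none or if the line
   search fails along the chosen one. *)
Definition newton_step (w x' : 'rV[R]_n) : Prop :=
  exists2 M, gen_hessian_supp w M &
    (exists d s, [/\ newton_eq M d, armijo w d s,
                     forall s', armijo w d s' -> (s <= s')%N
                   & x' = w - gamma ^+ s *: d])
    \/ (((~ exists d, newton_eq M d) \/
         (exists2 d, newton_eq M d & forall s, ~ armijo w d s))
        /\ x' = w).

Definition PSNP (alpha : nat -> R) (x0 : 'rV[R]_n) (x : nat -> 'rV[R]_n) :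
    Prop :=
  x 0%N = x0 /\
  forall k, exists2 w, prox_step (alpha k) (x k) w & newton_step w (x k.+1).

Definition PCSNP (alpha : nat -> R) (x0 : 'rV[R]_n) (x : nat -> 'rV[R]_n) :
    Prop :=
  x 0%N = x0 /\
  forall k, exists2 w, prox_step (alpha k) (x k) w &
    if supp w == supp (x k) then newton_step w (x k.+1) else x k.+1 = w.

End Problem.

Arguments gen_hessian_supp {R n} f lambda q x M.

(* Main.v *)
(** Let p be the accumulation point, S = supp p, E = E(.;S) and h = w^k - p.
    Nonzero entries of a prox point are bounded away from 0, so supp w^k = S as
    soon as w^k is near p. There E is LC^1 with a semismooth gradient, and F = E
    on the vectors supported in S.

    The bound on sigma says that the generalized Hessians of E at p exceed
    2 sigma on vectors supported in S; by compactness this persists near p.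
    Integrating along segments gives <grad E(w), h> >= 2 sigma |h|^2 and
    E(w) - E(p) >= sigma |h|^2. Such integration needs Rademacher's theorem, in
    the form: a Lipschitz map is differentiable almost everywhere on some line
    arbitrarily close to a given one. This form is proved by induction on the
    number of coordinates: where the restriction to the last coordinates is
    differentiable, a missing partial derivative or a porous set of good points
    is the only obstruction to adding one more coordinate, and both are null on
    the lines of that coordinate.

    Both half steps of the algorithm tend to 0 because F decreases. The prox
    optimality condition bounds grad_S E(w^k) by |w^k - x^k|, hence
    |h| <= C |w^k - x^k|: the sequence cannot leave a neighbourhood of p and
    converges. Comparing the decrease of F with its quadratic upper bound gives
    |h| <= C |x^k - p|. Finally, semismoothness makes
    grad E(w) - grad E(p) - h M small relative to h for M in the generalized
    Hessian at w; then the full Newton step passes the line search, and its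
    error is at most this residual divided by 2 sigma. *)

From HB Require Import structures.
Require Import Defs.
From mathcomp Require Import measurable_realfun ring lra.

Set SsrOldRewriteGoalsOrder.
Set Implicit Arguments.
Unset Strict Implicit.
Unset Printing Implicit Defensive.

Import Order.TTheory GRing.Theory Num.Theory.

Local Open Scope classical_set_scope.
Local Open Scope ring_scope.

(** * Lipschitz functions of one variable *)

(** Generalized Hessians see only points of twice differentiability, and a segment may miss all of
    them. Increments are therefore taken along parallel segments, and every mean value hypothesis is
    imposed on a tube around the segment. Once the direction of the segment is made the first axis,
    null sets enter only through Fubini on coordinate lines. The strictness of [sigma < sigma_star]
    is what compactness consumes: the bound at p is some c > 2 sigma, and exactly 2 sigma survives
    on a neighbourhood. The same 2 sigma decides the line search. Growth of E provides sigma |h|^2,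
    while the test asks for sigma/2 |d|^2 with |d| close to |h|; the difference pays for the
    inexactness of the full step. Only an accumulation point is given, so convergence cannot rest on
    a contraction of |x^k - p|. What makes a neighbourhood stable is that the bound of |h| by |w^k -
    x^k| does not involve |x^k - p|: each iteration restores the same radius, however close to the
    boundary it started. *)

Lemma stieltjes_dominated (R : realType) (psi : cumulative R R) (K : R) :
  0 < K -> (forall x y, x <= y -> psi y - psi x <= K * (y - x)) ->
  forall A, (lebesgue_stieltjes_measure psi A <= K%:E * lebesgue_measure A)%E.
Proof.
move=> K0 HK A.
rewrite /lebesgue_stieltjes_measure /lebesgue_measure /measure_extension /mu_ext.
rewrite -ereal_inf_pZl//.
(* Both measures are infima over the same countable covers by half-open intervals, so a comparison
   on single intervals suffices. *)
apply: le_ereal_inf_tmp => _ [_ [F [mF AF] <-] <-].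
apply: (@le_trans _ _ (\sum_(k <oo) wlength psi (F k))%E).
  by apply: ereal_inf_lbound; exists F.
rewrite -nneseriesZl//.
apply: lee_nneseries => [i _ _|i _ /=]; first exact: wlength_ge0.
have /ocitvP[->|[x x12 ->]] := mF i.
  by rewrite !wlength0 mule0.
rewrite !(wlength_itv_bnd _ _ _ (ltW x12))/= -EFinM lee_fin.
exact/HK/ltW.
Qed.

Lemma stieltjes_itvoc (R : realType) (psi : cumulative R R) (c d : R) : c <= d ->
  lebesgue_stieltjes_measure psi `]c, d]%classic = (psi d - psi c)%:E.
Proof.
move=> cd; rewrite /lebesgue_stieltjes_measure /measure_extension.
by rewrite measurable_mu_extE/= ?wlength_itv_bnd//; exact: is_ocitv.
Qed.

Lemma klipschitz_continuous (R : realType) (V W : normedModType R) (g : V -> W)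
    (L : R) : (forall x y, `|g x - g y| <= L * `|x - y|) -> continuous g.
Proof.
move=> gL x; apply/cvgrPdist_lt => e e0.
apply/nbhs_normP; exists (e / (`|L| + 1)) => [|y /= xy].
  by rewrite /= divr_gt0 // ltr_pwDr.
rewrite (le_lt_trans (gL _ _))//.
rewrite (@le_lt_trans _ _ ((`|L| + 1) * `|x - y|))//.
  by rewrite ler_wpM2r// (le_trans (ler_norm _))// lerDl.
by rewrite -ltr_pdivlMl ?ltr_pwDr// mulrC.
Qed.

(* [phi + L id] is nondecreasing; its Stieltjes measure is dominated by Lebesgue
   measure, and the derivative is its Radon-Nikodym density. *)
Lemma lipschitz_ae_derivable (R : realType) (phi : R -> R) (L a b : R) :
  (forall x y, `|phi x - phi y| <= L * `|x - y|) -> a < b ->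
  exists f : R -> R,
    [/\ lebesgue_measure.-integrable `]a, b] (EFin \o f),
        (phi b - phi a)%:E = (\int[lebesgue_measure]_(x in `]a, b]) (f x)%:E)%E
      & {ae lebesgue_measure, forall x, a < x < b -> is_derive x (1 : R) phi (f x)}].
Proof.
move=> Hphi ab.
wlog L0 : L Hphi / 0 < L => [hw|].
  apply: (hw (`|L| + 1)); last by rewrite ltr_pwDr.
  move=> x y; rewrite (le_trans (Hphi x y))// ler_wpM2r//.
  by rewrite (le_trans (ler_norm _))// lerDl.
pose tilt x := phi x + L * x.
have le_tilt x y : x <= y -> 0 <= tilt y - tilt x <= (L + L) * (y - x).
  move=> xy; have := Hphi y x; rewrite (ger0_norm (_ : 0 <= y - x)) ?subr_ge0//.
  by rewrite ler_norml /tilt => /andP[? ?]; apply/andP; split; lra.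
have tilt_nd : {homo tilt : x y / x <= y}.
  by move=> x y /le_tilt /andP[+ _]; rewrite subr_ge0.
have tilt_cont : continuous tilt.
  apply: (@klipschitz_continuous R R R tilt (L + L)) => x y.
  have [xy|/ltW yx] := leP x y.
    rewrite distrC (distrC x) !ger0_norm ?subr_ge0//; last exact: tilt_nd.
    by have /andP[] := le_tilt _ _ xy.
  rewrite !ger0_norm ?subr_ge0//; last exact: tilt_nd.
  by have /andP[] := le_tilt _ _ yx.
have tilt_rc : right_continuous tilt by apply: right_continuousW.
have [psi psiE] : exists psi : cumulative R R, forall x, psi x = phi x + L * x.
  by exists (HB.pack tilt (isCumulative.Build R _ R tilt tilt_nd tilt_rc) : cumulative R R).
have psi_le x y : x <= y -> psi y - psi x <= (L + L) * (y - x).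
  by rewrite !psiE => /le_tilt /andP[].
have dom := stieltjes_dominated (addr_gt0 L0 L0) psi_le.
have mab : measurable (`]a, b]%classic : set (measurableTypeR R)) by exact: measurable_itv.
have fin_ab : (lebesgue_stieltjes_measure psi `]a, b]%classic < +oo)%E.
  by rewrite stieltjes_itvoc ?ltW// ltry.
(* Restriction to the bounded interval makes the Stieltjes measure finite, hence fit for
   Radon-Nikodym. *)
pose nu : {finite_measure set (measurableTypeR R) -> \bar R} := mfrestr mab fin_ab.
have nudom : nu `<< (lebesgue_measure : set (measurableTypeR R) -> _).
  apply/null_content_dominatesP => A mA /= A0.
  apply/eqP; rewrite eq_le measure_ge0 andbT.
  rewrite /mfrestr /mrestr (le_trans (dom _))//.
  have -> : lebesgue_measure (A `&` `]a, b]%classic) = 0%E; last by rewrite mule0.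
  apply: subset_measure0 A0 => //; exact: measurableI.
have [h [h0 hfin hint hE]] := radon_nikodym_sigma_finite nudom.
pose g : R -> R := fun x => fine (h x).
have gE : EFin \o g = h by apply/funext => x; rewrite /g /= fineK.
have gT : lebesgue_measure.-integrable [set: R] (EFin \o g) by rewrite gE.
have gint u : a <= u -> u <= b ->
    (tilt u - tilt a)%:E = (\int[lebesgue_measure]_(x in `]a, u]) (g x)%:E)%E.
  move=> au ub; rewrite (_ : (fun x => (g x)%:E) = h); last by rewrite -gE.
  have mau : measurable (`]a, u]%classic : set (measurableTypeR R)) by exact: measurable_itv.
  have := hE _ mau; rewrite /nu/= /mfrestr /mrestr setIidl; last first.
    by apply: subset_itvl; rewrite bnd_simp.
  by rewrite stieltjes_itvoc// !psiE => ->.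
have gI u : lebesgue_measure.-integrable `]a, u] (EFin \o g).
  exact: integrableS gT.
have cI : lebesgue_measure.-integrable `]a, b] (EFin \o (cst L : R -> R)).
  apply: (@integrableS _ _ R lebesgue_measure `[a, b]) => //.
    by apply: subset_itvr; rewrite bnd_simp.
  apply: continuous_compact_integrable; first exact: segment_compact.
  by move=> x; exact: cvg_cst.
exists (fun x => g x - L); split.
- rewrite (_ : EFin \o _ = ((EFin \o g) \- (EFin \o cst L))%E)//.
  exact: integrableB.
- transitivity (\int[lebesgue_measure]_(x in `]a, b]) ((g x)%:E - (cst L x)%:E))%E => //.
  rewrite integralB_EFin//.
  rewrite -gint ?(ltW ab)//.
  transitivity ((tilt b - tilt a)%:E - \int[lebesgue_measure]_(x in `]a, b]) (cst L%:E) x)%E => //.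
  rewrite integral_cst//= lebesgue_measure_itv/= lte_fin ab -EFinB.
  by congr EFin; rewrite /tilt; ring.
(* Near [x], [phi] differs by an affine function from the indefinite integral [F] of [g], and [F]
   has derivative [g x] at every Lebesgue point of [g]. *)
have := lebesgue_differentiation (open_integrable_locally openT gT).
apply: filterS; first exact: (ae_filter_ringOfSetsType lebesgue_measure).
move=> x fx /andP[ax xb].
have x1 : x < x + 1 by rewrite ltrDl.
have ax' : (BRight a < BRight x)%O by rewrite bnd_simp.
have [dF FE] := FTC1_lebesgue_pt x1 (gI (x + 1)) ax' fx.
set F := fun y : R => _ in dF FE.
have FD : is_derive x (1 : R) F (g x).
  by apply: DeriveDef; [exact: dF|rewrite -derive1E; exact: FE].
apply: (@near_eq_is_derive _ _ _ (fun y => F y + (- L) *: y + tilt a)); last first.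
  apply: is_derive_eq.
  by rewrite addr0 /GRing.scale /= mulr1.
near=> y.
rewrite /F /Rintegral -gint/=; [|apply: ltW; near: y; exact: lt_nbhsr
    |apply: ltW; near: y; exact: lt_nbhsl].
rewrite /tilt /GRing.scale /=; ring.
Unshelve. all: by end_near. Qed.

(** The increment is the integral of the almost everywhere derivative. Quantifying over [c] keeps
    the hypothesis silent wherever the derivative fails to exist. *)
Lemma lipschitz_increment_le (R : realType) (phi : R -> R) (L a b K : R) :
  (forall x y, `|phi x - phi y| <= L * `|x - y|) -> a <= b ->
  {ae lebesgue_measure, forall x : R, a < x < b ->
     forall c : R, is_derive x (1 : R) phi c -> c <= K} ->
  phi b - phi a <= K * (b - a).
Proof.
move=> philip; rewrite le_eqVlt => /predU1P[->|ab] aeK; first by rewrite !subrr mulr0.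
have [f [fI fE fD]] := lipschitz_ae_derivable philip ab.
rewrite -lee_fin fE.
have -> : (K * (b - a))%:E = (\int[lebesgue_measure]_(x in `]a, b]) (cst K%:E) x)%E.
  by rewrite integral_cst//= lebesgue_measure_itv/= lte_fin ab -EFinB.
have KI : lebesgue_measure.-integrable `]a, b] (EFin \o (cst K : R -> R)).
  apply: (@integrableS _ _ R lebesgue_measure `[a, b]) => //.
    by apply: subset_itvr; rewrite bnd_simp.
  apply: continuous_compact_integrable; first exact: segment_compact.
  by move=> x; exact: cvg_cst.
rewrite -sube_ge0; last first.
  by apply/orP; left; exact: integrable_fin_num.
rewrite -(integralB_EFin _ KI fI)//.
have mKf : measurable_fun `]a, b] (EFin \o (fun x => K - f x)).
  by apply: (measurable_int lebesgue_measure); exact: (integrableB _ KI fI).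
rewrite (_ : (fun x => _) = EFin \o (fun x => K - f x)); last exact/funext.
(* The almost everywhere inequality [f <= K] is used as an almost everywhere equality of [K - f]
   with its absolute value, whose integral is nonnegative. *)
have <- : (\int[lebesgue_measure]_(x in `]a, b]) (`|K - f x|%R)%:E =
    \int[lebesgue_measure]_(x in `]a, b]) (K - f x)%R%:E)%E; last first.
  by apply: integral_ge0 => x _; rewrite lee_fin.
apply: ae_eq_integral => //.
  by apply/measurable_EFinP/measurableT_comp => //; exact/measurable_EFinP.
have neb : {ae lebesgue_measure, forall x : R, x != b}.
  exists [set b]; split => //; first exact: lebesgue_measure_set1.
  by move=> x /= /negP; rewrite negbK => /eqP.
apply: filterS3 neb aeK fD; first exact: (ae_filter_ringOfSetsType lebesgue_measure).
move=> x xb Kx Dx; rewrite /= in_itv/= => /andP[ax]; rewrite le_eqVlt (negPf xb)/= => xltb.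
rewrite ger0_norm// subr_ge0.
by apply: Kx; [rewrite ax|apply: Dx; rewrite ax].
Qed.

(** Shaped for its negation: at a point that is not one of porosity, every small [t] lies within
    [e * |t|] of some [u] with [s + u] in [A]. *)
Definition porous_at (R : realType) (A : set R) (s : R) :=
  exists2 e : R, 0 < e & forall d, 0 < d -> exists t, [/\ t != 0, `|t| < d &
    forall u, `|u - t| <= e * `|t| -> ~ A (s + u)].

(* A point of porosity is not a density point. *)
Lemma porous_null (R : realType) (A : set R) : closed A ->
  {ae lebesgue_measure, forall s, A s -> ~ porous_at A s}.
Proof.
move=> cA; have mA : measurable A by exact: closed_measurable.
apply: filterS (lebesgue_density mA); first exact: (ae_filter_ringOfSetsType lebesgue_measure).
move=> s + As [e e0 pA]; rewrite indicE mem_set//= => /fine_cvgP[_ /cvgrPdist_lt dens].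
(* The ball of radius [(1 + e) * |t|] around [s] contains the hole, which occupies the fraction
   [e / (1 + e) = 2 * c] of it; a density within [c] of 1 is then impossible. *)
pose c := e / (1 + e) / 2.
have c0 : 0 < c by rewrite !divr_gt0// addr_gt0.
have := dens c c0.
move=> /nbhs_ballP[d /= d0 dP].
have [t [tn0 td tA]] := pA (d / (1 + e)) (divr_gt0 d0 (addr_gt0 ltr01 e0)).
have t0 : 0 < `|t| by rewrite normr_gt0.
pose r := (1 + e) * `|t|.
have r0 : 0 < r by rewrite mulr_gt0// addr_gt0.
have rd : ball (0 : R) d r.
  rewrite /ball /= sub0r normrN gtr0_norm// /r mulrC -ltr_pdivlMr// addr_gt0//.
have := dP r rd r0.
suff : fine (lebesgue_measure (A `&` ball s r) * (lebesgue_measure (ball s r))^-1)%E <= 1 - c *+ 2.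
  rewrite /= => le1; rewrite ltNge => /negP; apply.
  rewrite (le_trans _ (ler_norm _))// lerBrDr -lerBrDl (le_trans le1)//.
  by rewrite lerD2l lerN2 mulr2n lerDl ltW.
have et0 : 0 <= e * `|t| by rewrite mulr_ge0// ltW.
have mB : measurable (ball s r) by exact: measurable_ball.
have mI : measurable (ball (s + t) (e * `|t|)) by exact: measurable_ball.
have mAB : measurable (A `&` ball s r) by exact: measurableI.
have subB : A `&` ball s r `|` ball (s + t) (e * `|t|) `<=` ball s r.
  move=> y [[]//|]; rewrite /ball /= => ty.
  rewrite /r mulrDl mul1r (_ : s - y = (s + t - y) - t); last by ring.
  by rewrite (le_lt_trans (ler_normB _ _))// addrC ltrD2l.
have disj : [disjoint A `&` ball s r & ball (s + t) (e * `|t|)].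
  apply/disj_set2P/seteqP; split => // y [[Ay _]]; rewrite /ball/= => ty.
  apply: (tA (y - s)); last by rewrite addrC subrK.
  rewrite (_ : y - s - t = - (s + t - y)); last by ring.
  by rewrite normrN ltW.
have : (lebesgue_measure (A `&` ball s r) + (e * `|t| *+ 2)%:E <= (r *+ 2)%:E)%E.
  rewrite -(lebesgue_measure_ball (s + t) et0) -(lebesgue_measure_ball s (ltW r0)).
  rewrite -measureU//; last exact/disj_set2P.
  by apply: le_measure => //; rewrite inE//; exact: measurableU.
rewrite lebesgue_measure_ball ?(ltW r0)// inver mulrn_eq0/= gt_eqF//.
have : (0 <= lebesgue_measure (A `&` ball s r))%E by exact: measure_ge0.
case: (lebesgue_measure _) => [m| |]//= m0; rewrite -EFinD lee_fin => mle.
rewrite ler_pdivrMr ?mulrn_wgt0// /c.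
have -> : (1 - e / (1 + e) / 2 *+ 2) * (r *+ 2) = r *+ 2 - e * `|t| *+ 2.
  by rewrite /r; field; rewrite gt_eqF// addr_gt0.
by rewrite lerBrDr.
Qed.

(** * Borel sets that are null on all coordinate lines *)

Definition borel (T : ptopologicalType) (B : set T) :=
  @measurable _ (g_sigma_algebraType (@open T)) B.

Lemma open_borel (T : ptopologicalType) (B : set T) : open B -> borel B.
Proof. exact: sub_sigma_algebra. Qed.

Lemma borelC (T : ptopologicalType) (B : set T) : borel B -> borel (~` B).
Proof. exact: (@measurableC _ (g_sigma_algebraType (@open T))). Qed.

Lemma closed_borel (T : ptopologicalType) (B : set T) : closed B -> borel B.
Proof. by move=> cB; rewrite -(setCK B); apply: borelC; apply: open_borel; rewrite openC. Qed.

Lemma borelI (T : ptopologicalType) (A B : set T) :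
  borel A -> borel B -> borel (A `&` B).
Proof. exact: (@measurableI _ (g_sigma_algebraType (@open T))). Qed.

Lemma borel_bigcup (T : ptopologicalType) (I : countType) (F : I -> set T) :
  (forall i, borel (F i)) -> borel (\bigcup_i F i).
Proof.
move=> mF; apply: (@countable_bigcupT_measurable _ (g_sigma_algebraType (@open T))) => //.
Qed.

Lemma borel_bigcap (T : ptopologicalType) (I : countType) (F : I -> set T) :
  (forall i, borel (F i)) -> borel (\bigcap_i F i).
Proof.
move=> mF; rewrite -(setCK (\bigcap_i _)) setC_bigcap.
by apply: borelC; apply: borel_bigcup => i; apply: borelC.
Qed.

Lemma borel_preimage_measurable d (T : measurableType d) (U : ptopologicalType)
    (h : T -> U) : (forall O, open O -> measurable (h @^-1` O)) ->
  forall B, borel B -> measurable (h @^-1` B).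
Proof.
move=> hO; apply: smallest_sub => //; split => /=.
- by rewrite preimage_set0.
- by move=> A mA; rewrite setTD preimage_setC; exact: measurableC.
- by move=> F mF; rewrite preimage_bigcup; exact: bigcupT_measurable.
Qed.

Lemma borel_preimage_continuous (T U : ptopologicalType) (h : T -> U) (B : set U) :
  continuous h -> borel B -> borel (h @^-1` B).
Proof.
move=> hc; apply: (@borel_preimage_measurable _ (g_sigma_algebraType (@open T))).
by move=> O oO; apply: open_borel; apply: open_comp => // x _; exact: hc.
Qed.

Lemma le_mx_norm (R : realType) m n (M : 'M[R]_(m, n)) i j : `|M i j| <= `|M|.
Proof.
rewrite {2}/Num.Def.normr /= mx_normrE.
by apply: (le_bigmax _ (fun ij : 'I_m * 'I_n => `|M ij.1 ij.2|) (i, j)).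
Qed.

Lemma mx_norm_le (R : realType) m n (M : 'M[R]_(m, n)) (c : R) :
  0 <= c -> (forall i j, `|M i j| <= c) -> `|M| <= c.
Proof.
by move=> c0 Mc; rewrite /Num.Def.normr /= mx_normrE; apply/bigmax_leP; split => // -[].
Qed.

Lemma mx_norm_lt (R : realType) m n (M : 'M[R]_(m, n)) (c : R) :
  0 < c -> (forall i j, `|M i j| < c) -> `|M| < c.
Proof.
by move=> c0 Mc; rewrite /Num.Def.normr /= mx_normrE; apply/bigmax_ltP; split => // -[].
Qed.

Lemma natSinv_lt (R : realType) (e : R) : 0 < e -> exists k : nat, k.+1%:R^-1 < e.
Proof.
move=> e0; have [k _ /(_ k (leqnn k)) ke] := near_infty_natSinv_lt (PosNum e0).
by exists k.
Qed.

Lemma rat_mx_approx (R : realType) m n (M : 'M[R]_(m, n)) (e : R) : 0 < e ->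
  exists Q : 'M[rat]_(m, n), `|M - map_mx ratr Q| < e.
Proof.
move=> e0.
have /choice[q qP] : forall ij : 'I_m * 'I_n, exists q : rat, `|M ij.1 ij.2 - ratr q| < e.
  move=> ij; have /rat_in_itvoo[q] : M ij.1 ij.2 - e < M ij.1 ij.2 + e by lra.
  rewrite in_itv/= => /andP[? ?]; exists q.
  by rewrite ltr_norml; apply/andP; split; lra.
exists (\matrix_(i, j) q (i, j)).
by apply: mx_norm_lt => // i j; rewrite !mxE; exact: (qP (i, j)).
Qed.

(** Balls of the maximum norm are boxes, so their preimages are finite intersections of coordinate
    preimages; an open set is the countable union of the rational balls it contains. *)
Lemma measurable_coord_preimage d (T : measurableType d) (R : realType) n
    (h : T -> 'rV[R]_n) : (forall j, measurable_fun setT (fun t => h t 0 j)) ->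
  forall B, borel B -> measurable (h @^-1` B).
Proof.
move=> mh; apply: borel_preimage_measurable => O oO.
have mball x r : 0 < r -> measurable (h @^-1` ball x r).
  move=> r0; have -> : h @^-1` ball x r = ~` \bigcup_j
      ~` (setT `&` (fun t => h t 0 j) @^-1` ball (x 0 j) r).
    rewrite setC_bigcup; apply/seteqP; split => t /=.
      rewrite -ball_normE => xr j _; rewrite setCK; split => //=.
      by rewrite -ball_normE /= (le_lt_trans _ xr)//; have := le_mx_norm (x - h t) 0 j; rewrite !mxE.
    move=> H; rewrite -ball_normE/=; apply: mx_norm_lt => // i j.
    by have := H j Logic.I; rewrite setCK ord1 !mxE /= -ball_normE => -[].
  apply: measurableC; apply: countable_bigcupT_measurable => // j.
  by apply/measurableC/mh => //; exact: measurable_ball.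
have -> : O = \bigcup_(ck : 'rV[rat]_n * nat)
    [set x | ball (map_mx ratr ck.1 : 'rV[R]_n) ck.2.+1%:R^-1 `<=` O /\
             ball (map_mx ratr ck.1 : 'rV[R]_n) ck.2.+1%:R^-1 x].
  apply/seteqP; split => [x Ox|x [ck _ /= [cO] /cO]//].
  have /nbhs_ballP[e /= e0 xeO] : nbhs x O by exact: open_nbhs_nbhs.
  have [k ke] := natSinv_lt (divr_gt0 e0 (ltr0Sn R 1)).
  have k0 : 0 < k.+1%:R^-1 :> R by rewrite invr_gt0.
  have [Q xQ] := rat_mx_approx x k0.
  exists (Q, k) => //=; rewrite -ball_normE /= distrC; split => // y /= Qy.
  apply: xeO; rewrite -ball_normE/= -(subrKA (map_mx ratr Q)).
  by rewrite (le_lt_trans (ler_normD _ _))// (splitr e) ltrD// (lt_trans _ ke).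
rewrite preimage_bigcup; apply: countable_bigcupT_measurable => // -[Q k] /=.
have [QO|QO] := pselect (ball (map_mx ratr Q : 'rV[R]_n) k.+1%:R^-1 `<=` O).
  rewrite (_ : _ @^-1` _ = h @^-1` ball (map_mx ratr Q : 'rV[R]_n) k.+1%:R^-1).
    by apply: mball; rewrite invr_gt0.
  by apply/seteqP; split => t // [].
by rewrite (_ : _ @^-1` _ = set0)//; apply/seteqP; split => t // [].
Qed.

(* The library's sigma-finite instance on [m1 \x m2] is shadowed by the one for
   products of subprobabilities; hence this alias. *)
Definition sigma_finite_prod d1 d2 (T1 : measurableType d1) (T2 : measurableType d2)
    (R : realType) (m1 : {sigma_finite_measure set T1 -> \bar R})
    (m2 : {sigma_finite_measure set T2 -> \bar R}) : set (T1 * T2) -> \bar R :=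
  (m1 \x m2)%E.

Section sigma_finite_prod.
Context d1 d2 (T1 : measurableType d1) (T2 : measurableType d2) (R : realType).
Variables (m1 : {sigma_finite_measure set T1 -> \bar R})
  (m2 : {sigma_finite_measure set T2 -> \bar R}).

HB.instance Definition _ := Measure.on (sigma_finite_prod m1 m2).

Let prodT : sigma_finite setT (sigma_finite_prod m1 m2).
Proof.
have /sigma_finiteP[F [FT ndF Foo]] := sigma_finiteT m1.
have /sigma_finiteP[G [GT ndG Goo]] := sigma_finiteT m2.
exists (fun k => F k `*` G k) => [|k].
  apply/seteqP; split => // -[a b] _.
  have [i _ Fa] : (\bigcup_i F i) a by rewrite -FT.
  have [j _ Gb] : (\bigcup_i G i) b by rewrite -GT.
  exists (maxn i j) => //; split => /=.
    exact: (subsetPset _ _ (ndF _ _ (leq_maxl i j))) Fa.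
  exact: (subsetPset _ _ (ndG _ _ (leq_maxr i j))) Gb.
have [[mF Fk] [mG Gk]] := (Foo k, Goo k); split; first exact: measurableX.
by rewrite /sigma_finite_prod product_measure1E// lte_mul_pinfty// ge0_fin_numE.
Qed.

HB.instance Definition _ :=
  Measure_isSigmaFinite.Build _ _ _ (sigma_finite_prod m1 m2) prodT.

End sigma_finite_prod.

Lemma measurable_row_mx_coord d (T : measurableType d) (R : realType) n
    (h : T -> 'rV[R]_n) : (forall j, measurable_fun setT (fun t => h t 0 j)) ->
  forall j : 'I_(1 + n), measurable_fun setT
    (fun z : measurableTypeR R * T => (row_mx (z.1)%:M (h z.2) : 'rV[R]_(1 + n)) 0 j).
Proof.
move=> mh j; case: (splitP j) => k jk.
    rewrite (_ : j = lshift n k); last exact/val_inj.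
    under eq_fun do rewrite row_mxEl ord1 !mxE eqxx mulr1n.
    exact: measurable_fst.
  rewrite (_ : j = rshift 1 k); last exact/val_inj.
  under eq_fun do rewrite row_mxEr.
  by apply: measurableT_comp (mh k) _; exact: measurable_snd.
Qed.

(** Induction step of [product_coordinates]. If [j] is the new coordinate, the lines in that
    direction are integrated first; otherwise each slice with the new coordinate fixed falls under
    the induction hypothesis. *)
Lemma null_lines_prod d (T : measurableType d) (R : realType) n
    (mu : {sigma_finite_measure set T -> \bar R}) (h : T -> 'rV[R]_n) :
  (forall j, measurable_fun setT (fun t => h t 0 j)) ->
  (forall B j, borel B ->
    (forall x, lebesgue_measure [set s : R | B (x + s *: delta_mx 0 j)] = 0%E) ->
    mu (h @^-1` B) = 0%E) ->
  forall (B : set 'rV[R]_n.+1) j, borel B ->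
    (forall x, lebesgue_measure [set s : R | B (x + s *: delta_mx 0 j)] = 0%E) ->
  sigma_finite_prod lebesgue_measure mu
    ((fun z => row_mx (z.1)%:M (h z.2) : 'rV_(1 + n)) @^-1` B) = 0%E.
Proof.
move=> mh null_h B j bB nB; have mh' := measurable_row_mx_coord mh.
have nB' (x : 'rV[R]_(1 + n)) :
  lebesgue_measure [set s : R | B (x + s *: delta_mx 0 (j : 'I_(1 + n)))] = 0%E.
  exact: nB.
have mB := measurable_coord_preimage mh' bB.
case: (splitP (j : 'I_(1 + n))) => k jk.
  have jE : j = lshift n k by exact/val_inj.
  rewrite jE in nB'.
  (* The order of integration is exchanged, so that the inner integral runs over the new
     coordinate. *)
  apply: etrans (product_measure_unique (m' := (lebesgue_measure \x^ mu)%E)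
    (fun A1 A2 => @product_measure2E _ _ _ _ _ _ _ A1 A2) mB) _.
  apply: integral0_eq => t _ /=.
  rewrite -[RHS](nB' (row_mx 0 (h t))); congr lebesgue_measure.
  have line s : (row_mx 0 (h t) : 'rV_(1 + n)) + s *: delta_mx 0 (lshift n k) = row_mx s%:M (h t).
    rewrite delta_mx_lshift scale_row_mx add_row_mx scaler0 addr0 add0r.
    by congr row_mx; apply/rowP => i; rewrite !mxE !ord1 !eqxx mulr1.
  by apply/seteqP; split => s /=; rewrite ysectionE/= -line.
have jE : j = rshift 1 k by exact/val_inj.
rewrite jE in nB'.
have cs (s : R) : continuous (fun c : 'rV[R]_n => row_mx s%:M c : 'rV[R]_(1 + n)).
  apply: (@klipschitz_continuous R 'rV[R]_n 'rV[R]_(1 + n) _ 1) => x y.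
  rewrite opp_row_mx add_row_mx subrr mul1r; apply: mx_norm_le => // i l.
  case: (split_ordP l) => l' ->; rewrite ?row_mxEl ?row_mxEr ?[in leLHS]mxE ?normr0//.
  by have := le_mx_norm (x - y) i l'; rewrite !mxE.
apply: integral0_eq => s _ /=.
rewrite -[RHS](null_h [set c | B (row_mx s%:M c : 'rV_(1 + n))] k).
- by congr (mu _); apply/seteqP; split => t /=; rewrite xsectionE.
- exact: (borel_preimage_continuous (cs s) bB).
- move=> x; rewrite -[RHS](nB' (row_mx s%:M x)); congr lebesgue_measure.
  have line u : (row_mx s%:M x : 'rV_(1 + n)) + u *: delta_mx 0 (rshift 1 k) =
      row_mx s%:M (x + u *: delta_mx 0 k).
    by rewrite delta_mx_rshift scale_row_mx add_row_mx scaler0 addr0.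
  by apply/seteqP; split => u /=; rewrite -line.
Qed.

(** A substitute for Lebesgue measure on R^n. Only nullity by Fubini and positivity on balls matter,
    so any measure space with a coordinate map serves; here it is an iterated product. *)
Lemma product_coordinates (R : realType) n :
  exists (d : measure_display) (T : measurableType d)
    (mu : {sigma_finite_measure set T -> \bar R}) (h : T -> 'rV[R]_n),
  [/\ forall j, measurable_fun setT (fun t => h t 0 j),
      forall B j, borel B ->
        (forall x, lebesgue_measure [set s : R | B (x + s *: delta_mx 0 j)] = 0%E) ->
        mu (h @^-1` B) = 0%E
    & forall x r, 0 < r -> (0 < mu (h @^-1` ball x r))%E].
Proof.
elim: n => [|n [d [T [mu [h [mh null_h pos_h]]]]]].
  exists _, unit, (\d_tt : {measure set unit -> \bar R}), (fun=> 0).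
  split=> [[]//|? []//|x r r0].
  rewrite (_ : _ @^-1` _ = setT); last first.
    by apply/seteqP; split => // -[] _ /=; rewrite (thinmx0 x); exact: ballxx.
  by have := @lte01 R; rewrite -{1}(diracT R tt).
exists _, (measurableTypeR R * T)%type, (sigma_finite_prod lebesgue_measure mu),
  (fun z => row_mx (z.1)%:M (h z.2) : 'rV_(1 + n)).
have mh' := measurable_row_mx_coord mh.
split => //; first exact: null_lines_prod.
  move=> x r r0.
  pose x1 : R := (x : 'rV_(1 + n)) 0 (lshift n ord0); pose x2 := rsubmx (x : 'rV_(1 + n)).
  have b0 : (0 < lebesgue_measure (ball x1 r))%E.
    by rewrite lebesgue_measure_ball ?ltW// lte_fin mulrn_wgt0.
  have mbox : measurable (h @^-1` ball x2 r).
    by apply: (measurable_coord_preimage mh); apply: open_borel; exact: ball_open.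
  apply: (@lt_le_trans _ _ (sigma_finite_prod lebesgue_measure mu
      (ball x1 r `*` (h @^-1` ball x2 r)))).
    rewrite /sigma_finite_prod product_measure1E//; last exact: measurable_ball.
    rewrite mule_gt0//; last exact: pos_h.
  apply: le_measure; rewrite ?inE.
  - by apply: measurableX => //; exact: measurable_ball.
  - by apply: (measurable_coord_preimage mh'); apply: open_borel; exact: ball_open.
  - move=> [s t] /= []; rewrite -!ball_normE /= => xs xt.
    have -> : x - (row_mx s%:M (h t) : 'rV_(1 + n)) =
        row_mx (lsubmx (x : 'rV_(1 + n)) - s%:M) (x2 - h t) :> 'rV_(1 + n).
      by rewrite -add_row_mx -opp_row_mx hsubmxK.
    apply: (@mx_norm_lt R 1 (1 + n)) => // i l.
    case: (split_ordP l) => l' ->; rewrite ?row_mxEl ?row_mxEr.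
      by rewrite (ord1 i) (ord1 l') !mxE /= mulr1n.
    by rewrite (le_lt_trans _ xt)//; exact: le_mx_norm.
Qed.

(** The sets [Z j] are null along different axes. Being null for the product measure, they are all
    null along the first axis over almost every base point, and positivity on balls puts such a base
    point near [x]. *)
Lemma null_lines_section (R : realType) n (Z : 'I_n.+1 -> set 'rV[R]_n.+1) :
  (forall j, borel (Z j)) ->
  (forall j x, lebesgue_measure [set s : R | Z j (x + s *: delta_mx 0 j)] = 0%E) ->
  forall (x : 'rV[R]_n) r, 0 < r -> exists2 c : 'rV[R]_n, ball x r c &
    {ae lebesgue_measure, forall s : R, forall j, ~ Z j (row_mx s%:M c)}.
Proof.
move=> bZ nZ x r r0.
have [d [T [mu [h [mh null_h pos_h]]]]] := product_coordinates R n.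
have aeZ j : {ae mu, forall t, lebesgue_measure [set s : R | Z j (row_mx s%:M (h t))] = 0%E}.
  have mB := measurable_coord_preimage (measurable_row_mx_coord mh) (bZ j).
  have := null_lines_prod mh null_h (bZ j) (nZ j).
  rewrite [X in X = _ -> _](_ : _ = (lebesgue_measure \x mu)%E
    ((fun z => row_mx (z.1)%:M (h z.2) : 'rV_(1 + n)) @^-1` Z j))//.
  have -> := product_measure_unique (m' := (lebesgue_measure \x^ mu)%E)
      (fun A1 A2 => @product_measure2E _ _ _ _ _ _ _ A1 A2) mB.
  move=> int0.
  have mf : measurable_fun setT (fun t => lebesgue_measure
      (ysection ((fun z => row_mx (z.1)%:M (h z.2) : 'rV_(1 + n)) @^-1` Z j) t)).
    exact: measurable_fun_ysection.
  have := (@ae_eq_integral_abs _ _ R mu setT measurableT _ mf).1.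
  have -> : (\int[mu]_x `|lebesgue_measure (ysection
      ((fun z => row_mx (z.1)%:M (h z.2) : 'rV_(1 + n)) @^-1` Z j) x)| = 0)%E.
    rewrite -[RHS]int0; apply: eq_integral => t _.
    by rewrite gee0_abs//; exact: measure_ge0.
  move=> /(_ erefl); rewrite /ae_eq; apply: (@filterS _ _ (ae_filter_ringOfSetsType mu)).
  move=> t /(_ Logic.I) /= t0; rewrite -[RHS]t0; congr (lebesgue_measure _).
  by apply/seteqP; split => s /=; rewrite ysectionE.
have [N [mN N0 NZ]] : {ae mu, forall t j, lebesgue_measure [set s : R | Z j (row_mx s%:M (h t))] = 0%E}.
  exact: (@filter_forall _ _ _ _ (ae_filter_ringOfSetsType mu)).
have [t xt tZ] : exists2 t, ball x r (h t) & forall j,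
    lebesgue_measure [set s : R | Z j (row_mx s%:M (h t))] = 0%E.
  apply: contrapT => noex.
  have : (0 < mu N)%E.
    apply: lt_le_trans (pos_h x r r0) _; apply: le_measure; rewrite ?inE//.
      by apply: (measurable_coord_preimage mh); apply: open_borel; exact: ball_open.
    by move=> t xt; apply: NZ => /= tZ; apply: noex; exists t.
  by rewrite N0 ltxx.
exists (h t) => //.
apply: (@filter_forall _ _ _ _ (ae_filter_ringOfSetsType lebesgue_measure)) => j.
exists [set s : R | Z j (row_mx s%:M (h t))]; split => //.
- have := measurable_coord_preimage (measurable_row_mx_coord mh) (bZ j).
  move=> /(measurable_ysection t); rewrite ysectionE; exact.
- exact: tZ.
- by move=> s /= /contrapT.
Qed.

(** * Matrix norms and Jacobians as first-order approximations *)

Lemma mx_norm_mulmx (R : realType) m n p (A : 'M[R]_(m, n)) (B : 'M[R]_(n, p)) :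
  `|A *m B| <= n%:R * `|A| * `|B|.
Proof.
apply: mx_norm_le => [|i j]; first by rewrite !mulr_ge0.
rewrite mxE (le_trans (ler_norm_sum _ _ _))//.
have -> : n%:R * `|A| * `|B| = \sum_(k < n) `|A| * `|B|.
  by rewrite sumr_const card_ord -mulrA mulr_natl.
by apply: ler_sum => k _; rewrite normrM ler_pM// le_mx_norm.
Qed.

Lemma mulmxr_continuous (R : realType) m n p (B : 'M[R]_(n, p)) :
  continuous (fun A : 'M[R]_(m, n) => A *m B).
Proof.
apply: (@klipschitz_continuous R 'M[R]_(m, n) 'M[R]_(m, p) _ (n%:R * `|B|)) => x y.
by rewrite -mulmxBl mulrAC mx_norm_mulmx.
Qed.

Lemma jacobian_approx (R : realType) n m (g : 'rV[R]_n -> 'rV[R]_m) x e :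
  differentiable g x -> 0 < e ->
  \forall h \near (0 : 'rV[R]_n), `|g (x + h) - g x - h *m 'J g x| <= e * `|h|.
Proof.
move=> /diff_locallyP[_ gx] e0.
have /eqaddoP /(_ e e0) := gx.
apply: filterS => h /=.
by rewrite /jacobian mul_rV_lin1 -addrA -opprD (addrC x).
Qed.

Lemma jacobian_unique (R : realType) n m (g : 'rV[R]_n -> 'rV[R]_m) x a :
  (forall e, 0 < e ->
     \forall h \near (0 : 'rV[R]_n), `|g (x + h) - g x - h *m a| <= e * `|h|) ->
  differentiable g x /\ 'J g x = a.
Proof.
move=> ga.
have ac : continuous (mulmxr a : {linear 'rV[R]_n -> 'rV[R]_m}).
  exact: mulmxr_continuous.
have gx : g \o shift x = cst (g x) + mulmxr a +o_ (0 : 'rV[R]_n) id.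
  apply/eqaddoP => e e0; apply: filterS (ga e e0) => h.
  by rewrite -addrA -opprD (addrC x).
have dg := diff_unique ac gx.
split.
  by apply/diff_locallyP; rewrite dg; split => //; exact: ac.
apply/row_matrixP => i; rewrite !rowE /jacobian mul_rV_lin1.
by rewrite dg.
Qed.

(** * Differentiability on almost every line *)

(** Thresholds of the form [1 / (p + 1)] make the quantifiers countable. For fixed thresholds the
    hole is a compact segment avoiding a closed set, which survives small moves of [x], so the
    condition is open. *)
Lemma borel_porous (R : realType) n (A : set 'rV[R]_n) (v : 'rV[R]_n) :
  closed A -> borel [set x | A x /\ porous_at [set s : R | A (x + s *: v)] 0].
Proof.
move=> cA.
pose O (p r : nat) := [set x : 'rV[R]_n | exists t : R, [/\ t != 0, `|t| < r.+1%:R^-1 &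
  forall u, `|u - t| <= p.+1%:R^-1 * `|t| -> ~ A (x + u *: v)]].
have -> : [set x | A x /\ porous_at [set s : R | A (x + s *: v)] 0] =
    A `&` \bigcup_p \bigcap_r O p r.
  apply/seteqP; split => x /= [Ax].
    move=> [e e0 px]; split => //.
    have [p pe] := natSinv_lt e0; exists p => // r _.
    have [t [t0 tr tA]] := px r.+1%:R^-1 ltac:(by rewrite invr_gt0).
    exists t; split => // u ut; have := tA u; rewrite /= add0r; apply.
    by rewrite (le_trans ut)// ler_wpM2r// ltW.
  move=> [p _ xO]; split => //; exists p.+1%:R^-1; first by rewrite invr_gt0.
  move=> d /natSinv_lt[r rd]; have [t [t0 tr tA]] := xO r Logic.I.
  by exists t; split => // [|u]; [exact: lt_trans rd|rewrite add0r; exact: tA].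
apply: borelI; first exact: closed_borel.
apply: borel_bigcup => p; apply: borel_bigcap => r; apply: open_borel.
rewrite openE => x [t [t0 tr tA]]; rewrite /interior /=.
have /compact_near_coveringP : compact `[t - p.+1%:R^-1 * `|t|, t + p.+1%:R^-1 * `|t|].
  exact: segment_compact.
move=> /(_ _ (nbhs x) (fun y u => ~ A (y + u *: v)) _) H.
have {H} : \forall y \near x,
    `[t - p.+1%:R^-1 * `|t|, t + p.+1%:R^-1 * `|t|] `<=` (fun u => ~ A (y + u *: v)).
  apply: H => u; rewrite /= in_itv/= -ler_distl => /tA uA.
  have cf : {for (u, x), continuous (fun z : R * 'rV[R]_n => z.2 + z.1 *: v)}.
    by apply: cvgD; [exact: cvg_snd|apply: cvgZr_tmp; exact: cvg_fst].
  by apply: (cf (~` A)); apply: open_nbhs_nbhs; split => //; rewrite openC.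
apply: filterS => y yA; exists t; split => // u ut.
by apply: yA; rewrite /= in_itv/= -ler_distl.
Qed.

Lemma ae_forall_count d (T : measurableType d) (R : realType)
    (mu : {measure set T -> \bar R}) (I : countType) (P : I -> T -> Prop) :
  (forall i, {ae mu, forall t, P i t}) -> {ae mu, forall t i, P i t}.
Proof.
move=> aeP; have aen n : {ae mu, forall t, if unpickle n is Some i then P i t else True}.
  by case: (unpickle n) => [i|]; [exact: aeP|exact: aeW].
apply: (@filterS _ _ (ae_filter_ringOfSetsType mu)) (ae_foralln aen) => t Pt i.
by have := Pt (pickle i); rewrite pickleK.
Qed.

Lemma is_derive_approx (R : realType) (phi : R -> R) (s c e : R) :
  is_derive s (1 : R) phi c -> 0 < e ->
  \forall t \near (0 : R), `|phi (s + t) - phi s - t * c| <= e * `|t|.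
Proof.
move=> [/derivable_nbhsP/eqaddoP + <-] e0 => /(_ e e0).
apply: filterS => t; congr (`|_| <= _).
by rewrite !fctE /= /GRing.scale /= mulr1 opprD addrA (addrC s).
Qed.

Lemma measure_line_null (R : realType) n (B : set 'rV[R]_n) (x v : 'rV[R]_n) :
  borel B -> {ae lebesgue_measure, forall s : R, ~ B (x + s *: v)} ->
  lebesgue_measure [set s : R | B (x + s *: v)] = 0%E.
Proof.
move=> bB aeB; apply/negligibleP.
  have lc : continuous (fun s : R => x + s *: v).
    apply: (@klipschitz_continuous R R 'rV[R]_n _ `|v|) => s t.
    by rewrite opprD addrACA subrr add0r -scalerBl normrZ mulrC.
  apply: (borel_preimage_measurable _ bB) => O oO.
  by apply: open_measurable; apply: open_comp => // s _; exact: lc.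
move: aeB => [N [mN N0 NB]]; exists N; split => // s /= Bs; apply: NB => /=.
exact.
Qed.

Section rademacher.
Variables (R : realType) (n m : nat) (G : 'rV[R]_n -> 'rV[R]_m) (L : R).
Hypothesis L0 : 0 <= L.
Hypothesis GL : forall x y, `|G x - G y| <= L * `|x - y|.

(** Error and radius are fixed so that the set of base points is closed; derivatives as limits would
    not give this. *)
Definition tail_approx (k : nat) (a : 'M[R]_(n, m)) (e d : R) : set 'rV[R]_n :=
  [set x | forall h : 'rV[R]_n, (forall i : 'I_n, (i < k)%N -> h 0 i = 0) ->
     `|h| <= d -> `|G (x + h) - G x - h *m a| <= e * `|h|].

(* Differentiability along the coordinates of index at least [k], with rational
   approximate differentials so that countable unions suffice. *)
Definition tail_diff (k : nat) (x : 'rV[R]_n) :=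
  forall p : nat, exists Q : 'M[rat]_(n, m), exists r : nat,
    tail_approx k (map_mx ratr Q) p.+1%:R^-1 r.+1%:R^-1 x.

Definition partial_approx (k : 'I_n) (b : 'rV[R]_m) (e d : R) : set 'rV[R]_n :=
  [set x | forall t : R, `|t| <= d ->
     `|G (x + t *: delta_mx 0 k) - G x - t *: b| <= e * `|t|].

Definition partial_diff (k : 'I_n) (x : 'rV[R]_n) :=
  forall p : nat, exists Q : 'rV[rat]_m, exists r : nat,
    partial_approx k (map_mx ratr Q) p.+1%:R^-1 r.+1%:R^-1 x.

(** The exceptional set of [tail_diff_step]. Off it, the points of the [k]-th coordinate line
    sharing a tail approximation with [x] are so dense near [x] that any small displacement can be
    corrected to reach one of them. *)
Definition tail_porous (k : 'I_n) : set 'rV[R]_n :=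
  \bigcup_(z : 'M[rat]_(n, m) * nat * nat) [set x |
    let A := tail_approx k.+1 (map_mx ratr z.1.1) z.1.2.+1%:R^-1 z.2.+1%:R^-1 in
    A x /\ porous_at [set s : R | A (x + s *: delta_mx 0 k)] 0].

Lemma closed_increment (h : 'rV[R]_n) (b : 'rV[R]_m) (c : R) :
  closed [set x | `|G (x + h) - G x - b| <= c].
Proof.
have cN : continuous (fun x : 'rV[R]_n => `|G (x + h) - G x - b| : R).
  apply: (@klipschitz_continuous R 'rV[R]_n R _ (L + L)) => x y.
  rewrite (le_trans (ler_dist_dist _ _))//.
  rewrite (_ : _ - _ = (G (x + h) - G (y + h)) - (G x - G y)); last first.
    by apply/rowP => i; rewrite !mxE; ring.
  rewrite (le_trans (ler_normB _ _))// mulrDl lerD ?(le_trans (GL _ _))//.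
  by rewrite opprD addrACA subrr addr0.
rewrite (_ : [set x | _] = (fun x => `|G (x + h) - G x - b|) @^-1` [set y | y <= c])//.
by apply: preimage_closed => [x _|]; [exact: cN|exact: closed_le].
Qed.

Lemma closed_tail_approx k a e d : closed (tail_approx k a e d).
Proof.
rewrite (_ : tail_approx k a e d = \bigcap_(h in [set h : 'rV[R]_n |
   (forall i : 'I_n, (i < k)%N -> h 0 i = 0) /\ `|h| <= d])
   [set x | `|G (x + h) - G x - h *m a| <= e * `|h|]).
  by apply: closed_bigI => h _; exact: closed_increment.
by apply/seteqP; split => x /= H h; [case; exact: H|move=> ? ?; exact: H].
Qed.

Lemma closed_partial_approx k b e d : closed (partial_approx k b e d).
Proof.
rewrite (_ : partial_approx k b e d = \bigcap_(t in [set t : R | `|t| <= d])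
   [set x | `|G (x + t *: delta_mx 0 k) - G x - t *: b| <= e * `|t|])//.
by apply: closed_bigI => t _; exact: closed_increment.
Qed.

Lemma borel_tail_porous k : borel (tail_porous k).
Proof.
by apply: borel_bigcup => z; apply: borel_porous; exact: closed_tail_approx.
Qed.

Lemma borel_partial_diff k : borel (partial_diff k).
Proof.
rewrite (_ : partial_diff k = \bigcap_p \bigcup_(z : 'rV[rat]_m * nat)
   partial_approx k (map_mx ratr z.1) p.+1%:R^-1 z.2.+1%:R^-1).
  apply: borel_bigcap => p; apply: borel_bigcup => z.
  by apply: closed_borel; exact: closed_partial_approx.
apply/seteqP; split => x /= H p.
  by move=> _; have [Q [r xQ]] := H p; exists (Q, r).
by have [[Q r] _ xQ] := H p Logic.I; exists Q, r.
Qed.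

Lemma ae_tail_porousN k x :
  {ae lebesgue_measure, forall s : R, ~ tail_porous k (x + s *: delta_mx 0 k)}.
Proof.
suff : {ae lebesgue_measure, forall (s : R) (z : 'M[rat]_(n, m) * nat * nat),
    let A := tail_approx k.+1 (map_mx ratr z.1.1) z.1.2.+1%:R^-1 z.2.+1%:R^-1 in
    A (x + s *: delta_mx 0 k) ->
    ~ porous_at [set u : R | A (x + s *: delta_mx 0 k + u *: delta_mx 0 k)] 0}.
  apply: (@filterS _ _ (ae_filter_ringOfSetsType lebesgue_measure)) => s Hs [z _ /= [Az pz]].
  exact: (Hs z Az pz).
apply: ae_forall_count => z /=; set A := tail_approx _ _ _ _.
have cA : closed [set s : R | A (x + s *: delta_mx 0 k)].
  have lc : continuous (fun s : R => x + s *: delta_mx 0 k : 'rV[R]_n).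
    apply: (@klipschitz_continuous R R 'rV[R]_n _ `|delta_mx 0 k : 'rV[R]_n|) => s t.
    by rewrite opprD addrACA subrr add0r -scalerBl normrZ mulrC.
  by apply: preimage_closed => [s _|]; [exact: lc|exact: closed_tail_approx].
apply: (@filterS _ _ (ae_filter_ringOfSetsType lebesgue_measure)) (porous_null cA) => s.
move=> /= Hs /Hs {}Hs [e e0 pe]; apply: Hs; exists e => // d d0.
have [t [t0 td tA]] := pe d d0; exists t; split => // u /tA /=.
by rewrite add0r scalerDl addrA.
Qed.

Lemma ae_partial_diff k x :
  {ae lebesgue_measure, forall s : R, partial_diff k (x + s *: delta_mx 0 k)}.
Proof.
pose phi (j : 'I_m) s := G (x + s *: delta_mx 0 k) 0 j.
have phiL j s t : `|phi j s - phi j t| <= L * `|s - t|.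
  have := le_mx_norm (G (x + s *: delta_mx 0 k) - G (x + t *: delta_mx 0 k)) 0 j.
  rewrite !mxE => /le_trans; apply; rewrite (le_trans (GL _ _))// ler_wpM2l//.
  rewrite opprD addrACA subrr add0r -scalerBl; apply: mx_norm_le => // i l.
  by rewrite !mxE normrM ler_piMr//; case: (_ && _); rewrite ?normr1 ?normr0.
(* Derivability is available on bounded intervals; countably many of them cover the line. *)
have : {ae lebesgue_measure, forall (s : R) (z : nat * 'I_m),
    - z.1.+1%:R < s < z.1.+1%:R -> exists c, is_derive s (1 : R) (phi z.2) c}.
  apply: ae_forall_count => -[N j] /=.
  have N2 : - N.+1%:R < N.+1%:R :> R by rewrite gtrN.
  have [f [_ _ fD]] := lipschitz_ae_derivable (phiL j) N2.
  apply: (@filterS _ _ (ae_filter_ringOfSetsType lebesgue_measure)) fD => s Hs sN.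
  by exists (f s); exact: Hs.
apply: (@filterS _ _ (ae_filter_ringOfSetsType lebesgue_measure)) => s Hs p.
have /choice[c cD] : forall j, exists c, is_derive s (1 : R) (phi j) c.
  move=> j; have [N sN] : exists N : nat, `|s| < N.+1%:R.
    exists (Num.bound `|s|); rewrite (lt_trans (archi_boundP (normr_ge0 s)))//.
    by rewrite ltr_nat.
  by apply: (Hs (N, j)); rewrite /= -ltr_norml.
(* Half of the error is for the remainder of the derivative, half for its rational approximation. *)
have e0 : 0 < p.+1%:R^-1 / 2 :> R by rewrite divr_gt0// invr_gt0.
have [Q cQ] := rat_mx_approx (\row_j c j) e0.
have : \forall t \near (0 : R), forall j, `|phi j (s + t) - phi j s - t * c j| <= p.+1%:R^-1 / 2 * `|t|.
  apply: (@filter_forall R 'I_m (fun j t => `|phi j (s + t) - phi j s - t * c j|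
    <= p.+1%:R^-1 / 2 * `|t|) (nbhs (0 : R))) => j.
  exact: is_derive_approx.
move=> /nbhs_ballP[d /= d0 dP]; have [r rd] := natSinv_lt d0.
exists Q, r => t tr; apply: mx_norm_le => [|i j]; first by rewrite mulr_ge0// invr_ge0.
have /(dP _) /(_ j) : ball (0 : R) d t by rewrite /ball /= sub0r normrN (le_lt_trans tr).
rewrite ord1 /phi !mxE scalerDl addrA => Ht.
rewrite (_ : _ - _ = G (x + s *: delta_mx 0 k + t *: delta_mx 0 k) 0 j -
    G (x + s *: delta_mx 0 k) 0 j - t * c j
   + t * (c j - ratr (Q 0 j))); last by ring.
rewrite (le_trans (ler_normD _ _))// (splitr p.+1%:R^-1) mulrDl lerD// normrM mulrC.
rewrite ler_wpM2r//; have := le_mx_norm (\row_j c j - map_mx ratr Q) 0 j.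
by rewrite !mxE => /le_trans; apply; exact: ltW.
Qed.

(** Split [h] into its [k]-th entry [t] and a tail [h']. The tail approximation holds at [x] but is
    needed after the move by [t], where it may fail. Without porosity it holds, with the same matrix
    and radius, after a move by some [u] within [e * |t|] of [t], and the Lipschitz bound pays for
    the correction. *)
Lemma tail_diff_step (k : 'I_n) x :
  tail_diff k.+1 x -> partial_diff k x -> ~ tail_porous k x -> tail_diff k x.
Proof.
move=> Dx Px nporx p.
(* The total error: two approximations costing [e] each and two corrections of the base point
   costing [L * e] each. *)
have C0 : 0 < 2 * L + 2 by rewrite ltr_wpDl// mulr_ge0.
have p0 : 0 < p.+1%:R^-1 :> R by rewrite invr_gt0.
have [q] := natSinv_lt (divr_gt0 p0 C0).
have [Q1 [r1 Ax]] := Dx q; have [Q2 [r2 Bx]] := Px q.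
have q0 : 0 < q.+1%:R^-1 :> R by rewrite invr_gt0.
set e : R := q.+1%:R^-1 in Ax Bx q0 *; rewrite ltr_pdivlMr// => eC.
have [d d0 dA] : exists2 d : R, 0 < d & forall t : R, t != 0 -> `|t| < d ->
    exists2 u, `|u - t| <= e * `|t| &
      tail_approx k.+1 (map_mx ratr Q1) e r1.+1%:R^-1 (x + u *: delta_mx 0 k).
  apply: contrapT => nd; apply: nporx; exists (Q1, q, r1) => //=; split => //.
  exists e => // d d0; apply: contrapT => nt; apply: nd; exists d => // t t0 td.
  apply: contrapT => nu; apply: nt; exists t; split => // u ut; rewrite /= add0r => Au.
  by apply: nu; exists u.
pose Q : 'M[rat]_(n, m) := \matrix_(i, j) if i == k then Q2 0 j else Q1 i j.
have dmin : 0 < Num.min d (Num.min r1.+1%:R^-1 r2.+1%:R^-1).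
  by rewrite !lt_min d0 !invr_gt0/= !ltr0n.
have [r] := natSinv_lt dmin; rewrite !lt_min => /and3P[rd /ltW rr1 /ltW rr2].
exists Q, r => h hk hr; pose t := h 0 k; pose h' := h - t *: delta_mx 0 k.
have th : `|t| <= `|h| by exact: le_mx_norm.
have h'E i : h' 0 i = if i == k then 0 else h 0 i.
  rewrite !mxE eqxx/=; case: eqVneq => [->|_]; first by rewrite mulr1 subrr.
  by rewrite mulr0 subr0.
have h'h : `|h'| <= `|h|.
  apply: mx_norm_le => // i j; rewrite ord1 h'E.
  by case: ifP => _; rewrite ?normr0//; exact: le_mx_norm.
have h'k (i : 'I_n) : (i < k.+1)%N -> h' 0 i = 0.
  move=> ik; rewrite h'E; case: (eqVneq i k) => // nik; apply: hk.
  move: ik; rewrite ltnS leq_eqVlt => /orP[/eqP ik|//].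
  by move: nik; rewrite (val_inj ik) eqxx.
have hQ : h *m map_mx ratr Q = t *: map_mx ratr Q2 + h' *m map_mx ratr Q1 :> 'rV[R]_m.
  apply/rowP => j; rewrite !mxE (bigD1 k)//= [in RHS](bigD1 k)//= h'E eqxx mul0r add0r.
  rewrite !mxE eqxx; congr (_ + _); apply: eq_bigr => i ik.
  by rewrite h'E !mxE (negPf ik).
have hE : h = t *: delta_mx 0 k + h' by rewrite addrC subrK.
have h'r1 : `|h'| <= r1.+1%:R^-1 by rewrite (le_trans h'h)// (le_trans hr).
(* Porosity speaks only of [t != 0]; for [t = 0] the tail approximation at [x] itself suffices. *)
have [t0|t0] := eqVneq t 0.
  have hh' : h' = h by rewrite [RHS]hE t0 scale0r add0r.
  rewrite hQ t0 scale0r add0r -hh'.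
  rewrite (le_trans (Ax _ h'k h'r1))// ler_wpM2r// (le_trans _ (ltW eC))//.
  by rewrite ler_peMr ?(ltW q0)//; move: L0; lra.
have [u ut Au] := dA t t0 (le_lt_trans th (le_lt_trans hr rd)).
have Ah := Au h' h'k h'r1.
have Bt := Bx t (le_trans th (le_trans hr rr2)).
have n1 : `|delta_mx 0 k : 'rV[R]_n| <= 1.
  apply: mx_norm_le => // i j; rewrite mxE.
  by case: (_ && _); rewrite ?normr1 ?normr0.
have utL v w : v - w = (t - u) *: delta_mx 0 k -> `|G v - G w| <= L * (e * `|h|).
  move=> vw; rewrite (le_trans (GL _ _))// ler_wpM2l// vw normrZ.
  rewrite (le_trans (ler_piMr _ n1))// distrC (le_trans ut)// ler_wpM2l// ltW//.
have G1 : `|G (x + h) - G (x + u *: delta_mx 0 k + h')| <= L * (e * `|h|).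
  by apply: utL; apply/rowP => i; rewrite /h' !mxE; ring.
have G2 : `|G (x + u *: delta_mx 0 k) - G (x + t *: delta_mx 0 k)| <= L * (e * `|h|).
  by rewrite distrC; apply: utL; rewrite opprD addrACA subrr add0r scalerBl.
rewrite hQ.
have -> : G (x + h) - G x - (t *: map_mx ratr Q2 + h' *m map_mx ratr Q1) =
   (G (x + h) - G (x + u *: delta_mx 0 k + h')) +
   (G (x + u *: delta_mx 0 k + h') - G (x + u *: delta_mx 0 k) - h' *m map_mx ratr Q1) +
   (G (x + u *: delta_mx 0 k) - G (x + t *: delta_mx 0 k)) +
   (G (x + t *: delta_mx 0 k) - G x - t *: map_mx ratr Q2).
  move: (h' *m _) (t *: map_mx _ _) => A1 A2.
  by apply/rowP => i; rewrite !mxE; ring.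
apply: (@le_trans _ _ ((2 * L + 2) * e * `|h|)); last first.
  by rewrite ler_wpM2r// mulrC ltW.
have -> : (2 * L + 2) * e * `|h| = L * (e * `|h|) + e * `|h| + L * (e * `|h|) + e * `|h|.
  by ring.
rewrite (le_trans (ler_normD _ _))// lerD//; last first.
  by rewrite (le_trans Bt)// ler_wpM2l// ltW.
rewrite (le_trans (ler_normD _ _))// lerD// (le_trans (ler_normD _ _))// lerD//.
by rewrite (le_trans Ah)// ler_wpM2l// ltW.
Qed.

(** Two approximate differentials, tested on the same small multiple of a basis vector, differ by at
    most the sum of their errors. The rational matrices are therefore Cauchy, and their limit is the
    Jacobian. *)
Lemma tail_diff0_differentiable x : tail_diff 0 x -> differentiable G x.
Proof.
move=> /choice[Q /choice[r Ax]].
have no0 (h : 'rV[R]_n) (i : 'I_n) : (i < 0)%N -> h 0 i = 0 by [].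
pose a p : 'M[R]_(n, m) := map_mx ratr (Q p).
have a_close p q i j : `|a p i j - a q i j| <= p.+1%:R^-1 + q.+1%:R^-1.
  pose t : R := Num.min (r p).+1%:R^-1 (r q).+1%:R^-1.
  have t0 : 0 < t by rewrite lt_min !invr_gt0 !ltr0n.
  have ht : `|t *: delta_mx 0 i : 'rV[R]_n| <= t.
    apply: mx_norm_le => [|i' j']; first exact: ltW.
    rewrite !mxE normrM gtr0_norm// ler_piMr ?(ltW t0)//.
    by case: (_ && _); rewrite ?normr1 ?normr0.
  have tp : t <= (r p).+1%:R^-1 by rewrite ge_min lexx.
  have tq : t <= (r q).+1%:R^-1 by rewrite ge_min lexx orbT.
  have Ap := Ax p (t *: delta_mx 0 i) (no0 _) (le_trans ht tp).
  have Aq := Ax q (t *: delta_mx 0 i) (no0 _) (le_trans ht tq).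
  have := le_mx_norm ((t *: delta_mx 0 i : 'rV[R]_n) *m (a p - a q)) 0 j.
  rewrite -scalemxAl -rowE !mxE normrM (gtr0_norm t0) => H.
  rewrite -(ler_pM2l t0) (le_trans H)//.
  set h := t *: delta_mx 0 i in Ap Aq ht.
  have -> : t *: row i (a p - a q) = (G (x + h) - G x - h *m a q) - (G (x + h) - G x - h *m a p).
    rewrite rowE scalemxAl -/h mulmxBr; move: (h *m a p) (h *m a q) => A1 A2.
    by apply/rowP => i'; rewrite !mxE; ring.
  rewrite (le_trans (ler_normB _ _))// mulrDr addrC.
  by rewrite lerD// mulrC (le_trans _ (ler_wpM2l _ ht)) ?invr_ge0.
have /choice[b bP] : forall ij : 'I_n * 'I_m, exists c : R,
    (fun p => a p ij.1 ij.2) @ \oo --> c.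
  move=> ij; apply/cvg_ex; apply: cauchy_cvg; apply: cauchy_exP => e e0.
  have [p pe] := natSinv_lt (divr_gt0 e0 (ltr0Sn R 1)).
  exists (a p ij.1 ij.2); exists p => // q /= pq.
  rewrite /ball /= (le_lt_trans (a_close p q ij.1 ij.2))// (splitr e).
  rewrite ltrD// (le_lt_trans _ pe)// lef_pV2 ?posrE//.
  by rewrite ler_nat.
pose aa : 'M[R]_(n, m) := \matrix_(i, j) b (i, j).
(* For one [q >= p], the distance from [a p] to [a q] counts twice and that from [a q] to the limit
   once. *)
have aaE p : `|a p - aa| <= 3 * p.+1%:R^-1.
  apply: mx_norm_le => [|i j]; first by rewrite mulr_ge0.
  rewrite (_ : (a p - aa) i j = a p i j - b (i, j)); last by rewrite !mxE.
  have /cvgrPdist_le /(_ p.+1%:R^-1) := bP (i, j).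
  rewrite invr_gt0 ltr0n => /(_ isT)[N _ HN].
  have Hq := HN (maxn N p) (leq_maxl _ _); rewrite /= distrC in Hq.
  have Hp : (maxn N p).+1%:R^-1 <= p.+1%:R^-1 :> R.
    by rewrite lef_pV2 ?posrE// ler_nat ltnS leq_maxr.
  rewrite (le_trans (ler_distD (a (maxn N p) i j) _ _))//.
  rewrite (_ : 3 * _ = p.+1%:R^-1 + p.+1%:R^-1 + p.+1%:R^-1); last by ring.
  by rewrite lerD// (le_trans (a_close _ _ _ _))// lerD2l.
have [] // := @jacobian_unique R n m G x aa.
move=> e e0; have n0 : 0 < 1 + 3 * n%:R :> R by rewrite ltr_pwDl// mulr_ge0.
have [p] := natSinv_lt (divr_gt0 e0 n0); rewrite ltr_pdivlMr// => pe.
have : \forall h \near (0 : 'rV[R]_n), `|h| <= (r p).+1%:R^-1.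
  apply/nbhs_ballP; exists (r p).+1%:R^-1; rewrite /= ?invr_gt0 ?ltr0n// => h.
  by rewrite -ball_normE /= sub0r normrN => /ltW.
apply: filterS => h hr.
have Aph := Ax p h (no0 _) hr.
have -> : G (x + h) - G x - h *m aa = (G (x + h) - G x - h *m a p) + h *m (a p - aa).
  by rewrite mulmxBr addrA subrK.
rewrite (le_trans (ler_normD _ _))//.
apply: (@le_trans _ _ (p.+1%:R^-1 * `|h| + n%:R * `|h| * (3 * p.+1%:R^-1))).
  rewrite lerD// (le_trans (mx_norm_mulmx _ _))// ler_wpM2l// mulr_ge0//.
rewrite (_ : _ + _ = p.+1%:R^-1 * (1 + 3 * n%:R) * `|h|); last by ring.
by rewrite ler_wpM2r// ltW.
Qed.

Lemma ae_differentiable_step x :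
  (forall k, partial_diff k x) -> (forall k, ~ tail_porous k x) -> differentiable G x.
Proof.
move=> Px nporx; apply: tail_diff0_differentiable.
suff H (k : nat) : (k <= n)%N -> tail_diff (n - k) x by rewrite -(subnn n); exact: H.
elim: k => [_ p|k IH kn].
  exists 0, 0%N => h h0 _; rewrite subn0 in h0.
  have -> : h = 0 by apply/rowP => i; rewrite h0// mxE.
  by rewrite addr0 subrr mul0mx subrr !normr0 mulr0.
have nk : (n - k.+1 < n)%N by rewrite ltn_subrL (leq_ltn_trans _ kn).
apply: (@tail_diff_step (Ordinal nk)) => //=.
by rewrite subnSK//; apply: IH; exact: ltnW.
Qed.

End rademacher.

Lemma rademacher_lines (R : realType) n m (G : 'rV[R]_n.+1 -> 'rV[R]_m) (L : R) :
  (forall x y, `|G x - G y| <= L * `|x - y|) ->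
  forall (x : 'rV[R]_n) r, 0 < r -> exists2 c : 'rV[R]_n, ball x r c &
    {ae lebesgue_measure, forall s : R, differentiable G (row_mx s%:M c : 'rV_(1 + n))}.
Proof.
move=> GL x r r0.
wlog L0 : L GL / 0 <= L => [hw|].
  apply: (hw `|L|) => // y z; rewrite (le_trans (GL y z))// ler_wpM2r//.
  exact: ler_norm.
pose Z k := ~` partial_diff G k `|` tail_porous G k.
have bZ k : borel (Z k).
  rewrite -[Z k]setCK setCU setCK; apply: borelC; apply: borelI.
    exact: borel_partial_diff GL _.
  apply: borelC; exact: borel_tail_porous GL _.
have nZ j y : lebesgue_measure [set s : R | Z j (y + s *: delta_mx 0 j)] = 0%E.
  apply: measure_line_null (bZ j) _.
  apply: (@filterS2 _ _ (ae_filter_ringOfSetsType lebesgue_measure)) (ae_partial_diff L0 GL j y)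
    (ae_tail_porousN GL j y) => s /= Ps Ts [|].
    exact.
  exact.
have [c xc cZ] := null_lines_section bZ nZ x r0.
exists c => //; apply: (@filterS _ _ (ae_filter_ringOfSetsType lebesgue_measure)) cZ => s sZ.
apply: (ae_differentiable_step L0 GL) => k.
  by apply: contrapT => ?; apply: (sZ k); left.
by move=> ?; apply: (sZ k); right.
Qed.

(** * A mean value theorem for Lipschitz maps *)

Section Euclidean.
Context {R : realType} {n : nat}.
Implicit Types u v w : 'rV[R]_n.

Lemma dotC u v : dot u v = dot v u.
Proof. by apply: eq_bigr => i _; rewrite mulrC. Qed.

Lemma dotDl u v w : dot (u + v) w = dot u w + dot v w.
Proof. by rewrite -big_split; apply: eq_bigr => i _; rewrite mxE mulrDl. Qed.

Lemma dotZl c u w : dot (c *: u) w = c * dot u w.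
Proof. by rewrite [RHS]mulr_sumr; apply: eq_bigr => i _; rewrite mxE mulrA. Qed.

Lemma dotNl u w : dot (- u) w = - dot u w.
Proof. by rewrite -scaleN1r dotZl mulN1r. Qed.

Lemma dotBl u v w : dot (u - v) w = dot u w - dot v w.
Proof. by rewrite dotDl dotNl. Qed.

Lemma dotDr u v w : dot w (u + v) = dot w u + dot w v.
Proof. by rewrite !(dotC w) dotDl. Qed.

Lemma dotZr c u w : dot w (c *: u) = c * dot w u.
Proof. by rewrite !(dotC w) dotZl. Qed.

Lemma dotNr u w : dot w (- u) = - dot w u.
Proof. by rewrite !(dotC w) dotNl. Qed.

Lemma dotBr u v w : dot w (u - v) = dot w u - dot w v.
Proof. by rewrite !(dotC w) dotBl. Qed.

Lemma dot0l w : dot 0 w = 0.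
Proof. by rewrite /dot big1// => i _; rewrite mxE mul0r. Qed.

Lemma dot_ge0 u : 0 <= dot u u.
Proof. by apply: sumr_ge0 => i _; rewrite -expr2 sqr_ge0. Qed.

Lemma enorm_ge0 u : 0 <= enorm u.
Proof. exact: sqrtr_ge0. Qed.

Lemma enorm_sqr u : enorm u ^+ 2 = dot u u.
Proof.
rewrite /enorm sqr_sqrtr; first by apply: eq_bigr => i _; rewrite expr2.
by apply: sumr_ge0 => i _; rewrite sqr_ge0.
Qed.

Lemma enorm_eq0 u : (enorm u == 0) = (u == 0).
Proof.
apply/eqP/eqP => [u0|->]; last first.
  by apply/eqP; rewrite -sqrf_eq0 enorm_sqr dot0l.
have : dot u u == 0 by rewrite -enorm_sqr u0 expr0n.
rewrite psumr_eq0; last by move=> i _; rewrite -expr2 sqr_ge0.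
move=> /allP H; apply/rowP => i; rewrite mxE; apply/eqP.
by have := H i (mem_index_enum i); rewrite /= -expr2 sqrf_eq0.
Qed.

Lemma enorm0 : enorm (0 : 'rV[R]_n) = 0.
Proof. by apply/eqP; rewrite enorm_eq0. Qed.

Lemma enormZ c u : enorm (c *: u) = `|c| * enorm u.
Proof.
apply/eqP; rewrite -(@eqrXn2 _ 2)// ?mulr_ge0 ?enorm_ge0//.
by rewrite exprMn !enorm_sqr dotZl dotZr mulrA real_normK ?num_real// expr2.
Qed.

Lemma enormN u : enorm (- u) = enorm u.
Proof. by rewrite -scaleN1r enormZ normrN1 mul1r. Qed.

Lemma enorm_distC u v : enorm (u - v) = enorm (v - u).
Proof. by rewrite -enormN opprB. Qed.

Lemma dot_le_enorm u v : dot u v <= enorm u * enorm v.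
Proof.
have [->|u0] := eqVneq u 0; first by rewrite dot0l enorm0 mul0r.
have [->|v0] := eqVneq v 0; first by rewrite dotC dot0l enorm0 mulr0.
have pu : 0 < enorm u by rewrite lt0r enorm_eq0 u0 enorm_ge0.
have pv : 0 < enorm v by rewrite lt0r enorm_eq0 v0 enorm_ge0.
have := dot_ge0 (enorm v *: u - enorm u *: v).
rewrite !(dotBl, dotBr, dotZl, dotZr) -!enorm_sqr (dotC v u) => H.
have : 0 <= (enorm u * enorm v) * (enorm u * enorm v - dot u v) *+ 2.
  by apply: le_trans H _; rewrite le_eqVlt; apply/orP; left; apply/eqP; ring.
by rewrite pmulrn_lge0// pmulr_rge0 ?mulr_gt0// subr_ge0.
Qed.

Lemma normr_dot_le u v : `|dot u v| <= enorm u * enorm v.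
Proof. by rewrite ler_norml lerNl -dotNl -{1}(enormN u) !dot_le_enorm. Qed.

Lemma enormD u v : enorm (u + v) <= enorm u + enorm v.
Proof.
rewrite -(@ler_pXn2r _ 2)// ?nnegrE ?addr_ge0 ?enorm_ge0//.
rewrite enorm_sqr !(dotDl, dotDr) -!enorm_sqr (dotC v u) sqrrD.
have := dot_le_enorm u v; lra.
Qed.

Lemma enormB u v : enorm (u - v) <= enorm u + enorm v.
Proof. by rewrite (le_trans (enormD _ _))// enormN. Qed.

Lemma norm_le_enorm u : `|u| <= enorm u.
Proof.
apply: mx_norm_le => [|i j]; first exact: enorm_ge0.
rewrite ord1 -(@ler_pXn2r _ 2)// ?nnegrE ?enorm_ge0//.
rewrite enorm_sqr /dot (bigD1 j)//= real_normK ?num_real// -expr2 lerDl.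
by apply: sumr_ge0 => k _; rewrite -expr2 sqr_ge0.
Qed.

Lemma enorm_le_norm u : enorm u <= n%:R * `|u|.
Proof.
rewrite -(@ler_pXn2r _ 2)// ?nnegrE ?enorm_ge0 ?mulr_ge0// enorm_sqr.
apply: (@le_trans _ _ (\sum_(i < n) `|u| ^+ 2)).
  apply: ler_sum => i _; rewrite -expr2 -[leLHS]real_normK ?num_real//.
  by rewrite ler_pXn2r ?nnegrE// le_mx_norm.
rewrite sumr_const card_ord -[leLHS]mulr_natl exprMn ler_wpM2r ?sqr_ge0//.
by rewrite -natrX ler_nat -mulnn; case: n => // k; rewrite leq_pmulr.
Qed.

End Euclidean.

Lemma near_eq_jacobian (R : realType) n m (g1 g2 : 'rV[R]_n -> 'rV[R]_m) x :
  {near x, g1 =1 g2} -> differentiable g1 x ->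
  differentiable g2 x /\ 'J g2 x = 'J g1 x.
Proof.
move=> g12 d1; apply: jacobian_unique => e e0.
have : \forall h \near (0 : 'rV[R]_n), g1 (x + h) = g2 (x + h).
  have /nbhs_ballP[d /= d0 dP] := g12; apply/nbhs_ballP; exists d => // h /=.
  rewrite -ball_normE /= sub0r normrN => hd; apply: dP.
  by rewrite -ball_normE /= opprD addrA subrr sub0r normrN.
apply: filterS2 (jacobian_approx d1 e0) => h + <-.
by rewrite (nbhs_singleton g12).
Qed.

(** Provides coordinates in which [d] is the first axis. The rank factorization of a nonzero row has
    a scalar left factor, which is moved into the invertible right one. *)
Lemma row_completion (R : realType) n (d : 'rV[R]_n.+1) : d != 0 ->
  exists2 B : 'M[R]_n.+1, B \in unitmx & delta_mx 0 0 *m B = d.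
Proof.
move=> d0; have rk : \rank d = 1%N by rewrite rank_rV d0.
have := mulmx_ebase d; rewrite rk.
have [c ->] : exists c : R, col_ebase d = c%:M.
  by exists (col_ebase d 0 0); apply/matrixP => i j; rewrite !ord1 mxE eqxx mulr1n.
rewrite mul_scalar_mx -scalemxAl => dE.
have c0 : c != 0 by apply: contra_neq d0 => c0; rewrite -dE c0 scale0r.
exists (c *: row_ebase d).
  by rewrite unitmxZ ?unitfE// row_ebase_unit.
apply: etrans dE; rewrite -scalemxAr; congr (_ *: (_ *m _)).
by apply/matrixP => i j; rewrite !mxE !ord1 eqxx /= andbT eq_sym.
Qed.

Lemma is_derive_dot (R : realType) n m (G : 'rV[R]_n -> 'rV[R]_m) (y d : 'rV[R]_n)
    (w : 'rV[R]_m) (s c : R) (y0 : 'rV[R]_n) : y = y0 + s *: d ->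
  differentiable G y ->
  is_derive s (1 : R) (fun t => dot (G (y0 + t *: d)) w) c ->
  c = dot (d *m 'J G y) w.
Proof.
move=> yE dG dc; apply/eqP; rewrite -subr_eq0 -normr_le0; apply/ler_addgt0Pr => e e0.
rewrite add0r.
pose C := 1 + m%:R * (`|d| * enorm w).
have C0 : 0 < C by rewrite ltr_pwDl// !mulr_ge0// enorm_ge0.
pose e' := e / C; have e'0 : 0 < e' by rewrite divr_gt0.
have /nbhs_ballP[r /= r0 rP] := is_derive_approx dc e'0.
have /nbhs_ballP[q /= q0 qP] := jacobian_approx dG e'0.
pose t := Num.min (r / 2) (q / 2 / (`|d| + 1)).
have t0 : 0 < t by rewrite lt_min !divr_gt0// ltr_wpDl.
have /rP : ball 0 r t.
  rewrite /ball/= sub0r normrN gtr0_norm// (@le_lt_trans _ _ (r / 2))//.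
    by rewrite ge_min lexx.
  by rewrite ltr_pdivrMr// ltr_pMr// ltr1n.
have /qP : ball 0 q (t *: d).
  rewrite -ball_normE /= sub0r normrN normrZ (gtr0_norm t0).
  rewrite (@le_lt_trans _ _ (q / 2 / (`|d| + 1) * `|d|))//.
    by rewrite ler_wpM2r// ge_min lexx orbT.
  rewrite (@le_lt_trans _ _ (q / 2))//; last by rewrite ltr_pdivrMr// ltr_pMr// ltr1n.
  by rewrite mulrAC ler_pdivrMr ?ltr_wpDl// ler_wpM2l ?lerDl// ltW// divr_gt0.
rewrite normrZ (gtr0_norm t0) => H1 H2.
rewrite -(ler_pM2l t0) -[X in X * `|_|](gtr0_norm t0) -normrM.
have -> : t * (c - dot (d *m 'J G y) w) =
   dot (G (y + t *: d) - G y - t *: d *m 'J G y) w -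
   (dot (G (y0 + (s + t) *: d)) w - dot (G (y0 + s *: d)) w - t * c).
  by rewrite scalerDl addrA -yE !dotBl -scalemxAl dotZl; ring.
rewrite (le_trans (ler_normB _ _))//.
have -> : t * e = m%:R * (e' * (t * `|d|)) * enorm w + e' * t.
  rewrite (_ : _ + _ = t * (e' * C)); last by rewrite /C; ring.
  by rewrite /e' divfK// gt_eqF.
rewrite lerD// (le_trans (normr_dot_le _ _))// ler_wpM2r ?enorm_ge0//.
by rewrite (le_trans (enorm_le_norm _))// ler_wpM2l.
Qed.

(** With [b - a] as first axis, [rademacher_lines] yields a parallel line, displaced by a small [C],
    on which [G] is differentiable almost everywhere. The one-variable bound applies there, and
    moving the endpoints back costs an arbitrarily small amount. *)
Lemma lipschitz_mvt (R : realType) n m (G : 'rV[R]_n -> 'rV[R]_m) (L : R)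
    (a b : 'rV[R]_n) (w : 'rV[R]_m) (K r : R) :
  (forall x y, `|G x - G y| <= L * `|x - y|) -> a != b -> 0 < r ->
  (forall (s : R) c, 0 < s < 1 -> `|c| < r -> differentiable G (a + s *: (b - a) + c) ->
    dot ((b - a) *m 'J G (a + s *: (b - a) + c)) w <= K) ->
  dot (G b - G a) w <= K.
Proof.
move=> GL ab r0 H; case: n G a b GL ab H => [|n] G a b GL ab H.
  by move: ab; rewrite (thinmx0 a) (thinmx0 b) eqxx.
wlog L0 : L GL / 0 < L => [hw|].
  apply: (hw (`|L| + 1)); last by rewrite ltr_pwDr.
  move=> x y; rewrite (le_trans (GL x y))// ler_wpM2r//.
  by rewrite (le_trans (ler_norm _))// lerDl.
have ba0 : b - a != 0 by rewrite subr_eq0 eq_sym.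
have [B Bu dB] := row_completion ba0.
apply/ler_addgt0Pr => e e0.
(* Each of the two endpoints moves by [C] and changes [G] by at most [L * |C|]; [m] converts the
   maximum norm into the Euclidean one. *)
pose D := 2 * m%:R * L * (enorm w + 1).
have D0 : 0 <= D by rewrite !mulr_ge0 ?addr_ge0 ?enorm_ge0// ltW.
pose rho := Num.min r (e / (D + 1)).
have rho0 : 0 < rho by rewrite lt_min r0 divr_gt0// ltr_wpDl.
have nB0 : 0 < n.+1%:R * (`|B| + 1) by rewrite mulr_gt0// ltr_wpDl.
pose HH (t : 'rV[R]_n.+1) := G (a + t *m B).
have HHL x y : `|HH x - HH y| <= L * (n.+1%:R * `|B|) * `|x - y|.
  rewrite (le_trans (GL _ _))// -mulrA ler_wpM2l ?(ltW L0)//.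
  rewrite opprD addrACA subrr add0r -mulmxBl.
  by rewrite (le_trans (mx_norm_mulmx _ _))// mulrAC.
have [c c0 aec] := rademacher_lines HHL 0 (divr_gt0 rho0 nB0).
pose C := (row_mx 0 c : 'rV_(1 + n)) *m B.
have Crho : `|C| < rho.
  rewrite (le_lt_trans (mx_norm_mulmx _ _))//.
  have cle : `|row_mx 0 c : 'rV[R]_(1 + n)| <= `|c|.
    apply: mx_norm_le => // i j; case: (split_ordP j) => k ->.
      by rewrite row_mxEl mxE normr0.
    by rewrite row_mxEr le_mx_norm.
  move: c0; rewrite -ball_normE /= sub0r normrN ltr_pdivlMr// => /(le_lt_trans _); apply.
  rewrite -mulrA mulrCA ler_pM ?mulr_ge0// ler_wpM2l// lerDl//.
have rowE t : (row_mx t%:M c : 'rV_(1 + n)) *m B = t *: (b - a) + C.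
  rewrite -dB /C scalemxAl -mulmxDl; congr (_ *m _).
  apply/rowP => j; rewrite !mxE.
  have j0 : (j == 0) = (j == 0 :> nat) by rewrite -(inj_eq val_inj).
  case: fintype.splitP => k jk; rewrite ?mxE.
    by rewrite j0 jk (ord1 k) mulr1n mulr1 addr0.
  by rewrite j0 jk mulr0 add0r.
have GHH : G =1 HH \o (fun y => (y - a) *m invmx B).
  by move=> y; rewrite /HH /= mulmxKV// addrC subrK.
have dGHH t : differentiable HH (row_mx t%:M c : 'rV_(1 + n)) ->
    differentiable G (a + t *: (b - a) + C).
  move=> dH; rewrite (funext GHH); apply: differentiable_comp.
    apply: (@differentiable_comp _ _ _ _ (fun y => y - a) (mulmxr (invmx B))).
      by apply: differentiableB => //; exact: differentiable_cst.
    by apply: linear_differentiable; exact: mulmxr_continuous.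
  rewrite (_ : (_ + _ - a) *m _ = (row_mx t%:M c : 'rV_(1 + n)))//.
  by rewrite addrC !addrA addNr add0r -rowE mulmxK.
pose phi t := dot (G (a + C + t *: (b - a))) w.
have phiL x y : `|phi x - phi y| <= m%:R * (L * `|b - a|) * enorm w * `|x - y|.
  rewrite /phi -dotBl (le_trans (normr_dot_le _ _))// mulrAC ler_wpM2r ?enorm_ge0//.
  rewrite (le_trans (enorm_le_norm _))// -mulrA ler_wpM2l// (le_trans (GL _ _))//.
  by rewrite -mulrA ler_wpM2l ?(ltW L0)// opprD addrACA subrr add0r -scalerBl normrZ mulrC.
have : phi 1 - phi 0 <= K * (1 - 0).
  apply: (lipschitz_increment_le phiL) => //.
  apply: (@filterS _ _ (ae_filter_ringOfSetsType lebesgue_measure)) aec => s /dGHH dGs s01 c' dphi.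
  have /= yE : a + s *: (b - a) + C = a + C + s *: (b - a) by rewrite addrAC.
  rewrite (is_derive_dot yE dGs dphi); apply: H => //.
  by rewrite (lt_le_trans Crho)// ge_min lexx.
rewrite subr0 mulr1 /phi -dotBl scale1r scale0r addr0 => HK.
have -> : G b - G a = (G (a + C + (b - a)) - G (a + C)) +
    ((G b - G (a + C + (b - a))) - (G a - G (a + C))).
  by apply/rowP => i; rewrite !mxE; ring.
rewrite dotDl lerD//.
have CE : `|b - (a + C + (b - a))| = `|C|.
  by rewrite -[RHS]normrN; congr `|_|; apply/rowP => i; rewrite !mxE; ring.
have CE' : `|a - (a + C)| = `|C| by rewrite opprD addrA subrr add0r normrN.
have e1 : enorm ((G b - G (a + C + (b - a))) - (G a - G (a + C))) <= m%:R * (2 * L * `|C|).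
  rewrite (le_trans (enorm_le_norm _))// ler_wpM2l// (le_trans (ler_normB _ _))//.
  by rewrite mulr2n mulrDl mulrDl mul1r lerD// (le_trans (GL _ _))// ?CE ?CE'.
rewrite (le_trans (dot_le_enorm _ _))// (le_trans (ler_wpM2r (enorm_ge0 w) e1))//.
apply: (@le_trans _ _ (D * `|C|)).
  rewrite (_ : D * `|C| = m%:R * (2 * L * `|C|) * (enorm w + 1)); last by rewrite /D; ring.
  by rewrite ler_wpM2l ?mulr_ge0 ?(ltW L0)// lerDl.
apply: (@le_trans _ _ ((D + 1) * (e / (D + 1)))); last first.
  by rewrite mulrC divfK// gt_eqF// ltr_wpDl.
rewrite ler_pM// ?lerDl// ltW// (lt_le_trans Crho)// ge_min lexx orbT//.
Qed.

Lemma minr_increment (R : realType) (q c d : R) : c <= d ->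
  0 <= Num.min q d - Num.min q c <= d - c.
Proof.
by move=> cd; case: (ltP q c) => qc; case: (ltP q d) => qd; apply/andP; split; lra.
Qed.

Lemma maxr_increment (R : realType) (q c d : R) : c <= d ->
  0 <= Num.max q d - Num.max q c <= d - c.
Proof.
by move=> cd; case: (ltP q c) => qc; case: (ltP q d) => qd; apply/andP; split; lra.
Qed.

Lemma clamp_lipschitz (R : realType) (q c d : R) :
  `|Num.max (- q) (Num.min q c) - Num.max (- q) (Num.min q d)| <= `|c - d|.
Proof.
wlog cd : c d / c <= d => [hw|].
  by have [/hw//|/ltW/hw] := leP c d; rewrite distrC (distrC c).
have /andP[m0 m1] := minr_increment q cd; rewrite subr_ge0 in m0.
have /andP[M0 M1] := maxr_increment (- q) m0.
rewrite distrC (distrC c) !ger0_norm ?subr_ge0//; last by rewrite -subr_ge0.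
exact: le_trans M1 m1.
Qed.

Section local_mvt.
Variables (R : realType) (n m : nat) (G : 'rV[R]_n -> 'rV[R]_m) (L : R)
  (p : 'rV[R]_n) (rho : R).
Hypothesis GL : forall x y, ball p rho x -> ball p rho y -> `|G x - G y| <= L * `|x - y|.

(** Clamping the coordinates retracts the space onto a box around [p] and is 1-Lipschitz for the
    maximum norm, so composition with it makes [G] globally Lipschitz. The half-width [q] exceeds
    the distance of both endpoints from [p]; near the segment clamping is then the identity and
    Jacobians agree. *)
Lemma local_lipschitz_mvt (a b : 'rV[R]_n) (w : 'rV[R]_m) (K r : R) :
  ball p rho a -> ball p rho b -> a != b -> 0 < r ->
  (forall (s : R) c, 0 < s < 1 -> `|c| < r -> ball p rho (a + s *: (b - a) + c) ->
    differentiable G (a + s *: (b - a) + c) ->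
    dot ((b - a) *m 'J G (a + s *: (b - a) + c)) w <= K) ->
  dot (G b - G a) w <= K.
Proof.
rewrite -!ball_normE /= => pa pb ab r0 H.
pose mu := Num.max `|p - a| `|p - b|.
have mu_rho : mu < rho by rewrite gt_max pa.
pose q := (mu + rho) / 2.
have [muq qrho] : mu < q /\ q < rho by rewrite /q; split; lra.
have q0 : 0 <= q by rewrite (le_trans _ (ltW muq))// le_max normr_ge0.
pose cl (c : R) := Num.max (- q) (Num.min q c).
have clq c : `|cl c| <= q by rewrite ler_norml /cl le_max lexx /= ge_max ge_min lexx /= andbT ge0_cp.
have cl_id c : `|c| <= q -> cl c = c.
  by rewrite ler_norml /cl => /andP[? ?]; rewrite min_r// max_r.
have cl_lip c d : `|cl c - cl d| <= `|c - d| by exact: clamp_lipschitz.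
pose P (y : 'rV[R]_n) := p + map_mx cl (y - p).
have Pball y : ball p rho (P y).
  rewrite -ball_normE /= opprD addrA subrr sub0r normrN (le_lt_trans _ qrho)//.
  by apply: mx_norm_le => // i j; rewrite mxE.
have Pid y : `|p - y| <= q -> P y = y.
  move=> yq; rewrite -[RHS](subrK p) addrC; congr (_ + _); apply/matrixP => i j.
  rewrite mxE cl_id// (le_trans (le_mx_norm _ _ _))// distrC//.
have PL x y : `|(G \o P) x - (G \o P) y| <= `|L| * `|x - y|.
  rewrite /= (le_trans (GL (Pball x) (Pball y)))//.
  apply: (@le_trans _ _ (`|L| * `|P x - P y|)); first by rewrite ler_wpM2r// ler_norm.
  rewrite ler_wpM2l// opprD addrACA subrr add0r; apply: mx_norm_le => // i j.
  rewrite !mxE (le_trans (cl_lip _ _))//.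
  by have := le_mx_norm (x - y) i j; rewrite !mxE; congr (`|_| <= _); ring.
have [amu bmu] : `|p - a| <= mu /\ `|p - b| <= mu by rewrite !le_max !lexx orbT.
have Pa : P a = a by apply: Pid; exact: le_trans amu (ltW muq).
have Pb : P b = b by apply: Pid; exact: le_trans bmu (ltW muq).
rewrite -Pb -Pa.
apply: (@lipschitz_mvt _ _ _ (G \o P) _ a b w K (Num.min r (q - mu)) PL ab).
  by rewrite lt_min r0 subr_gt0.
move=> s c s01; rewrite lt_min => /andP[cr cq] dG.
set y := a + _ + c in dG *.
have yq : `|p - y| < q.
  have -> : p - y = (1 - s) *: (p - a) + s *: (p - b) - c.
    by apply/rowP => i; rewrite /y !mxE; ring.
  have /andP[s0 s1] := s01.
  rewrite (le_lt_trans (ler_normB _ _))// -ltrBrDr.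
  apply: (@le_lt_trans _ _ mu); last by rewrite ltrBrDl -ltrBrDr.
  rewrite (le_trans (ler_normD _ _))// !normrZ (gtr0_norm s0) gtr0_norm ?subr_gt0//.
  have -> : mu = (1 - s) * mu + s * mu by ring.
  by rewrite lerD// ler_wpM2l// ltW// subr_gt0.
have PG : {near y, G \o P =1 G}.
  apply/nbhs_ballP; exists (q - `|p - y|); rewrite /= ?subr_gt0// => z.
  rewrite -ball_normE /= => yz; rewrite Pid//.
  by rewrite -(subrKA y) (le_trans (ler_normD _ _))// -lerBrDl ltW.
have [dGy <-] := near_eq_jacobian PG dG.
by apply: H => //; exact: lt_trans yq qrho.
Qed.

(** The deviation [w] itself serves as test vector in the scalar inequality, and one factor
    [enorm w] is cancelled. *)
Lemma local_lipschitz_mvt_enorm (a b : 'rV[R]_n) (l : 'rV[R]_m) (K r : R) :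
  ball p rho a -> ball p rho b -> a != b -> 0 < r ->
  (forall (s : R) c, 0 < s < 1 -> `|c| < r -> ball p rho (a + s *: (b - a) + c) ->
    differentiable G (a + s *: (b - a) + c) ->
    enorm ((b - a) *m 'J G (a + s *: (b - a) + c) - l) <= K) ->
  enorm (G b - G a - l) <= K.
Proof.
move=> pa pb ab r0 H; set w := G b - G a - l.
have : dot (G b - G a) w <= dot l w + K * enorm w.
  apply: (local_lipschitz_mvt pa pb ab r0) => s c s01 cr yb dG.
  rewrite -lerBlDl -dotBl (le_trans (dot_le_enorm _ _))// ler_wpM2r ?enorm_ge0//.
  exact: H.
rewrite -lerBlDl -dotBl -/w -enorm_sqr expr2.
have [w0|w0] := eqVneq (enorm w) 0; last first.
  by rewrite ler_pM2r// lt0r w0 enorm_ge0.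
(* What remains is [0 <= K]. If [K < 0], the hypothesis excludes every point of differentiability in
   the tube, so the mean value inequality holds vacuously with any bound, even [-1] for the test
   vector 0. *)
rewrite w0 => _; apply: contrapT => K0.
suff : dot (G b - G a) 0 <= -1 by rewrite dotC dot0l lerNr oppr0 ler10.
apply: (local_lipschitz_mvt pa pb ab r0) => s c s01 cr yb dG.
by case: K0; exact: le_trans (enorm_ge0 _) (H s c s01 cr yb dG).
Qed.

End local_mvt.

(** * Semismooth maps *)

Lemma lipschitz_onP (R : realType) (V W : normedModType R) (g : V -> W) (U : set V) :
  [lipschitz g y | y in U] ->
  exists2 L : R, 0 < L & forall x y, U x -> U y -> `|g x - g y| <= L * `|x - y|.
Proof.
move=> [M [_ HM]]; exists (`|M| + 1); first by rewrite ltr_pwDr.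
move=> x y Ux Uy; have /HM : M < `|M| + 1 by rewrite (le_lt_trans (ler_norm _))// ltrDl.
by move=> /(_ (x, y)); apply; split.
Qed.

Lemma small_scale (R : realType) (V : normedModType R) (v : V) (d : R) : 0 < d ->
  exists2 t0 : R, 0 < t0 & forall t, `|t| <= t0 -> `|t *: v| < d.
Proof.
move=> d0; have v1 : 0 < `|v| + 1 by rewrite ltr_wpDl.
exists (d / (`|v| + 1)) => [|t tle]; first by rewrite divr_gt0.
rewrite normrZ (le_lt_trans (ler_wpM2r (normr_ge0 v) tle))//.
by rewrite mulrAC ltr_pdivrMr// ltr_pM2l// ltrDl.
Qed.

Lemma jacobian_lipschitz (R : realType) n m (g : 'rV[R]_n -> 'rV[R]_m) (L : R)
    (U : set 'rV[R]_n) (y v : 'rV[R]_n) :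
  (forall x y, U x -> U y -> `|g x - g y| <= L * `|x - y|) -> nbhs y U ->
  differentiable g y -> `|v *m 'J g y| <= L * `|v|.
Proof.
move=> gL Uy dg; apply/ler_addgt0Pr => e e0.
have v1 : 0 < `|v| + 1 by rewrite ltr_wpDl.
have e'0 : 0 < e / (`|v| + 1) by rewrite divr_gt0.
have /nbhs_ballP[q /= q0 qP] := jacobian_approx dg e'0.
have /nbhs_ballP[r /= r0 rP] := Uy.
have qr0 : 0 < Num.min q r by rewrite lt_min q0.
have [t t0 tP] := small_scale v qr0.
have {tP} : `|t *: v| < Num.min q r by apply: tP; rewrite gtr0_norm.
rewrite lt_min => /andP[tq tr].
have /qP H : ball 0 q (t *: v) by rewrite -ball_normE /= sub0r normrN.
have Uyt : U (y + t *: v).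
  by apply: rP; rewrite -ball_normE /= opprD addrA subrr sub0r normrN.
have := gL _ _ Uyt (nbhs_singleton Uy); rewrite addrAC subrr add0r => H2.
rewrite -(ler_pM2l t0) -[X in X * `|_ *m _|](gtr0_norm t0) -normrZ scalemxAl.
have -> : t *: v *m 'J g y = (g (y + t *: v) - g y) - (g (y + t *: v) - g y - t *: v *m 'J g y).
  by rewrite opprB addrC subrK.
rewrite (le_trans (ler_normB _ _))// mulrDr lerD//.
  by rewrite (le_trans H2)// normrZ (gtr0_norm t0) mulrCA.
rewrite (le_trans H)// normrZ (gtr0_norm t0) mulrCA ler_wpM2l ?(ltW t0)//.
by rewrite mulrAC ler_pdivrMr// ler_wpM2l ?lerDl// ltW.
Qed.

Lemma clarke_jacobian_differentiable (R : realType) n m (g : 'rV[R]_n -> 'rV[R]_m) y :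
  differentiable g y -> clarke_jacobian g y ('J g y).
Proof.
move=> dg; apply: sub_gen_smallest; exists (fun=> y).
by split => //; exact: cvg_cst.
Qed.

Section semismooth.
Variables (R : realType) (n m : nat) (g : 'rV[R]_n -> 'rV[R]_m) (x : 'rV[R]_n).
Variables (L rho : R).
Hypotheses (L0 : 0 < L) (rho0 : 0 < rho).
Hypothesis gL : forall y z, ball x rho y -> ball x rho z -> `|g y - g z| <= L * `|y - z|.

Lemma enorm_lipschitz y z : ball x rho y -> ball x rho z ->
  enorm (g y - g z) <= m%:R * (L * `|y - z|).
Proof. by move=> yb zb; rewrite (le_trans (enorm_le_norm _))// ler_wpM2l// gL. Qed.

Lemma enorm_jacobian y v : ball x rho y -> differentiable g y ->
  enorm (v *m 'J g y) <= m%:R * (L * `|v|).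
Proof.
move=> yb dg; rewrite (le_trans (enorm_le_norm _))// ler_wpM2l//.
apply: jacobian_lipschitz gL _ dg.
by apply: open_nbhs_nbhs; split => //; exact: ball_open.
Qed.

Lemma ballxD h : `|h| < rho -> ball x rho (x + h).
Proof. by rewrite -ball_normE /= opprD addrA subrr sub0r normrN. Qed.

(* The perturbation [c] of the mean value theorem is absorbed in the direction:
   x + u d + c = x + u (d + c / u). *)
Lemma directional_increment (d : 'rV[R]_n) (l : 'rV[R]_m) (e q : R) :
  d != 0 -> 0 < e -> 0 < q ->
  (forall (d' : 'rV[R]_n) t, `|d' - d| < q -> 0 < t < q -> differentiable g (x + t *: d') ->
     enorm (d' *m 'J g (x + t *: d') - l) <= e) ->
  exists2 t0, 0 < t0 & forall t, 0 < t < t0 ->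
    enorm (g (x + t *: d) - g x - t *: l) <= 2 * e * t.
Proof.
move=> dn0 e0 q0 Hq.
have [t1 t10 t1P] := small_scale d rho0.
exists (Num.min t1 q); first by rewrite lt_min t10.
move=> t; rewrite lt_min => /and3P[t0 tt1 tq].
have tdb s : 0 <= s <= 1 -> `|(s * t) *: d| < rho.
  move=> /andP[s0 s1]; apply: t1P; rewrite ger0_norm ?mulr_ge0 ?(ltW t0)//.
  by rewrite (le_trans _ (ltW tt1))// ler_piMl// ltW.
have xb : ball x rho x by exact: ballxx.
have bb : ball x rho (x + t *: d).
  by apply: ballxD; rewrite -[t]mul1r tdb// ler01 lexx.
apply/ler_addgt0Pr => z z0.
pose C := m%:R * (L * (t * `|d|)) + t * enorm l + 1.
have C0 : 0 < C.
  by rewrite ltr_wpDl// addr_ge0 ?mulr_ge0 ?enorm_ge0 ?(ltW t0) ?(ltW L0).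
(* The segment starts at [x + (eta * t) *: d] rather than at [x], so that [u >= eta * t] and [c / u]
   stays small; the omitted initial piece costs at most [eta * C <= z]. *)
pose eta := Num.min (1 / 2) (z / C).
have eta0 : 0 < eta by rewrite lt_min !divr_gt0.
have eta1 : eta < 1 by rewrite gt_min; apply/orP; left; lra.
have etaz : eta * C <= z by rewrite -ler_pdivlMr// ge_min lexx orbT.
have ab' : ball x rho (x + (eta * t) *: d) by apply: ballxD; rewrite tdb// !ltW.
(* The Jacobian applied to [c / u] then contributes at most [e], whence the factor 2 in the
   conclusion. *)
pose q' := Num.min q (e / (m%:R * L + 1)).
have mL : 0 < m%:R * L + 1 by rewrite ltr_wpDl// mulr_ge0// ltW.
have q'0 : 0 < q' by rewrite lt_min q0 divr_gt0.
have baE : (x + t *: d) - (x + (eta * t) *: d) = ((1 - eta) * t) *: d.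
  by apply/rowP => i; rewrite !mxE; ring.
have eta1t : 0 < (1 - eta) * t by rewrite mulr_gt0// subr_gt0.
have main : enorm (g (x + t *: d) - g (x + (eta * t) *: d) - ((1 - eta) * t) *: l)
    <= (1 - eta) * t * (2 * e).
  have r0 : 0 < eta * t * q' by rewrite !mulr_gt0.
  apply: (local_lipschitz_mvt_enorm gL ab' bb _ r0).
    by rewrite eq_sym -subr_eq0 baE scaler_eq0 (negPf dn0) gt_eqF.
  move=> s c /andP[s0 s1]; rewrite baE => cr yb dy.
  pose u := eta * t + s * ((1 - eta) * t).
  have u0 : 0 < u by rewrite addr_gt0// mulr_gt0.
  have etau : eta * t <= u by rewrite lerDl ltW// mulr_gt0.
  have ut : u <= t.
    rewrite [leRHS](_ : t = eta * t + 1 * ((1 - eta) * t)); last by ring.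
    by rewrite lerD2l ler_wpM2r ?ltW.
  pose k := u^-1 *: c.
  have kq : `|k| < q'.
    rewrite normrZ gtr0_norm ?invr_gt0// mulrC ltr_pdivrMr//.
    by rewrite (lt_le_trans cr)// mulrC ler_wpM2l// ltW.
  move: kq; rewrite lt_min => /andP[kq ke].
  move: yb dy; set y := x + _ + _ + c.
  have -> : y = x + u *: (d + k).
    rewrite scalerDr scalerA divff ?gt_eqF// scale1r /y /u.
    by apply/rowP => i; rewrite !mxE; ring.
  move=> yb dy.
  rewrite -scalemxAl -scalerBr enormZ gtr0_norm// ler_pM2l//.
  have -> : d *m 'J g (x + u *: (d + k)) - l =
      ((d + k) *m 'J g (x + u *: (d + k)) - l) - k *m 'J g (x + u *: (d + k)).
    rewrite mulmxDl; move: (d *m _) (k *m _) => A1 A2.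
    by apply/rowP => i; rewrite !mxE; ring.
  rewrite (le_trans (enormB _ _))// mulr2n mulrDl mul1r lerD//.
    by apply: Hq => //; rewrite ?u0 ?(le_lt_trans ut)// addrAC subrr add0r.
  rewrite (le_trans (enorm_jacobian _ yb dy))// mulrA.
  apply: (@le_trans _ _ ((m%:R * L + 1) * (e / (m%:R * L + 1)))); last first.
    by rewrite mulrC divfK// gt_eqF.
  by rewrite ler_pM ?mulr_ge0 ?lerDl ?(ltW L0)// ltW.
have -> : g (x + t *: d) - g x - t *: l =
   (g (x + t *: d) - g (x + (eta * t) *: d) - ((1 - eta) * t) *: l) +
   (g (x + (eta * t) *: d) - g x) - (eta * t) *: l.
  by apply/rowP => i; rewrite !mxE; ring.
apply: (@le_trans _ _ (2 * e * t + eta * C)); last by rewrite lerD2l.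
have -> : 2 * e * t + eta * C =
   2 * e * t + m%:R * (L * (eta * t * `|d|)) + eta * t * enorm l + eta.
  by rewrite /C; ring.
rewrite ler_wpDr ?(ltW eta0)// (le_trans (enormB _ _))// lerD//; last first.
  by rewrite enormZ ger0_norm// mulr_ge0// ltW.
rewrite (le_trans (enormD _ _))// lerD//.
  rewrite (le_trans main)// mulrC ler_wpM2l ?mulr_ge0 ?(ltW e0)//.
  by rewrite ler_piMl ?(ltW t0)// gerBl ltW.
rewrite (le_trans (enorm_lipschitz ab' xb))// ler_wpM2l// ler_wpM2l ?(ltW L0)//.
by rewrite addrAC subrr add0r normrZ ger0_norm// mulr_ge0// ltW.
Qed.

Hypothesis ssg : semismooth g x.

Lemma semismooth_direction (d : 'rV[R]_n) : exists l : 'rV[R]_m, forall e, 0 < e ->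
  exists2 q, 0 < q & forall (d' : 'rV[R]_n) t, `|d' - d| < q -> 0 < t < q ->
    differentiable g (x + t *: d') -> enorm (d' *m 'J g (x + t *: d') - l) <= e.
Proof.
have [_ /(_ d)[l Hl]] := ssg; exists l => e /Hl [[U V] /= [dU tV] UV].
have /nbhs_ballP[q1 /= q10 q1P] := dU.
have /nbhs_ballP[q2 /= q20 q2P] := tV.
exists (Num.min q1 q2); first by rewrite lt_min q10.
move=> d' t; rewrite lt_min => /andP[d'1 _] /andP[t0]; rewrite lt_min => /andP[_ t2] dg.
apply: ltW; apply: (UV (d', t)) => /=; last exact: clarke_jacobian_differentiable.
split; first by apply: q1P; rewrite -ball_normE /= distrC.
by apply: q2P => //; rewrite /ball/= sub0r normrN gtr0_norm.
Qed.

Lemma dirderiv0 : dirderiv g x 0 = 0.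
Proof.
apply: cvg_lim => //; apply: (@cvg_trans _ (cst 0 @ 0^'+)); last exact: cvg_cst.
by apply: near_eq_cvg; apply: nearW => t; rewrite scaler0 addr0 subrr scaler0.
Qed.

(** [semismooth] does not postulate the directional derivative: it turns out to be the limit [l] of
    the Jacobian images. Direction 0 is apart because the mean value theorem needs distinct
    endpoints. *)
Lemma semismooth_dirderiv (d : 'rV[R]_n) (e : R) : 0 < e ->
  exists2 t0, 0 < t0 & forall t, 0 < t < t0 ->
    enorm (g (x + t *: d) - g x - t *: dirderiv g x d) <= e * t.
Proof.
have [->|d0] := eqVneq d 0.
  move=> e0; exists 1 => // t /andP[t0 _].
  by rewrite dirderiv0 !scaler0 addr0 subrr subr0 enorm0 mulr_ge0// ltW.
have [l Hl] := semismooth_direction d.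
have inc z : 0 < z -> exists2 t0, 0 < t0 & forall t, 0 < t < t0 ->
    enorm (g (x + t *: d) - g x - t *: l) <= z * t.
  move=> z0; have z20 : 0 < z / 2 by rewrite divr_gt0.
  have [q q0 qP] := Hl _ z20.
  have [t0 t00 t0P] := directional_increment d0 z20 q0 qP; exists t0 => // t /t0P.
  by rewrite mulrCA divff// mulr1.
suff -> : dirderiv g x d = l by exact: inc.
apply: cvg_lim => //; apply/cvgrPdist_lt => z z0.
have [t0 t00 t0P] := inc _ (divr_gt0 z0 (ltr0Sn R 1)).
exists t0 => //= t; rewrite /= sub0r normrN => /(le_lt_trans (ler_norm _)) tt0 t_gt0.
have := t0P t; rewrite t_gt0 tt0 => /(_ isT) H.
rewrite distrC -(ltr_pM2l t_gt0) -{1}(gtr0_norm t_gt0) -normrZ.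
rewrite scalerBr scalerA divff ?gt_eqF// scale1r.
rewrite (le_lt_trans (norm_le_enorm _))// (le_lt_trans H)// mulrC ltr_pM2l//.
by rewrite ltr_pdivrMr// ltr_pMr// ltr1n.
Qed.

Lemma dirderivZ (s : R) d : 0 < s -> dirderiv g x (s *: d) = s *: dirderiv g x d.
Proof.
move=> s0; apply/eqP; rewrite -subr_eq0 -enorm_eq0 eq_le enorm_ge0 andbT; apply/ler_addgt0Pr => e e0.
have s1 : 0 < 1 + s by rewrite addr_gt0.
have e'0 : 0 < e / (1 + s) by rewrite divr_gt0.
have [t1 t10 H1] := semismooth_dirderiv (s *: d) e'0.
have [t2 t20 H2] := semismooth_dirderiv d e'0.
pose t := Num.min t1 (t2 / s) / 2.
have min0 : 0 < Num.min t1 (t2 / s) by rewrite lt_min t10 divr_gt0.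
have t0 : 0 < t by rewrite divr_gt0.
have : t < Num.min t1 (t2 / s) by rewrite ltr_pdivrMr// ltr_pMr// ltr1n.
rewrite lt_min ltr_pdivlMr// => /andP[tt1 tt2].
have {}H1 := H1 t ltac:(by rewrite t0 tt1).
have {}H2 := H2 (t * s) ltac:(by rewrite mulr_gt0).
rewrite add0r -(ler_pM2l t0) -{1}(gtr0_norm t0) -enormZ.
have -> : t *: (dirderiv g x (s *: d) - s *: dirderiv g x d) =
   (g (x + (t * s) *: d) - g x - (t * s) *: dirderiv g x d) -
   (g (x + t *: (s *: d)) - g x - t *: dirderiv g x (s *: d)).
  by rewrite scalerA; apply/rowP => i; rewrite !mxE; ring.
rewrite (le_trans (enormB _ _))// (le_trans (lerD H2 H1))//.
rewrite le_eqVlt; apply/orP; left; apply/eqP.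
by field; rewrite gt_eqF.
Qed.

Lemma dirderiv_lipschitz d d' :
  enorm (dirderiv g x d - dirderiv g x d') <= m%:R * (L * `|d - d'|).
Proof.
apply/ler_addgt0Pr => e e0.
have e20 : 0 < e / 2 by rewrite divr_gt0.
have [t1 t10 H1] := semismooth_dirderiv d e20.
have [t2 t20 H2] := semismooth_dirderiv d' e20.
have [t3 t30 H3] := small_scale d rho0; have [t4 t40 H4] := small_scale d' rho0.
pose tm := Num.min (Num.min t1 t2) (Num.min t3 t4).
have tm0 : 0 < tm by rewrite !lt_min t10 t20 t30.
pose t := tm / 2; have t0 : 0 < t by rewrite divr_gt0.
have : t < tm by rewrite ltr_pdivrMr// ltr_pMr// ltr1n.
rewrite !lt_min => /andP[/andP[tt1 tt2] /andP[/ltW tt3 /ltW tt4]].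
have {}H1 := H1 t ltac:(by rewrite t0 tt1).
have {}H2 := H2 t ltac:(by rewrite t0 tt2).
have {}H3 : ball x rho (x + t *: d) by apply: ballxD; apply: H3; rewrite gtr0_norm.
have {}H4 : ball x rho (x + t *: d') by apply: ballxD; apply: H4; rewrite gtr0_norm.
rewrite -(ler_pM2l t0) -{1}(gtr0_norm t0) -enormZ.
have -> : t *: (dirderiv g x d - dirderiv g x d') =
   (g (x + t *: d) - g (x + t *: d')) +
   ((g (x + t *: d') - g x - t *: dirderiv g x d') -
   (g (x + t *: d) - g x - t *: dirderiv g x d)).
  by apply/rowP => i; rewrite !mxE; ring.
rewrite (le_trans (enormD _ _))// mulrDr lerD//.
  rewrite (le_trans (enorm_lipschitz H3 H4))// opprD addrACA subrr add0r -scalerBr.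
  by rewrite normrZ (gtr0_norm t0) (mulrCA t) ler_wpM2l// mulrCA.
rewrite (le_trans (enormB _ _))// (le_trans (lerD H2 H1))//.
by rewrite -mulrDl -splitr mulrC.
Qed.

(** Semismoothness controls the directions near a given one, and compactness of the unit sphere
    makes this uniform. For [d'] near [d] the residual splits into the change of [g] from [d] to
    [d'], the increment along [d], and the Jacobian term at [d']. *)
Lemma semismooth_jacobian (e : R) : 0 < e ->
  \forall y \near x, differentiable g y ->
    enorm (g y - g x - (y - x) *m 'J g y) <= e * enorm (y - x).
Proof.
move=> e0.
pose K := [set d : 'rV[R]_n | `|d| = 1].
have cK : compact K.
  apply: bounded_closed_compact; first by exists 1; split => // M M1 d /= ->; exact: ltW.
  rewrite (_ : K = (fun d : 'rV[R]_n => `|d|) @^-1` [set 1]); last by [].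
  by apply: preimage_closed => [d _|]; [exact: norm_continuous|exact: closed_eq].
have /compact_near_coveringP := cK.
move=> /(_ _ (0^'+ : set_system R) (fun t d => differentiable g (x + t *: d) ->
   enorm (g (x + t *: d) - g x - t *: (d *m 'J g (x + t *: d))) <= e * t) _) H.
have {H} : \forall t \near 0^'+, K `<=` (fun d => differentiable g (x + t *: d) ->
   enorm (g (x + t *: d) - g x - t *: (d *m 'J g (x + t *: d))) <= e * t).
  apply: H => d /= d1.
  have dn0 : d != 0 by rewrite -normr_gt0 d1.
  have [l Hl] := semismooth_direction d.
  have e30 : 0 < e / 4 by rewrite divr_gt0.
  have [q q0 qP] := Hl _ e30.
  have [t0 t00 t0P] := directional_increment dn0 e30 q0 qP.
  have mL : 0 < m%:R * L + 1 by rewrite ltr_wpDl// mulr_ge0// ltW.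
  pose q' := Num.min q (Num.min 1 (e / 4 / (m%:R * L + 1))).
  have q'0 : 0 < q' by rewrite !lt_min q0 divr_gt0//= ltr01.
  pose t1 := Num.min (Num.min t0 q) (rho / 2).
  have t10 : 0 < t1 by rewrite !lt_min t00 q0 divr_gt0.
  exists (ball d q', [set t | 0 < t < t1]) => /=.
    split; first exact: nbhsx_ballx.
    by exists t1 => //= t; rewrite /= sub0r normrN => /(le_lt_trans (ler_norm _)) tt1 t_gt0; rewrite t_gt0.
  move=> [d' t] /= [dd' /andP[t_gt0]]; rewrite !lt_min => /andP[/andP[tt0 tq] trho] dg.
  move: dd'; rewrite -ball_normE /= distrC !lt_min => /and3P[dq d'1 dmL].
  have d'2 : `|d'| <= 2.
    by rewrite -(subrK d d') (le_trans (ler_normD _ _))// d1 (natrD _ 1 1) lerD2r ltW.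
  have xb : ball x rho (x + t *: d).
    apply: ballxD; rewrite normrZ d1 mulr1 gtr0_norm// (lt_le_trans trho)//.
    by rewrite ler_pdivrMr// ler_pMr// ler1n.
  have xb' : ball x rho (x + t *: d').
    apply: ballxD; rewrite normrZ gtr0_norm//.
    by rewrite (le_lt_trans (ler_wpM2l (ltW t_gt0) d'2))// -ltr_pdivlMr.
  have H1 := qP d' t dq ltac:(by rewrite t_gt0 tq) dg.
  have H2 := t0P t ltac:(by rewrite t_gt0 tt0).
  have H3 := enorm_lipschitz xb' xb.
  have -> : g (x + t *: d') - g x - t *: (d' *m 'J g (x + t *: d')) =
    (g (x + t *: d') - g (x + t *: d)) + (g (x + t *: d) - g x - t *: l) -
    t *: (d' *m 'J g (x + t *: d') - l).
    by move: (d' *m _) => A; apply/rowP => i; rewrite !mxE; ring.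
  rewrite (le_trans (enormB _ _))//.
  have -> : e * t = e / 4 * t + 2 * (e / 4) * t + e / 4 * t by field.
  apply: lerD; last by rewrite enormZ gtr0_norm// mulrC ler_wpM2r// ltW.
  rewrite (le_trans (enormD _ _))// lerD// (le_trans H3)//.
  rewrite opprD addrACA subrr add0r -scalerBr normrZ (gtr0_norm t_gt0).
  rewrite (mulrCA L) (mulrCA _ t) [leRHS]mulrC ler_wpM2l ?(ltW t_gt0)//.
  apply: (@le_trans _ _ ((m%:R * L + 1) * (e / 4 / (m%:R * L + 1)))); last first.
    by rewrite mulrC divfK// gt_eqF.
  by rewrite mulrA ler_pM ?mulr_ge0 ?lerDl ?(ltW L0)// ltW.
move=> [q /= q0 qP].
apply/nbhs_ballP; exists q => // y; rewrite -ball_normE /= distrC => yq dg.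
have [->|yx] := eqVneq y x; first by rewrite !subrr mul0mx !subrr !enorm0 mulr0.
have t0 : 0 < `|y - x| by rewrite normr_gt0 subr_eq0.
pose d := `|y - x|^-1 *: (y - x).
have Kd : K d by rewrite /K /= normrZ normfV normr_id mulVf// gt_eqF.
have yE : x + `|y - x| *: d = y by rewrite scalerA divff ?gt_eqF// scale1r addrC subrK.
have := qP `|y - x| _ t0 d Kd; rewrite yE scalemxAl [_ *: d]scalerA divff ?gt_eqF// scale1r.
rewrite /= sub0r normrN normr_id => /(_ yq dg) /le_trans; apply.
by rewrite ler_wpM2l ?norm_le_enorm// ltW.
Qed.


(** * Quadratic residuals under strong semismoothness *)

Section strong.
Variables (C0 q : R).
Hypotheses (C00 : 0 <= C0) (q0 : 0 < q).
Hypothesis jac_dirderiv : forall d, `|d| < q -> differentiable g (x + d) ->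
  enorm (d *m 'J g (x + d) - dirderiv g x d) <= C0 * enorm d ^+ 2.

(** As for one direction, but [k = u *: h + c] is compared with [h] through [dirderiv], which is
    positively homogeneous and Lipschitz. The perturbation [c] costs [m * L] twice, through the
    Jacobian and through [dirderiv]; [1 + n] bounds [enorm k] by [u * (1 + n) * enorm h], which uses
    [enorm h <= 1]. *)
Lemma strong_increment h : h != 0 -> `|h| < q / 2 -> `|h| < rho -> enorm h <= 1 ->
  enorm (g (x + h) - g x - dirderiv g x h) <=
    (C0 * (1 + n%:R) ^+ 2 + 2 * m%:R * L) * enorm h ^+ 2.
Proof.
move=> hn0 hq hrho h1; set K := leRHS.
have h0 : 0 < enorm h by rewrite lt0r enorm_eq0 hn0 enorm_ge0.
have K0 : 0 <= K by rewrite mulr_ge0 ?sqr_ge0// addr_ge0 ?mulr_ge0 ?sqr_ge0 ?(ltW L0).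
have xb : ball x rho x by exact: ballxx.
have bb := ballxD hrho.
apply/ler_addgt0Pr => z z0.
pose C := m%:R * (L * `|h|) + enorm (dirderiv g x h) + 1.
have Cp : 0 < C by rewrite ltr_wpDl// addr_ge0 ?enorm_ge0 ?mulr_ge0 ?(ltW L0).
pose eta := Num.min (1 / 2) (z / C).
have eta0 : 0 < eta by rewrite lt_min !divr_gt0.
have eta1 : eta < 1 by rewrite gt_min; apply/orP; left; lra.
have etaz : eta * C <= z by rewrite -ler_pdivlMr// ge_min lexx orbT.
have ab' : ball x rho (x + eta *: h).
  apply: ballxD; rewrite normrZ gtr0_norm// (le_lt_trans _ hrho)//.
  by rewrite ler_piMl// ltW.
have baE : (x + h) - (x + eta *: h) = (1 - eta) *: h.
  by apply/rowP => i; rewrite !mxE; ring.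
have eta1p : 0 < 1 - eta by rewrite subr_gt0.
have main : enorm (g (x + h) - g (x + eta *: h) - (1 - eta) *: dirderiv g x h)
    <= (1 - eta) * K.
  pose r := Num.min (eta * enorm h ^+ 2) (q / 2).
  have r0 : 0 < r by rewrite lt_min !mulr_gt0 ?exprn_gt0 ?invr_gt0.
  apply: (local_lipschitz_mvt_enorm gL ab' bb _ r0).
    by rewrite eq_sym -subr_eq0 baE scaler_eq0 (negPf hn0) gt_eqF.
  move=> s c /andP[s0 s1]; rewrite baE lt_min => /andP[cr cq] yb dy.
  pose u := eta + s * (1 - eta).
  have u0 : 0 < u by rewrite addr_gt0// mulr_gt0.
  have etau : eta <= u by rewrite lerDl ltW// mulr_gt0.
  have u1 : u <= 1.
    rewrite [leRHS](_ : 1 = eta + 1 * (1 - eta)); last by ring.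
    by rewrite lerD2l ler_wpM2r ?ltW.
  have cu : `|c| <= u * enorm h ^+ 2.
    by rewrite (le_trans (ltW cr))// ler_wpM2r ?sqr_ge0.
  move: yb dy; set y := x + _ + _ + c.
  pose k := u *: h + c.
  have -> : y = x + k by rewrite /y /k /u; apply/rowP => i; rewrite !mxE; ring.
  move=> yb dy.
  have kq : `|k| < q.
    rewrite (le_lt_trans (ler_normD _ _))// (splitr q) ltr_leD// ?(ltW cq)//.
    by rewrite normrZ gtr0_norm// (le_lt_trans _ hq)// ler_piMl.
  have ke : enorm k <= u * ((1 + n%:R) * enorm h).
    rewrite (le_trans (enormD _ _))// enormZ gtr0_norm// (mulrDl 1) mul1r (mulrDr u) lerD2l.
    rewrite (le_trans (enorm_le_norm _))// mulrCA ler_wpM2l// (le_trans cu)//.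
    by rewrite ler_wpM2l ?(ltW u0)// expr2 ler_piMl// ltW.
  rewrite -scalemxAl -scalerBr enormZ gtr0_norm// ler_pM2l//.
  rewrite -(ler_pM2l u0) -{1}(gtr0_norm u0) -enormZ.
  have -> : u *: (h *m 'J g (x + k) - dirderiv g x h) =
      (k *m 'J g (x + k) - dirderiv g x k) - c *m 'J g (x + k) +
      (dirderiv g x k - dirderiv g x (u *: h)).
    rewrite mulmxDl dirderivZ// -scalemxAl; move: (h *m _) (c *m _) => A1 A2.
    by apply/rowP => i; rewrite !mxE; ring.
  have -> : u * K = C0 * (u * ((1 + n%:R) ^+ 2 * enorm h ^+ 2)) +
     m%:R * (L * (u * enorm h ^+ 2)) + m%:R * (L * (u * enorm h ^+ 2)).
    by rewrite /K; ring.
  rewrite (le_trans (enormD _ _))// lerD//.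
    rewrite (le_trans (enormB _ _))// lerD//.
      rewrite (le_trans (jac_dirderiv kq dy))// ler_wpM2l// -exprMn.
      apply: (@le_trans _ _ ((u * ((1 + n%:R) * enorm h)) ^+ 2)).
        by rewrite ler_pXn2r// ?nnegrE ?enorm_ge0// (le_trans (enorm_ge0 k)).
      by rewrite [leLHS]exprMn ler_wpM2r ?sqr_ge0// (expr2 u) ler_piMl// ltW.
    rewrite (le_trans (enorm_jacobian _ yb dy))// ler_wpM2l// ler_wpM2l// ltW//.
  rewrite (le_trans (dirderiv_lipschitz _ _))// ler_wpM2l// ler_wpM2l ?(ltW L0)//.
  by rewrite /k addrAC subrr add0r.
have -> : g (x + h) - g x - dirderiv g x h =
   (g (x + h) - g (x + eta *: h) - (1 - eta) *: dirderiv g x h) +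
   (g (x + eta *: h) - g x) - eta *: dirderiv g x h.
  by apply/rowP => i; rewrite !mxE; ring.
apply: (@le_trans _ _ (K + eta * C)); last by rewrite lerD2l.
have -> : K + eta * C =
   K + m%:R * (L * (eta * `|h|)) + eta * enorm (dirderiv g x h) + eta.
  by rewrite /C; ring.
rewrite ler_wpDr ?(ltW eta0)// (le_trans (enormB _ _))// lerD//; last first.
  by rewrite enormZ gtr0_norm.
rewrite (le_trans (enormD _ _))// lerD//.
  by rewrite (le_trans main)// ler_piMl// gerBl ltW.
rewrite (le_trans (enorm_lipschitz ab' xb))// ler_wpM2l// ler_wpM2l ?(ltW L0)//.
by rewrite addrAC subrr add0r normrZ gtr0_norm.
Qed.

End strong.

End semismooth.

Lemma strongly_semismooth_jacobian (R : realType) n m (g : 'rV[R]_n -> 'rV[R]_m) x :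
  strongly_semismooth g x -> exists C : R, \forall y \near x, differentiable g y ->
    enorm (g y - g x - (y - x) *m 'J g y) <= C * enorm (y - x) ^+ 2.
Proof.
move=> [ss [C0 /nbhs_ballP[q /= q0 qP]]].
have [[U Ux /lipschitz_onP[L L0 gL]] _] := ss.
have /nbhs_ballP[rho /= rho0 rhoU] := Ux.
have {}gL y z : ball x rho y -> ball x rho z -> `|g y - g z| <= L * `|y - z|.
  by move=> /rhoU ? /rhoU ?; exact: gL.
have jd d : `|d| < q -> differentiable g (x + d) ->
    enorm (d *m 'J g (x + d) - dirderiv g x d) <= `|C0| * enorm d ^+ 2.
  move=> dq dg; have : ball 0 q d by rewrite -ball_normE /= sub0r normrN.
  move=> /qP /(_ _ (clarke_jacobian_differentiable dg)) /le_trans; apply.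
  by rewrite ler_wpM2r ?sqr_ge0// ler_norm.
exists ((`|C0| * (1 + n%:R) ^+ 2 + 2 * m%:R * L) + `|C0|).
pose e := Num.min (Num.min (q / 2) rho) (1 / n.+1%:R).
have e0 : 0 < e by rewrite !lt_min rho0 !divr_gt0.
apply/nbhs_ballP; exists e => // y; rewrite -ball_normE /= distrC !lt_min.
move=> /andP[/andP[yq yrho] y1] dg.
have [->|yx] := eqVneq y x; first by rewrite !subrr mul0mx !subrr !enorm0 expr0n mulr0.
have yE : x + (y - x) = y by rewrite addrC subrK.
have := jd (y - x); rewrite yE => /(_ _ dg) H1.
have h1 : enorm (y - x) <= 1.
  rewrite (le_trans (enorm_le_norm _))//.
  apply: (@le_trans _ _ (n.+1%:R * (1 / n.+1%:R))); last by rewrite mulrC divfK.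
  by rewrite ler_pM// ?ler_nat// ltW.
have := strong_increment L0 rho0 gL ss (normr_ge0 C0) q0 jd _ yq yrho h1.
rewrite subr_eq0 yE => /(_ yx) H2.
have -> : g y - g x - (y - x) *m 'J g y = (g y - g x - dirderiv g x (y - x)) -
  ((y - x) *m 'J g y - dirderiv g x (y - x)).
  by move: ((y - x) *m _) => A; apply/rowP => i; rewrite !mxE; ring.
rewrite (le_trans (enormB _ _))// mulrDl lerD// H1//.
by rewrite (lt_le_trans yq)// ler_pdivrMr// ler_peMr ?ler1n// ltW.
Qed.

(** * The penalty off the origin and its proximal map *)

Section mean_value.
Context {R : realType}.
Implicit Types (F : R -> R) (d C s t : R).

Lemma mvt_point F (F' : R -> R) (t0 : R) d s t :
  (forall u, `|u - t0| < d -> is_derive u 1 F (F' u)) ->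
  `|s - t0| < d -> `|t - t0| < d ->
  exists2 u, `|u - t0| < d /\ `|u - t| <= `|s - t| & F s - F t = F' u * (s - t).
Proof.
move=> dF.
have bnd a b u : `|a - t0| < d -> `|b - t0| < d -> a <= u <= b -> `|u - t0| < d.
  rewrite !ltr_norml => /andP[a1 a2] /andP[b1 b2] /andP[au ub].
  by apply/andP; split; lra.
have mvt a b : a <= b -> `|a - t0| < d -> `|b - t0| < d ->
    exists2 u, a <= u <= b & F b - F a = F' u * (b - a).
  move=> ab ad bd.
  have [||u] := @MVT_segment R F F' a b ab.
  - move=> u; rewrite in_itv => /andP[au ub]; apply: dF.
    by apply: bnd ad bd _; rewrite !ltW.
  - apply: derivable_within_continuous => u; rewrite in_itv => /= uab.
    by have [] := dF u (bnd _ _ _ ad bd uab).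
  - by rewrite in_itv => ? ?; exists u.
move=> sd td; have [st|/ltW ts] := leP s t.
  have [u ust Fu] := mvt s t st sd td; exists u.
    split; first exact: bnd sd td ust.
    by move: ust => /andP[? ?]; rewrite !ler0_norm ?subr_le0//; lra.
  by rewrite -opprB Fu -mulrN opprB.
have [u uts Fu] := mvt t s ts td sd; exists u => //.
split; first exact: bnd td sd uts.
by move: uts => /andP[? ?]; rewrite !ger0_norm ?subr_ge0//; lra.
Qed.

(** Both points vary, because the residuals to be estimated are expanded around the moving point and
    not around the limit. *)
Lemma local_taylor F (F' F'' : R -> R) (t0 : R) :
  (\forall u \near t0, is_derive (u : R) (1 : R) F (F' u)) ->
  (\forall u \near t0, is_derive (u : R) (1 : R) F' (F'' u)) ->
  {for t0, continuous F'} -> {for t0, continuous F''} ->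
  exists2 C, 0 < C & exists2 d, 0 < d &
    forall s t, `|s - t0| < d -> `|t - t0| < d ->
      `|F s - F t| <= C * `|s - t| /\
      `|F s - F t - (s - t) * F' t| <= C * `|s - t| ^+ 2.
Proof.
move=> dF dF' cF' cF''.
pose C := `|F' t0| + `|F'' t0| + 1.
have near_lt (K : R -> R) : {for t0, continuous K} -> \forall u \near t0, `|K u| <= `|K t0| + 1.
  move=> /cvgrPdist_le /(_ 1 ltr01); apply: filterS => u /= Ku.
  by rewrite -lerBlDl (le_trans _ Ku)// distrC lerB_dist.
have : \forall u \near t0, [/\ is_derive (u : R) (1 : R) F (F' u),
    is_derive (u : R) (1 : R) F' (F'' u), `|F' u| <= C & `|F'' u| <= C].
  apply: filterS2 (filterI dF dF') (filterI (near_lt _ cF') (near_lt _ cF'')).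
  move=> u [? ?] [F'u F''u]; split=> //; rewrite /C.
    by rewrite (le_trans F'u)// addrAC lerDl.
  by rewrite (le_trans F''u)// -addrA lerDr.
move=> /nbhs_ballP[d /= d0]; rewrite /ball/= => bP.
have dP u : `|u - t0| < d -> [/\ is_derive u 1 F (F' u), is_derive u 1 F' (F'' u),
    `|F' u| <= C & `|F'' u| <= C] by rewrite distrC => /bP.
exists C; first by rewrite ltr_wpDl// addr_ge0.
exists d => // s t sd td.
have [u [ud us] Fu] := @mvt_point F F' t0 d s t (fun u h => let: And4 r _ _ _ := dP u h in r) sd td.
split; first by rewrite Fu normrM ler_wpM2r//; have [] := dP u ud.
have [v [vd _] F'v] := @mvt_point F' F'' t0 d u t (fun u h => let: And4 _ r _ _ := dP u h in r) ud td.
have -> : F s - F t - (s - t) * F' t = F'' v * (u - t) * (s - t).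
  by rewrite Fu -F'v; ring.
rewrite !normrM expr2 mulrA ler_wpM2r// ler_pM//.
by have [] := dP v vd.
Qed.

End mean_value.

Section power.
Context {R : realType}.
Implicit Types (q t : R).

(* The derivatives of [abspow q] off the origin are of this shape. *)
Definition sgpow (c b : R) (k : nat) (t : R) : R := c * Num.sg t ^+ k * `|t| `^ b.

Definition dpow q := sgpow q (q - 1) 1.
Definition ddpow q := sgpow (q * (q - 1)) (q - 1 - 1) 2.

Lemma normr_sg_near t : t != 0 ->
  \forall u \near t, Num.sg u = Num.sg t /\ 0 < Num.sg t * u.
Proof.
move=> t0; have t'0 : 0 < `|t| by rewrite normr_gt0.
apply/nbhs_ballP; exists `|t| => // u; rewrite /ball/=.
case: (sgrP t) => [ht|ht|ht]; first by rewrite ht eqxx in t0.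
  rewrite ltr_norml => /andP[u1 u2]; have u3 : 0 < u by lra.
  by rewrite (gtr0_sg u3); split=> //; lra.
rewrite distrC ltr_norml => /andP[u1 u2]; have u3 : u < 0 by lra.
by rewrite (ltr0_sg u3); split=> //; lra.
Qed.

Lemma is_derive_powR_scale (s a t : R) : 0 < s * t ->
  is_derive t 1 (fun u => (s * u) `^ a) (a * (s * t) `^ (a - 1) * s).
Proof.
move=> st; apply: (@is_derive1_comp _ (fun v => v `^ a) (fun u => s * u)).
  exact: is_derive1_powR.
have := @is_deriveZ _ _ _ id s t 1 1 (is_derive_id t 1).
by rewrite [_ *: _]mulr1.
Qed.

Lemma is_derive_sgpow (c b : R) k t : t != 0 ->
  is_derive t 1 (sgpow c b k) (sgpow (c * b) (b - 1) k.+1 t).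
Proof.
move=> t0; have st := normr_sg_near t0; have [_ st0] := nbhs_singleton st.
have dp := is_derive_powR_scale b st0.
have := is_deriveZ (c * Num.sg t ^+ k) dp.
rewrite (_ : _ *: _ = sgpow (c * b) (b - 1) k.+1 t); last first.
  by rewrite /sgpow /GRing.scale/= normrEsg exprS; ring.
apply: near_eq_is_derive; apply: filterS st => u [su us].
by rewrite /sgpow normrEsg su.
Qed.

Lemma continuous_sgpow (c b : R) k t : t != 0 -> {for t, continuous (sgpow c b k)}.
Proof.
move=> /(is_derive_sgpow c b k)[+ _].
by move=> /derivable1_diffP /differentiable_continuous.
Qed.

Lemma is_derive_abspow q t : t != 0 -> is_derive t 1 (abspow q) (dpow q t).
Proof.
move=> t0; have st := normr_sg_near t0.
have := is_derive_sgpow 1 q 0 t0; rewrite mul1r; apply: near_eq_is_derive.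
apply: filterS st => u [su us]; rewrite /abspow /sgpow expr0 mulr1 mul1r ifF//.
by apply: contraTF us => /eqP ->; rewrite mulr0 ltxx.
Qed.

Lemma near_neq0 t : t != 0 -> \forall u \near t, u != 0.
Proof.
move=> /normr_sg_near; apply: filterS => u [_ us].
by apply: contraTneq us => ->; rewrite mulr0 ltxx.
Qed.

Lemma dpow_taylor q (t0 : R) : t0 != 0 ->
  exists2 C, 0 < C & exists2 d, 0 < d &
    forall s t, `|s - t0| < d -> `|t - t0| < d ->
      `|dpow q s - dpow q t| <= C * `|s - t| /\
      `|dpow q s - dpow q t - (s - t) * ddpow q t| <= C * `|s - t| ^+ 2.
Proof.
move=> t0n0; have nt := near_neq0 t0n0.
apply: (local_taylor (F'' := sgpow (q * (q - 1) * (q - 1 - 1)) (q - 1 - 1 - 1) 3)).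
- by apply: filterS nt => u; exact: is_derive_sgpow.
- by apply: filterS nt => u; exact: is_derive_sgpow.
- exact: continuous_sgpow.
- exact: continuous_sgpow.
Qed.

End power.

Lemma neq0_near_point (R : realType) (t s : R) : t - `|t| < s < t + `|t| -> s != 0.
Proof.
apply: contraTneq => ->; apply/negP => /andP[].
by case: (ger0P t) => _; rewrite subrr ltxx.
Qed.

Section prox.
Context {R : realType} {n : nat}.
Variables (q mu : R) (z w : 'rV[R]_n).
Hypothesis w_prox : prox (fun y => mu * lqq q y) z w.

Lemma prox_coord i s : 2^-1 * (z 0 i - w 0 i) ^+ 2 + mu * abspow q (w 0 i) <=
  2^-1 * (z 0 i - s) ^+ 2 + mu * abspow q s.
Proof.
have := w_prox (\row_j if j == i then s else w 0 j).
rewrite !enorm_sqr /dot /lqq (bigD1 i)//= [X in _ + mu * X <= _](bigD1 i)//=.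
rewrite [X in _ <= _ * X + _](bigD1 i)//= [X in _ <= _ + _ * X](bigD1 i)//=.
rewrite !mxE eqxx; under [X in _ <= _ * (_ + X) + _]eq_bigr => j ji.
  rewrite !mxE (negPf ji); over.
under [X in _ <= _ + _ * (_ + X)]eq_bigr => j ji.
  rewrite !mxE (negPf ji); over.
under [X in _ * (_ + X) + _ <= _]eq_bigr => j ji do rewrite !mxE.
move: (\sum_(j < n | _) (_ - _) * _) (\sum_(j < n | j != i) abspow q (w 0 j)).
by move=> A B; lra.
Qed.

(* Compare with the candidates obtained by zeroing and by doubling the entry:
   the average of the two inequalities does not involve [z]. *)
Lemma prox_entry i : mu * (1 - 2 `^ (q - 1)) * abspow q (w 0 i) <= 2^-1 * w 0 i ^+ 2.
Proof.
have [->|t0] := eqVneq (w 0 i) 0; first by rewrite /abspow eqxx mulr0 expr0n mulr0.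
have H0 := prox_coord i 0; have H2 := prox_coord i (2 * w 0 i).
have A2 : abspow q (2 * w 0 i) = 2 * 2 `^ (q - 1) * abspow q (w 0 i).
  rewrite /abspow mulf_eq0 (negPf t0) orbF ifF ?pnatr_eq0// normrM powRM// gtr0_norm//.
  have := @powRD R 2 1 (q - 1); rewrite pnatr_eq0 implybT powRr1// => /(_ isT) <-.
  by rewrite addrC subrK.
have A0 : abspow q 0 = 0 by rewrite /abspow eqxx.
rewrite A2 in H2; rewrite A0 in H0.
clear A2 A0; move: H0 H2; move: (abspow q (w 0 i)) => b.
move: (2 `^ _) (w 0 i) (z 0 i) => a t y H0 H2; lra.
Qed.

Lemma prox_stationary i : w 0 i != 0 -> w 0 i - z 0 i + mu * dpow q (w 0 i) = 0.
Proof.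
set t : R := w 0 i => t0; set y : R := z 0 i.
pose F (s : R) : R := 2^-1 * (y - s) ^+ 2 + mu * abspow q s.
have dF (s : R) : s != 0 -> is_derive s (1 : R) F (s - y + mu * dpow q s).
  move=> s0; have dab := is_deriveZ mu (is_derive_abspow q s0).
  have d1 := is_deriveB (is_derive_cst y s 1) (is_derive_id s 1).
  have := is_deriveD (is_deriveZ (2^-1 : R) (is_deriveX 2 d1)) dab.
  rewrite (_ : 2^-1 *: _ + _ = s - y + mu * dpow q s); last first.
    rewrite (_ : (cst y - id) s = y - s)//.
    by move: (dpow q s) => p; rewrite /GRing.scale/= expr1; field.
  by congr (is_derive _ _ _ _); apply/funext => u; rewrite /F expr2.
have t'0 : 0 < `|t| by rewrite normr_gt0.
have min0 : is_derive t (1 : R) F 0.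
  apply: (@derive1_at_min R F (t - `|t|) (t + `|t|)).
  - by rewrite lerD2l ge0_cp.
  - by move=> s; rewrite in_itv /= => /neq0_near_point /dF[].
  - by rewrite in_itv /= ltrDl t'0 ltrBlDr ltrDl t'0.
  - by move=> s _; exact: prox_coord.
have [_ <-] := min0; have [_ ->//] := dF t t0.
Qed.

End prox.

(** If [|w i| < 1] then [|w i| <= |w i|^q], and [prox_entry] becomes [c <= |w i| / 2]. The constant
    [c] is positive because [2 ^ (q - 1) < 1]. *)
Lemma prox_lower_bound (R : realType) n (q mu : R) : 0 < mu -> q < 1 ->
  exists2 k : R, 0 < k & forall (z w : 'rV[R]_n), prox (fun y => mu * lqq q y) z w ->
    forall i, w 0 i != 0 -> k <= `|w 0 i|.
Proof.
move=> mu0 q1; pose c := mu * (1 - 2 `^ (q - 1)).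
have c0 : 0 < c.
  rewrite mulr_gt0// subr_gt0 /powR pnatr_eq0/= expR_lt1.
  by rewrite nmulr_rlt0 ?subr_lt0// ln_gt0// ltr1n.
exists (Num.min 1 (2 * c)) => [|z w /prox_entry H i wi0].
  by rewrite lt_min ltr01 mulr_gt0.
have := H i; rewrite -/c => {}H.
have wi : 0 < `|w 0 i| by rewrite normr_gt0.
rewrite leNgt lt_min; apply/negP => /andP[w1 wc].
have : `|w 0 i| <= abspow q (w 0 i).
  rewrite /abspow (negPf wi0); apply: ger1_powR; last exact: ltW.
  by rewrite wi ltW.
rewrite -(ler_pM2l c0) => /le_trans /(_ H).
rewrite -real_normK ?num_real// expr2 mulrA ler_pM2r// mulrC.
by rewrite ler_pdivlMr// mulrC leNgt wc.
Qed.

(** * Generalized Hessians *)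

Section generalized_hessian.
Context {R : realType} {n : nat}.
Implicit Types (M N : 'M[R]_n) (K : set 'M[R]_n) (u v y : 'rV[R]_n).

Lemma limit_setP m (D : set 'rV[R]_n) (J : 'rV[R]_n -> 'M[R]_(n, m)) y (M' : 'M[R]_(n, m)) :
  limit_set D J y M' <->
  forall e : R, 0 < e -> exists z, [/\ D z, `|z - y| < e & `|J z - M'| < e].
Proof.
split=> [[u [Du uy Ju]] e e0|H].
  have uy' : \forall i \near \oo, `|u i - y| < e.
    by move/cvgrPdist_lt : uy => /(_ e e0); apply: filterS => i; rewrite distrC.
  have Ju' : \forall i \near \oo, `|J (u i) - M'| < e.
    by move/cvgrPdist_lt : Ju => /(_ e e0); apply: filterS => i; rewrite distrC.
  by have [i [ui Ji]] := filter_ex (filterI uy' Ju'); exists (u i).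
have /choice[u uP] k : exists z, [/\ D z, `|z - y| < k.+1%:R^-1 & `|J z - M'| < k.+1%:R^-1].
  by apply: H; rewrite invr_gt0.
have inv_lt e : 0 < e -> \forall i \near \oo, i.+1%:R^-1 < e :> R.
  move=> e0; have [k ke] := natSinv_lt e0; exists k => // i /= ki.
  by rewrite (le_lt_trans _ ke)// lef_pV2 ?posrE// ler_nat.
exists u; split => [i||]; first by have [] := uP i.
- apply/cvgrPdist_lt => e /inv_lt; apply: filterS => i; rewrite distrC.
  by apply: lt_trans; have [] := uP i.
- apply/cvgrPdist_lt => e /inv_lt; apply: filterS => i; rewrite distrC.
  by apply: lt_trans; have [] := uP i.
Qed.

Lemma gen_hessian_sub (f : 'rV[R]_n -> R) y K :
  (forall M N (t : R), 0 <= t <= 1 -> K M -> K N -> K (t *: M + (1 - t) *: N)) ->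
  limit_set (twice_differentiable f) (hessian f) y `<=` K ->
  gen_hessian f y `<=` K.
Proof.
move=> cK; apply: smallest_sub => M N t; rewrite !inE => KM KN; apply: cK => //.
by apply/andP; split.
Qed.

Lemma dot_mulmx_le u v M : `|dot (u *m M) v| <= n%:R * n%:R * `|u| * `|M| * enorm v.
Proof.
rewrite (le_trans (normr_dot_le _ _))// ler_wpM2r ?enorm_ge0//.
rewrite (le_trans (enorm_le_norm _))// -!mulrA ler_wpM2l// mulrA.
exact: mx_norm_mulmx.
Qed.

Lemma enorm_mulmx_le u M : enorm (u *m M) <= n%:R * n%:R * `|u| * `|M|.
Proof.
rewrite (le_trans (enorm_le_norm _))// -!mulrA ler_wpM2l// mulrA.
exact: mx_norm_mulmx.
Qed.

Lemma gen_hessian_ge (f : 'rV[R]_n -> R) y (v : 'rV[R]_n) c :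
  (\forall z \near y, twice_differentiable f z -> c <= dot (v *m hessian f z) v) ->
  forall M, gen_hessian f y M -> c <= dot (v *m M) v.
Proof.
move=> /nbhs_ballP[q /= q0 qP]; apply: gen_hessian_sub => /=.
  move=> M N t /andP[t0 t1] HM HN.
  rewrite mulmxDr -!scalemxAr dotDl !dotZl.
  have -> : c = t * c + (1 - t) * c by ring.
  by rewrite lerD// ler_wpM2l// subr_ge0.
move=> M /limit_setP lM; apply/ler_addgt0Pr => e e0.
pose C := n%:R * n%:R * `|v| * enorm v + 1.
have C0 : 0 < C by rewrite ltr_wpDl// !mulr_ge0 ?enorm_ge0.
have /lM[z [Dz zy JM]] : 0 < Num.min q (e / C) by rewrite lt_min q0 divr_gt0.
move: zy JM; rewrite !lt_min => /andP[zq _] /andP[_ JM].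
have /qP /(_ Dz) H : ball y q z by rewrite -ball_normE /= distrC.
rewrite (le_trans H)// -lerBlDl -dotBl -mulmxBr (le_trans (ler_norm _))//.
rewrite (le_trans (dot_mulmx_le _ _ _))// mulrAC.
apply: (@le_trans _ _ (C * (e / C))); last by rewrite mulrC divfK// gt_eqF.
by rewrite ler_pM ?mulr_ge0 ?enorm_ge0 ?lerDl// ltW.
Qed.

(** A bound on the norm of an affine function of [M] is a convex condition, so it passes from limits
    of Hessians to their convex hull; continuity of [G] and [b] carries it to the limits. *)
Lemma gen_hessian_residual (f : 'rV[R]_n -> R) (G : 'rV[R]_n -> 'rV[R]_n) (L : R)
    (b : 'rV[R]_n -> R) (U : set 'rV[R]_n) (a p y : 'rV[R]_n) :
  0 < L -> (forall x y, U x -> U y -> `|G x - G y| <= L * `|x - y|) -> nbhs y U ->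
  {for y, continuous b} ->
  (\forall z \near y, twice_differentiable f z ->
     enorm (G z - a - (z - p) *m hessian f z) <= b z) ->
  forall M, gen_hessian f y M -> enorm (G y - a - (y - p) *m M) <= b y.
Proof.
move=> L0 GL Uy cb bz; apply: gen_hessian_sub => /= [M N t /andP[t0 t1] HM HN|M /limit_setP lM].
  have -> : G y - a - (y - p) *m (t *: M + (1 - t) *: N) =
    t *: (G y - a - (y - p) *m M) + (1 - t) *: (G y - a - (y - p) *m N).
    rewrite mulmxDr -!scalemxAr; move: (_ *m M) (_ *m N) => A B.
    by apply/rowP => i; rewrite !mxE; ring.
  have -> : b y = t * b y + (1 - t) * b y by ring.
  rewrite (le_trans (enormD _ _))// !enormZ lerD//.
    by rewrite ger0_norm// ler_wpM2l.
  by rewrite ger0_norm ?subr_ge0// ler_wpM2l// subr_ge0.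
apply/ler_addgt0Pr => e e0.
have e20 : 0 < e / 2 by rewrite divr_gt0.
(* In order, the costs of replacing [z] by [y] in [G], [z] by [y] in [z - p], and [hessian f z] by
   [M]; the final 1 keeps [C] positive. *)
pose C := n%:R * L + n%:R * n%:R * (`|M| + 1) + n%:R * n%:R * `|y - p| + 1.
have C0 : 0 < C by rewrite ltr_wpDl// !addr_ge0 ?mulr_ge0 ?addr_ge0// ltW.
have cb' : \forall z \near y, b z <= b y + e / 2.
  move/cvgrPdist_le : cb => /(_ _ e20); apply: filterS => z /= H.
  by rewrite -lerBlDl (le_trans _ H)// distrC ler_norm.
have : \forall z \near y, [/\ U z, b z <= b y + e / 2 & twice_differentiable f z ->
     enorm (G z - a - (z - p) *m hessian f z) <= b z].
  by apply: filterS3 Uy cb' bz => z ? ? ?; split.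
move=> /nbhs_ballP[q /= q0 qP].
pose d := Num.min (Num.min q 1) (e / 2 / C).
have d0 : 0 < d by rewrite !lt_min q0 ltr01 divr_gt0.
have /lM[z [Dz zy JM]] := d0.
have [zq JM1] : `|z - y| < q /\ `|hessian f z - M| < 1.
  by move: zy JM; rewrite !lt_min => /andP[/andP[-> _] _] /andP[/andP[_ ->] _].
have dC : d * C <= e / 2 by rewrite -ler_pdivlMr// ge_min lexx orbT.
have /qP[Uz bz2 /(_ Dz) bz3] : ball y q z by rewrite -ball_normE /= distrC.
have -> : G y - a - (y - p) *m M = (G z - a - (z - p) *m hessian f z) + (G y - G z) +
    (z - y) *m hessian f z + (y - p) *m (hessian f z - M).
  rewrite !mulmxBr !mulmxBl; move: (y *m M) (p *m M) (y *m _) (z *m _) (p *m _) => A1 A2 A3 A4 A5.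
  by apply/rowP => i; rewrite !mxE; ring.
have nJ : `|hessian f z| <= `|M| + 1.
  by rewrite -(subrK M (hessian f z)) (le_trans (ler_normD _ _))// addrC lerD2l ltW.
have {}dC : b z + n%:R * (L * d) + n%:R * n%:R * d * (`|M| + 1) +
    n%:R * n%:R * `|y - p| * d <= b y + e.
  have : d * C = n%:R * (L * d) + n%:R * n%:R * d * (`|M| + 1) +
    n%:R * n%:R * `|y - p| * d + d by rewrite /C; ring.
  by move: dC bz2 (ltW d0); clear; lra.
rewrite (le_trans _ dC)// (le_trans (enormD _ _))// lerD//; last first.
  by rewrite (le_trans (enorm_mulmx_le _ _))// ler_wpM2l ?mulr_ge0// ltW.
rewrite (le_trans (enormD _ _))// lerD//; last first.
  by rewrite (le_trans (enorm_mulmx_le _ _))// ler_pM ?mulr_ge0// ler_wpM2l ?mulr_ge0// ltW.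
rewrite (le_trans (enormD _ _))// lerD// (le_trans (enorm_le_norm _))// ler_wpM2l//.
by rewrite (le_trans (GL _ _ (nbhs_singleton Uy) Uz))// ler_wpM2l ?(ltW L0)// distrC ltW.
Qed.

End generalized_hessian.

Definition supported (R : realType) n (S : {set 'I_n}) (v : 'rV[R]_n) : Prop :=
  forall i, i \notin S -> v 0 i = 0.

Lemma normr_enormB (R : realType) n (u v : 'rV[R]_n) :
  `|enorm u - enorm v| <= n%:R * `|u - v|.
Proof.
apply: le_trans (enorm_le_norm _); rewrite ler_norml; apply/andP; split.
  by rewrite lerNl opprB lerBlDr enorm_distC -{1}(subrK u v) enormD.
by rewrite lerBlDr -{1}(subrK v u) enormD.
Qed.

Lemma enorm_continuous (R : realType) n : continuous (@enorm R n).
Proof. exact: (klipschitz_continuous (@normr_enormB R n)). Qed.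

Lemma enorm_dist_continuous (R : realType) n (p : 'rV[R]_n) :
  continuous (fun y : 'rV[R]_n => enorm (y - p)).
Proof.
apply: (@klipschitz_continuous R 'rV[R]_n R _ n%:R) => u v.
by rewrite (le_trans (normr_enormB _ _))// opprB addrA subrK.
Qed.

Lemma compact_supported_sphere (R : realType) n (S : {set 'I_n}) :
  compact [set v : 'rV[R]_n | supported S v /\ enorm v = 1].
Proof.
apply: bounded_closed_compact.
  exists 1; split => // M M1 v /= [_ v1]; apply: le_trans (ltW M1).
  by rewrite -v1 norm_le_enorm.
rewrite (_ : [set v | _] = (\bigcap_(i in [set i | i \notin S])
    ((fun v : 'rV[R]_n => v 0 i) @^-1` [set 0])) `&` ((@enorm R n) @^-1` [set 1])) //.
apply: closedI; last first.
  by apply: preimage_closed => [v _|]; [exact: enorm_continuous|exact: closed_eq].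
apply: closed_bigI => i _.
by apply: preimage_closed => [v _|]; [exact: coord_continuous|exact: closed_eq].
Qed.

Lemma mx_norm_vec_mx (R : realType) m n (u : 'rV[R]_(m * n)) : `|vec_mx u| <= `|u|.
Proof. by apply: mx_norm_le => // i j; rewrite mxE le_mx_norm. Qed.

Lemma mx_norm_mxvec (R : realType) m n (A : 'M[R]_(m, n)) : `|mxvec A| <= `|A|.
Proof.
apply: mx_norm_le => // i j; rewrite ord1; case/mxvec_indexP: j => k l.
by rewrite mxvecE le_mx_norm.
Qed.

Lemma jacobian_norm_le (R : realType) n m (g : 'rV[R]_n -> 'rV[R]_m) (L : R)
    (U : set 'rV[R]_n) (y : 'rV[R]_n) : 0 <= L ->
  (forall x y, U x -> U y -> `|g x - g y| <= L * `|x - y|) -> nbhs y U ->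
  differentiable g y -> `|'J g y| <= L.
Proof.
move=> L0 gL Uy dg; apply: mx_norm_le => // i j.
have -> : 'J g y i j = ((delta_mx 0 i : 'rV[R]_n) *m 'J g y) 0 j by rewrite -rowE [RHS]mxE.
rewrite (le_trans (le_mx_norm _ _ _))// (le_trans (jacobian_lipschitz _ gL Uy dg))//.
rewrite -[leRHS]mulr1 ler_wpM2l//; apply: mx_norm_le => // k l.
by rewrite mxE; case: (_ && _); rewrite ?normr1 ?normr0.
Qed.

(** Hessians near [p] are bounded by [L], so pairs of a flattened Hessian and a unit vector stay in
    a compact set. Around a pair whose matrix is a limit Hessian at [p], the form remains at least
    [c]; any other matrix has a neighbourhood avoided by the Hessians at points close to [p].
    Compactness makes the closeness uniform. *)
Lemma hessian_pd_near (R : realType) n (f : 'rV[R]_n -> R) (L rho c c' : R)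
    (S : {set 'I_n}) (p : 'rV[R]_n) :
  0 < L -> 0 < rho ->
  (forall x y, ball p rho x -> ball p rho y -> `|grad f x - grad f y| <= L * `|x - y|) ->
  c < c' ->
  (forall M, limit_set (twice_differentiable f) (hessian f) p M ->
     forall v, supported S v -> enorm v = 1 -> c' <= dot (v *m M) v) ->
  \forall y \near p, twice_differentiable f y ->
    forall v, supported S v -> c * enorm v ^+ 2 <= dot (v *m hessian f y) v.
Proof.
move=> L0 rho0 GL cc' pd.
pose K1 := [set u : 'rV[R]_(n * n) | `|u| <= L].
pose K2 := [set v : 'rV[R]_n | supported S v /\ enorm v = 1].
have cK1 : compact K1.
  apply: bounded_closed_compact.
    by exists L; split => [|M M1 u /= /le_trans]; [exact: num_real|apply; exact: ltW].
  rewrite (_ : K1 = (fun u : 'rV[R]_(n * n) => `|u|) @^-1` [set r | r <= L]); last by [].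
  by apply: preimage_closed => [d _|]; [exact: norm_continuous|exact: closed_le].
have cK := compact_setX cK1 (@compact_supported_sphere R n S).
pose P (y : 'rV[R]_n) (uv : 'rV[R]_(n * n) * 'rV[R]_n) := twice_differentiable f y ->
  mxvec (hessian f y) = uv.1 -> K1 uv.1 -> K2 uv.2 ->
  c <= dot (uv.2 *m hessian f y) uv.2.
have : \forall y \near p, K1 `*` K2 `<=` P y.
  have /compact_near_coveringP := cK.
  move=> /(_ _ (nbhs p : set_system 'rV[R]_n) P _) H; apply: H => -[u v] [/= Ku [vS v1]].
  have [lM|nlM] := pselect (limit_set (twice_differentiable f) (hessian f) p (vec_mx u)).
    pose C := n%:R * n%:R * L + n%:R * n%:R + n%:R * n%:R * L * n%:R + 1.
    have C0 : 0 < C by rewrite ltr_wpDl// !addr_ge0 ?mulr_ge0 ?(ltW L0).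
    pose d := (c' - c) / C; have d0 : 0 < d by rewrite divr_gt0// subr_gt0.
    exists (ball u d `*` ball v d, setT) => /=.
      split; last exact: filterT.
      by exists (ball u d, ball v d) => //=; split; exact: nbhsx_ballx.
    move=> [[u' v'] y] /= [[ud vd] _] Dy /= Ju Ku' [v'S v'1].
    move: ud vd; rewrite -!ball_normE /= => ud vd.
    have {Ju} -> : hessian f y = vec_mx u' by rewrite -Ju mxvecK.
    have M' : `|vec_mx u' : 'M[R]_n| <= L by rewrite (le_trans (mx_norm_vec_mx _)).
    have dM : `|vec_mx u - vec_mx u' : 'M[R]_n| <= d.
      by rewrite -linearB (le_trans (mx_norm_vec_mx _))// ltW.
    have nv : `|v| <= 1 by rewrite -v1 norm_le_enorm.
    have nM : `|vec_mx u : 'M[R]_n| <= L by rewrite (le_trans (mx_norm_vec_mx _)).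
    have vve : enorm (v - v') <= n%:R * d.
      by rewrite (le_trans (enorm_le_norm _))// ler_wpM2l// ltW.
    have c'le : c' <= dot (v *m vec_mx u) v by apply: pd.
    have -> : c = c' - C * d by rewrite /d mulrC divfK ?gt_eqF// opprB addrC subrK.
    have : dot (v *m vec_mx u) v - dot (v' *m vec_mx u') v' <= C * d; last by lra.
    have -> : dot (v *m vec_mx u) v - dot (v' *m vec_mx u') v' =
        dot ((v - v') *m vec_mx u) v + dot (v' *m (vec_mx u - vec_mx u')) v +
        dot (v' *m vec_mx u') (v - v').
      by rewrite mulmxBl mulmxBr !(dotBl, dotBr); ring.
    have -> : C * d = n%:R * n%:R * d * L * 1 + n%:R * n%:R * 1 * d * 1 +
        n%:R * n%:R * 1 * L * (n%:R * d) + d by rewrite /C; ring.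
    have nv' : `|v'| <= 1 by rewrite -v'1 norm_le_enorm.
    have dv := ltW vd.
    rewrite ler_wpDr ?(ltW d0)// lerD ?lerD// (le_trans (ler_norm _))//;
      rewrite (le_trans (dot_mulmx_le _ _ _))// ?v1.
    - by rewrite ler_wpM2r// ler_pM ?mulr_ge0// ler_wpM2l ?mulr_ge0.
    - by rewrite ler_wpM2r// ler_pM ?mulr_ge0// ler_wpM2l ?mulr_ge0.
    - rewrite ler_pM ?mulr_ge0 ?enorm_ge0// ler_pM ?mulr_ge0//.
      by rewrite ler_wpM2l ?mulr_ge0.
  have [e e0 eP] : exists2 e : R, 0 < e & forall y, twice_differentiable f y ->
      `|y - p| < e -> e <= `|hessian f y - vec_mx u|.
    apply: contrapT => H; apply: nlM; apply/limit_setP => e e0.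
    apply: contrapT => H2; apply: H; exists e => // y Dy ye.
    by rewrite leNgt; apply/negP => H3; apply: H2; exists y.
  exists (ball u e `*` setT, ball p e) => /=.
    split; last exact: nbhsx_ballx.
    by exists (ball u e, setT) => //=; split; [exact: nbhsx_ballx|exact: filterT].
  move=> [[u' v'] y] /= [[ue _] ye] Dy /= Ju _ _.
  move: ue ye; rewrite -!ball_normE /= => ue; rewrite distrC => /(eP _ Dy).
  rewrite leNgt (le_lt_trans _ ue)// -[hessian f y]mxvecK Ju -linearB distrC.
  exact: mx_norm_vec_mx.
have : \forall y \near p, ball p rho y by exact: nbhsx_ballx.
apply: filterS2 => y yb KP Dy v vS.
have [->|vn0] := eqVneq v 0; first by rewrite enorm0 expr0n mulr0 mul0mx dot0l.
have ve0 : 0 < enorm v by rewrite lt0r enorm_eq0 vn0 enorm_ge0.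
pose w := (enorm v)^-1 *: v.
have vE : v = enorm v *: w by rewrite scalerA divff ?gt_eqF// scale1r.
have Kw : K2 w.
  split; first by move=> i iS; rewrite mxE vS// mulr0.
  by rewrite enormZ ger0_norm ?invr_ge0 ?enorm_ge0// mulVf// gt_eqF.
have Ku : K1 (mxvec (hessian f y)).
  rewrite /K1 /= (le_trans (mx_norm_mxvec _))//.
  apply: (jacobian_norm_le (ltW L0) GL); last by have [] := Dy.
  by apply: open_nbhs_nbhs; split => //; exact: ball_open.
have /= := KP (mxvec (hessian f y), w) (conj Ku Kw) Dy erefl Ku Kw.
have -> : dot (v *m hessian f y) v = enorm v ^+ 2 * dot (w *m hessian f y) w.
  by rewrite {1 2}vE -scalemxAl dotZl dotZr mulrA -expr2.
by rewrite mulrC ler_pM2l// exprn_gt0.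
Qed.

(** * The restricted objective *)

Lemma derive_dot_grad (R : realType) n (F : 'rV[R]_n -> R) (y v : 'rV[R]_n) :
  differentiable F y -> 'D_v F y = dot v (grad F y).
Proof.
move=> dF; rewrite deriveE// {1}(row_sum_delta v) linear_sum.
by apply: eq_bigr => i _; rewrite linearZ /= !mxE deriveE.
Qed.

Lemma is_derive_line (R : realType) n (F : 'rV[R]_n -> R) (p v : 'rV[R]_n) (t : R) :
  differentiable F (p + t *: v) ->
  is_derive t (1 : R) (fun s => F (p + s *: v)) (dot v (grad F (p + t *: v))).
Proof.
move=> dF; rewrite -derive_dot_grad//.
have E : (fun s : R => s^-1 *: (F (p + (s *: (1 : R) + t) *: v) - F (p + t *: v))) =
    (fun s : R => s^-1 *: (F (s *: v + (p + t *: v)) - F (p + t *: v))).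
  apply/funext => s; congr (_ *: (F _ - _)).
  by rewrite [s *: 1]mulr1 scalerDl addrCA.
split; last by rewrite /derive E.
by rewrite /derivable E; exact: diff_derivable.
Qed.

Lemma differentiable_coord_comp (R : realType) n (F : R -> R) (y : 'rV[R]_n) i dF :
  is_derive (y 0 i) (1 : R) F dF ->
  differentiable (fun z : 'rV[R]_n => F (z 0 i)) y /\
  forall v, 'D_v (fun z : 'rV[R]_n => F (z 0 i)) y = v 0 i * dF.
Proof.
move=> [/derivable1_diffP dF1 dFE].
have dc := differentiable_coord y 0 i.
have dcomp : differentiable (fun z : 'rV[R]_n => F (z 0 i)) y.
  exact: (@differentiable_comp _ _ _ _ (fun z : 'rV[R]_n => z 0 i) F).
split => // v; rewrite deriveE//.
rewrite (@diff_comp _ _ _ _ (fun z : 'rV[R]_n => z 0 i) F)//=.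
rewrite -dFE deriveE// -[X in 'd F _ X]mulr1 [_ * 1]/(_ *: _) linearZ /=.
congr (_ *: _); rewrite -deriveE//.
apply: cvg_lim => //; apply: cvg_near_cst.
apply: filterS (nbhs_dnbhs_neq (0 : R)) => s s0.
by rewrite /= !mxE addrK [_ *: _]mulKf.
Qed.

Lemma jacobian_subZ (R : realType) n m (g h : 'rV[R]_n -> 'rV[R]_m) (l : R) x :
  differentiable g x -> differentiable h x ->
  differentiable (fun y => g y - l *: h y) x /\
  'J (fun y => g y - l *: h y) x = 'J g x - l *: 'J h x.
Proof.
move=> dg dh; apply: jacobian_unique => e e0.
have l0 : 0 < 1 + `|l| by rewrite ltr_pwDl.
have e'0 : 0 < e / (1 + `|l|) by rewrite divr_gt0.
apply: filterS2 (jacobian_approx dg e'0) (jacobian_approx dh e'0) => v Hg Hh.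
have -> : g (x + v) - l *: h (x + v) - (g x - l *: h x) - v *m ('J g x - l *: 'J h x) =
    (g (x + v) - g x - v *m 'J g x) - l *: (h (x + v) - h x - v *m 'J h x).
  move: ('J g x) ('J h x) => Jg Jh; rewrite mulmxBr -scalemxAr; move: (v *m Jg) (v *m Jh) => A B.
  move: (g (x + v)) (h (x + v)) (g x) (h x) => a b c d.
  by apply/rowP => i; rewrite !mxE; ring.
have -> : e * `|v| = e / (1 + `|l|) * `|v| + `|l| * (e / (1 + `|l|) * `|v|).
  by field; rewrite gt_eqF.
move: (_ - _ - _ *m _) (_ - _ - _ *m _) Hg Hh => A B HA HB.
by rewrite (le_trans (ler_normB _ _))// lerD// normrZ ler_wpM2l.
Qed.

Section restricted.
Context {R : realType} {n : nat}.
Variables (f : 'rV[R]_n -> R) (lambda q : R) (S : {set 'I_n}).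
Hypothesis fd : forall y, differentiable f y.
Implicit Types y z v : 'rV[R]_n.

Definition nonzero_on y := forall i, i \in S -> y 0 i != 0.

Definition dlqq y : 'rV[R]_n := \row_i (if i \in S then dpow q (y 0 i) else 0).

Definition ddlqq y : 'M[R]_n :=
  diag_mx (\row_i (if i \in S then ddpow q (y 0 i) else 0)).

Let E := restricted_objective f lambda q S.

Lemma restricted_objectiveE y : E y = f y + lambda * \sum_(i in S) abspow q (y 0 i).
Proof.
rewrite /E /restricted_objective /lqq [in RHS]big_enum_val; congr (_ + _ * _).
by apply: eq_bigr => i _; rewrite mxE.
Qed.

Lemma near_nonzero_on y : nonzero_on y -> \forall z \near y, nonzero_on z.
Proof.
move=> yn0.
suff : forall i, \forall z \near y, i \in S -> (z : 'rV[R]_n) 0 i != 0.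
  by move=> /filter_forall; apply: filterS => z H i; exact: H.
move=> i; have [iS|niS] := boolP (i \in S); last first.
  by apply: (filterS _ (nbhsx_ballx y 1 ltr01)).
have := @coord_continuous R 1 n 0 i y _ (near_neq0 (yn0 i iS)).
by move=> H; apply: (filterS _ (H : nbhs y [set M | M 0 i != 0])).
Qed.

Lemma restricted_calculus y : nonzero_on y ->
  differentiable E y /\ grad E y = grad f y + lambda *: dlqq y.
Proof.
move=> yn0.
pose h (i : 'I_n) z := if i \in S then abspow q (z 0 i) else 0.
have hE i : differentiable (h i) y /\
    forall v, 'D_v (h i) y = v 0 i * (if i \in S then dpow q (y 0 i) else 0).
  rewrite /h; case: ifP => iS.
    exact: differentiable_coord_comp (is_derive_abspow q (yn0 i iS)).
  by split => [|v]; [exact: differentiable_cst|rewrite derive_cst mulr0].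
have EE : E = f + lambda *: (\sum_(i < n) h i).
  apply/funext => z; rewrite restricted_objectiveE big_mkcond /=.
  by congr (_ + _ * _); rewrite fct_sumE.
have dh : differentiable (\sum_(i < n) h i) y.
  by apply: differentiable_sum => i; have [] := hE i.
have dE : differentiable E y by rewrite EE; apply: differentiableD => //; exact: differentiableZ.
split => //; apply/rowP => i; rewrite !mxE EE deriveD//; last 2 first.
- exact: diff_derivable.
- by apply: diff_derivable; exact: differentiableZ.
rewrite deriveZ /=; last exact: diff_derivable.
rewrite derive_sum; last by move=> j; apply: diff_derivable; have [] := hE j.
congr (_ + _ * _); rewrite (bigD1 i)//= big1 => [|j ji].
  by have [_ ->] := hE i; rewrite mxE !eqxx mul1r addr0.
by have [_ ->] := hE j; rewrite mxE (negPf ji) andbF mul0r.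
Qed.

Lemma dlqq_taylor p : nonzero_on p ->
  exists2 C, 0 < C & exists2 d, 0 < d & forall y z, ball p d y -> ball p d z ->
    [/\ nonzero_on y, `|dlqq y - dlqq z| <= C * `|y - z| &
        `|dlqq y - dlqq z - (y - z) *m ddlqq z| <= C * `|y - z| ^+ 2].
Proof.
move=> pn0; have /nbhs_ballP[d1 /= d10 d1P] := near_nonzero_on pn0.
have /choice[c cP] (i : 'I_n) : exists c : R * R, [/\ 0 < c.1, 0 < c.2 & i \in S ->
    forall s t, `|s - p 0 i| < c.2 -> `|t - p 0 i| < c.2 ->
      `|dpow q s - dpow q t| <= c.1 * `|s - t| /\
      `|dpow q s - dpow q t - (s - t) * ddpow q t| <= c.1 * `|s - t| ^+ 2].
  have [iS|niS] := boolP (i \in S); last by exists (1, 1); split.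
  by have [C C0 [d d0 H]] := dpow_taylor q (pn0 i iS); exists (C, d); split.
pose C := \sum_i (c i).1 + 1.
have sum0 : 0 <= \sum_i (c i).1 by apply: sumr_ge0 => i _; have [/ltW] := cP i.
have C0 : 0 < C by rewrite ltr_wpDl.
have cC i : (c i).1 <= C.
  rewrite /C (bigD1 i)//= -addrA lerDl addr_ge0//.
  by apply: sumr_ge0 => j _; have [/ltW] := cP j.
have : \forall e \near 0^'+, forall i, e <= (c i).2.
  by apply: filter_forall => i; apply: nbhs_right_le; have [] := cP i.
move=> /(filterI (nbhs_right_le d10)) /(filterI (nbhs_right_gt (0 : R))) /filter_ex.
move=> [d [d0 [dd1 dc]]].
exists C => //; exists d => // y z; rewrite -ball_normE /= => yd zd.
have yp i : `|y 0 i - p 0 i| < (c i).2.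
  rewrite (lt_le_trans _ (dc i))// (le_lt_trans _ yd)// distrC.
  by have := le_mx_norm (p - y) 0 i; rewrite !mxE.
have zp i : `|z 0 i - p 0 i| < (c i).2.
  rewrite (lt_le_trans _ (dc i))// (le_lt_trans _ zd)// distrC.
  by have := le_mx_norm (p - z) 0 i; rewrite !mxE.
have yz i : `|y 0 i - z 0 i| <= `|y - z|.
  by have := le_mx_norm (y - z) 0 i; rewrite !mxE.
split; first by apply: d1P; rewrite -ball_normE /= (lt_le_trans yd).
- apply: mx_norm_le => [|k i]; first by rewrite mulr_ge0// ltW.
  rewrite !mxE; case: ifP => iS; last by rewrite subrr normr0 mulr_ge0// ltW.
  have [c0 _ /(_ iS _ _ (yp i) (zp i))[H _]] := cP i.
  by rewrite (le_trans H)// ler_pM// ltW.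
- apply: mx_norm_le => [|k i]; first by rewrite mulr_ge0// ?exprn_ge0// ltW.
  rewrite mul_mx_diag !mxE.
  case: ifP => iS; last by rewrite mulr0 !subr0 normr0 mulr_ge0// ?exprn_ge0// ltW.
  have [c0 _ /(_ iS _ _ (yp i) (zp i))[_ H]] := cP i; rewrite !ord1.
  by rewrite (le_trans H)// ler_pM ?exprn_ge0// ?(ltW c0)// ler_pXn2r// ?nnegrE.
Qed.

Lemma jacobian_dlqq y : nonzero_on y -> differentiable dlqq y /\ 'J dlqq y = ddlqq y.
Proof.
move=> yn0; apply: jacobian_unique => e e0.
have [C C0 [d d0 H]] := dlqq_taylor yn0.
have r0 : 0 < Num.min d (e / C) by rewrite lt_min d0 divr_gt0.
apply/nbhs_ballP; exists (Num.min d (e / C)) => // h; rewrite -ball_normE /= sub0r normrN.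
rewrite lt_min => /andP[hd he].
have yh : ball y d (y + h) by rewrite -ball_normE /= opprD addrA subrr sub0r normrN.
have yhE : y + h - y = h by rewrite addrAC subrr add0r.
have [_ _] := H _ _ yh (ballxx y d0); rewrite yhE => /le_trans; apply.
rewrite expr2 mulrA ler_wpM2r// mulrC.
by rewrite -ler_pdivlMr// ltW.
Qed.

(** The penalty is smooth near [y], so subtracting its gradient transfers differentiability from
    [grad E] back to [grad f], the map that is assumed semismooth. *)
Lemma restricted_hessian y : nonzero_on y -> twice_differentiable E y ->
  differentiable (grad f) y /\ hessian E y = 'J (grad f) y + lambda *: ddlqq y.
Proof.
move=> yn0 [_ dG]; have [dl Jl] := jacobian_dlqq yn0.
have [dB JB] := jacobian_subZ lambda dG dl.
have fG : {near y, (fun z => grad E z - lambda *: dlqq z) =1 grad f}.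
  by apply: filterS (near_nonzero_on yn0) => z /restricted_calculus[_ ->]; rewrite addrK.
have [df Jf] := near_eq_jacobian fG dB; split; first exact: df.
rewrite Jf JB Jl /hessian; move: ('J _ _) (_ *: _) => A B.
by rewrite subrK.
Qed.

Lemma restricted_residual p (b : 'rV[R]_n -> R) : 0 <= lambda -> nonzero_on p ->
  (\forall y \near p, differentiable (grad f) y ->
     enorm (grad f y - grad f p - (y - p) *m 'J (grad f) y) <= b y) ->
  exists2 C, 0 <= C & \forall y \near p, twice_differentiable E y ->
     enorm (grad E y - grad E p - (y - p) *m hessian E y) <= b y + C * enorm (y - p) ^+ 2.
Proof.
move=> l0 pn0 fb; have [C C0 [d d0 H]] := dlqq_taylor pn0.
exists (lambda * (n%:R * C)); first by rewrite !mulr_ge0// ltW.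
have [_ Gp] := restricted_calculus pn0.
apply: filterS3 fb (near_nonzero_on pn0) (nbhsx_ballx p d d0) => y fb yn0 yd Dy.
have [df ->] := restricted_hessian yn0 Dy; have [_ ->] := restricted_calculus yn0; rewrite Gp.
(* The residual contains the Hessian at [y], so the expansion is centred at [y] and evaluated at
   [p]. *)
have [_ _ T] := H p y (ballxx p d0) yd.
have -> : grad f y + lambda *: dlqq y - (grad f p + lambda *: dlqq p) -
    (y - p) *m ('J (grad f) y + lambda *: ddlqq y) =
  (grad f y - grad f p - (y - p) *m 'J (grad f) y) -
  lambda *: (dlqq p - dlqq y - (p - y) *m ddlqq y).
  move: ('J (grad f) y) (ddlqq y) => Jf D.
  rewrite mulmxDr -scalemxAr -(opprB y p) mulNmx; move: (_ *m Jf) (_ *m D) => A B.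
  by apply/rowP => i; rewrite !mxE; ring.
rewrite (le_trans (enormB _ _))// lerD ?fb// enormZ ger0_norm// -mulrA ler_wpM2l//.
rewrite (le_trans (enorm_le_norm _))// -mulrA ler_wpM2l// (le_trans T)// ler_wpM2l ?(ltW C0)//.
by rewrite distrC ler_pXn2r ?nnegrE ?enorm_ge0 ?norm_le_enorm.
Qed.

Lemma restricted_grad_lipschitz p : locally_lipschitz_at (grad f) p -> nonzero_on p ->
  exists L rho : R, [/\ 0 < L, 0 < rho, forall y, ball p rho y -> nonzero_on y,
    forall y z, ball p rho y -> ball p rho z -> `|grad f y - grad f z| <= L * `|y - z| &
    forall y z, ball p rho y -> ball p rho z -> `|grad E y - grad E z| <= L * `|y - z|].
Proof.
move=> [U Up /lipschitz_onP[L L0 fL]] pn0.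
have [C C0 [d d0 H]] := dlqq_taylor pn0.
have /nbhs_ballP[r /= r0 rU] := Up.
have lsub y : ball p (Num.min r d) y -> U y /\ ball p d y.
  rewrite -ball_normE /= lt_min => /andP[yr yd].
  by split => //; apply: rU; rewrite -ball_normE.
exists (L + `|lambda| * C), (Num.min r d); split.
- by rewrite ltr_pwDl// mulr_ge0// ltW.
- by rewrite lt_min r0.
- by move=> y /lsub[_ yd]; have [] := H y y yd yd.
- move=> y z /lsub[Uy _] /lsub[Uz _]; rewrite (le_trans (fL _ _ Uy Uz))// ler_wpM2r//.
  by rewrite lerDl mulr_ge0// ltW.
move=> y z /lsub[Uy yd] /lsub[Uz zd].
have [yn0 T _] := H y z yd zd; have [zn0 _ _] := H z z zd zd.
have [_ ->] := restricted_calculus yn0; have [_ ->] := restricted_calculus zn0.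
rewrite opprD addrACA -scalerBr (le_trans (ler_normD _ _))// mulrDl lerD ?fL//.
by rewrite normrZ -mulrA ler_wpM2l.
Qed.

End restricted.

(** * Strong convexity and Newton steps *)

Section supported.
Context {R : realType} {n : nat}.
Implicit Types (S : {set 'I_n}) (a b u v : 'rV[R]_n).

Lemma dot_supported S a b u : supported S u ->
  (forall i, i \in S -> a 0 i = b 0 i) -> dot a u = dot b u.
Proof.
move=> uS ab; apply: eq_bigr => i _; have [iS|niS] := boolP (i \in S).
  by rewrite ab.
by rewrite uS// !mulr0.
Qed.

Lemma supportedB S u v : supported S u -> supported S v -> supported S (u - v).
Proof. by move=> uS vS i iS; rewrite !mxE uS// vS// subrr. Qed.

Lemma supportedZ S (t : R) u : supported S u -> supported S (t *: u).
Proof. by move=> uS i iS; rewrite mxE uS// mulr0. Qed.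

(** With [u = y - d - p], the entries of [u *m M] in [S] are those of the negated residual, by the
    Newton equation and stationarity. Pairing with [u], which is supported in [S], and
    Cauchy-Schwarz give the bound. *)
Lemma newton_error S (M : 'M[R]_n) (d y p a b : 'rV[R]_n) (c r : R) :
  (forall v, supported S v -> c * enorm v ^+ 2 <= dot (v *m M) v) ->
  supported S d -> supported S (y - p) ->
  (forall i, i \in S -> (d *m M) 0 i = a 0 i) ->
  (forall i, i \in S -> b 0 i = 0) ->
  enorm (a - b - (y - p) *m M) <= r -> c * enorm (y - d - p) <= r.
Proof.
move=> pd dS ypS dM b0 res; set u := y - d - p.
have uE : u = (y - p) - d by rewrite /u addrAC.
have uS : supported S u by rewrite uE; exact: supportedB.
have [->|u0] := eqVneq u 0.
  by rewrite enorm0 mulr0 (le_trans _ res)// enorm_ge0.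
have ue : 0 < enorm u by rewrite lt0r enorm_eq0 u0 enorm_ge0.
have : c * enorm u ^+ 2 <= r * enorm u; last by rewrite expr2 mulrA ler_pM2r.
rewrite (le_trans (pd u uS))// (@dot_supported S _ (- (a - b - (y - p) *m M)))//; last first.
  by move=> i iS; rewrite uE mulmxBl !mxE -dM// b0// mxE; ring.
rewrite (le_trans (dot_le_enorm _ _))// ler_wpM2r ?enorm_ge0//.
by rewrite enormN.
Qed.

End supported.

Section strong_convexity.
Context {R : realType} {n : nat}.
Variables (F : 'rV[R]_n -> R) (p : 'rV[R]_n) (L rho c : R) (S : {set 'I_n}).
Hypotheses (L0 : 0 < L) (rho0 : 0 < rho).
Hypothesis Fd : forall y, ball p rho y -> differentiable F y.
Hypothesis GL : forall y z, ball p rho y -> ball p rho z ->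
  `|grad F y - grad F z| <= L * `|y - z|.
Hypothesis pd : forall y, ball p rho y -> twice_differentiable F y ->
  forall v, supported S v -> c * enorm v ^+ 2 <= dot (v *m hessian F y) v.
Hypothesis stat : forall i, i \in S -> grad F p 0 i = 0.

Lemma strong_monotone y : ball p rho y -> supported S (y - p) ->
  c * enorm (y - p) ^+ 2 <= dot (grad F y) (y - p).
Proof.
move=> yb yS.
have Gp : dot (grad F p) (y - p) = 0.
  rewrite (@dot_supported _ _ S _ 0) ?dot0l// => i iS.
  by rewrite stat// mxE.
have [->|yp] := eqVneq y p; first by rewrite subrr enorm0 expr0n mulr0 dotC dot0l.
(* The mean value theorem bounds from above, hence the test vector [- (y - p)]. *)
rewrite -[dot _ _]subr0 -Gp -dotBl -lerN2 -dotNr.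
apply: (local_lipschitz_mvt GL (ballxx p rho0) yb _ ltr01); first by rewrite eq_sym.
move=> s k _ _ zb; set z := p + _ + k => dG.
have Dz : twice_differentiable F z.
  split => //; have : nbhs z (ball p rho) by apply: open_nbhs_nbhs; split => //; exact: ball_open.
  by apply: filterS => z'; exact: Fd.
by rewrite dotNr lerN2; exact: pd.
Qed.

Let line_ball y (t : R) : ball p rho y -> 0 <= t <= 1 -> ball p rho (p + t *: (y - p)).
Proof.
rewrite -!ball_normE /= => yb /andP[t0 t1].
rewrite opprD addrA subrr sub0r normrN normrZ ger0_norm//.
by rewrite (le_lt_trans _ yb)// distrC ler_piMl.
Qed.

Let dline y (t : R) : ball p rho y -> 0 <= t <= 1 ->
  is_derive t (1 : R) (fun s => F (p + s *: (y - p))) (dot (y - p) (grad F (p + t *: (y - p)))).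
Proof. by move=> yb t01; apply: is_derive_line; apply: Fd; exact: line_ball. Qed.

Lemma quadratic_growth y : ball p rho y -> supported S (y - p) ->
  c / 2 * enorm (y - p) ^+ 2 <= F y - F p.
Proof.
move=> yb yS; set k := c / 2 * _.
(* Monotonicity of the gradient, applied at [p + t *: (y - p)], says that [X] has nonnegative
   derivative. *)
pose X (t : R) := F (p + t *: (y - p)) - k * t ^+ 2.
have dX (t : R) : 0 <= t <= 1 -> is_derive t (1 : R) X
    (dot (y - p) (grad F (p + t *: (y - p))) - k * (2 * t)).
  move=> t01; have dsq := is_deriveZ k (is_deriveX 2 (is_derive_id t (1 : R))).
  have := is_deriveB (dline yb t01) dsq.
  rewrite (_ : k *: _ = k * (2 * t)); last by rewrite /GRing.scale/= expr1 mulr1.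
  by congr (is_derive _ _ _ _); apply/funext => u; rewrite /X [in RHS]expr2.
have [||t] := @MVT_segment R X (fun t => dot (y - p) (grad F (p + t *: (y - p))) - k * (2 * t)) 0 1 ler01.
- by move=> t; rewrite in_itv /= => /andP[t0 t1]; apply: dX; rewrite !ltW.
- by apply: derivable_within_continuous => t; rewrite in_itv /= => /dX[].
rewrite in_itv /= => /andP[t0 t1]; rewrite subr0 mulr1 /X.
rewrite scale0r scale1r addr0 (addrC p) subrK expr1n expr0n mulr0 mulr1 subr0 => XE.
have : 0 <= F y - k - F p; last by lra.
(* The monotonicity inequality must be divided by [t]; at [t = 0] stationarity makes the derivative
   vanish instead. *)
rewrite XE; have [->|tn0] := eqVneq t 0.
  rewrite scale0r addr0 !mulr0 subr0 dotC (@dot_supported _ _ S _ 0) ?dot0l// => i iS.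
  by rewrite stat// mxE.
have tp : 0 < t by rewrite lt0r tn0.
have tb := @line_ball y t yb ltac:(by rewrite t0 t1).
have := strong_monotone tb; rewrite addrAC subrr add0r => /(_ (supportedZ _ yS)).
rewrite enormZ gtr0_norm// dotZr exprMn mulrCA expr2 -mulrA ler_pM2l// dotC subr_ge0.
by apply: le_trans; rewrite /k le_eqVlt; apply/orP; left; apply/eqP; field.
Qed.

Lemma quadratic_upper y : ball p rho y -> supported S (y - p) ->
  F y - F p <= n%:R * L * enorm (y - p) ^+ 2.
Proof.
move=> yb yS.
have [||t] := @MVT_segment R (fun t => F (p + t *: (y - p)))
    (fun t => dot (y - p) (grad F (p + t *: (y - p)))) 0 1 ler01.
- by move=> t; rewrite in_itv /= => /andP[t0 t1]; apply: dline; rewrite ?ltW.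
- apply: derivable_within_continuous => t; rewrite in_itv /= => t01.
  by have [] := dline yb t01.
rewrite in_itv /= => /andP[t0 t1]; rewrite subr0 mulr1.
rewrite scale0r scale1r addr0 (addrC p) subrK => ->.
have tb := @line_ball y t yb ltac:(by rewrite t0 t1).
rewrite dotC (@dot_supported _ _ S _ (grad F (p + t *: (y - p)) - grad F p))//; last first.
  move=> i iS; have := stat iS; move: (grad F p) (grad F _) => A B A0.
  by rewrite !mxE A0 subr0.
rewrite (le_trans (dot_le_enorm _ _))// expr2 mulrA ler_wpM2r ?enorm_ge0//.
rewrite (le_trans (enorm_le_norm _))// -mulrA ler_wpM2l//.
rewrite (le_trans (GL tb (ballxx p rho0)))// ler_wpM2l ?(ltW L0)//.
rewrite addrAC subrr add0r normrZ ger0_norm// (le_trans _ (norm_le_enorm _))//.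
by rewrite ler_piMl.
Qed.

End strong_convexity.

Section principal.
Context {R : realType} {n : nat}.
Variable T : {set 'I_n}.
Implicit Types (M : 'M[R]_n) (v d : 'rV[R]_n) (z b : 'rV[R]_#|T|).

(** Extension by zero, a right inverse of [subvec T]. *)
Definition extend z : 'rV[R]_n := \row_i \sum_j z 0 j *+ (enum_val j == i).

Lemma extend_supported z : supported T (extend z).
Proof.
move=> i iT; rewrite mxE big1// => j _; case: eqP => // ji.
by move: iT; rewrite -ji enum_valP.
Qed.

Lemma subvec_extend z : subvec T (extend z) = z.
Proof.
apply/rowP => j; rewrite !mxE (bigD1 j)//= eqxx big1 ?addr0// => k kj.
by rewrite (inj_eq enum_val_inj) (negPf kj).
Qed.

Lemma sum_supported d (F : 'I_n -> R) : supported T d ->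
  \sum_(j < #|T|) d 0 (enum_val j) * F (enum_val j) = \sum_i d 0 i * F i.
Proof.
move=> dT; rewrite -(big_enum_val (fun i => d 0 i * F i)) big_mkcond /=.
by apply: eq_bigr => i _; case: ifPn => // iT; rewrite dT// mul0r.
Qed.

Lemma dot_subvec a d : supported T d -> dot (subvec T a) (subvec T d) = dot a d.
Proof.
move=> dT; rewrite dotC [RHS]dotC /dot -(sum_supported (fun i => a 0 i) dT).
by apply: eq_bigr => j _; rewrite !mxE.
Qed.

Lemma subvec_mul_principal d M : supported T d ->
  subvec T d *m principal_submx T M = subvec T (d *m M).
Proof.
move=> dT; apply/rowP => j; rewrite !mxE -(sum_supported (fun i => M i (enum_val j)) dT).
by apply: eq_bigr => k _; rewrite !mxE.
Qed.

(** A nonzero kernel vector of the principal submatrix, extended by zero, would have a vanishing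
    quadratic form. *)
Lemma principal_solvable M b :
  (forall v, supported T v -> v != 0 -> 0 < dot (v *m M) v) ->
  exists2 d, supported T d & subvec T d *m principal_submx T M = b.
Proof.
move=> pd; have Pu : principal_submx T M \in unitmx.
  rewrite -row_free_unit; apply: inj_row_free => z zP.
  apply/eqP; have [//|z0] := eqVneq z 0.
  have zT := @extend_supported z.
  have /pd : extend z != 0.
    by apply: contra_neq z0 => E; rewrite -(subvec_extend z) E; apply/rowP => j; rewrite !mxE.
  move=> /(_ zT); rewrite -(dot_subvec _ zT) -subvec_mul_principal// subvec_extend zP.
  by rewrite dot0l ltxx.
exists (extend (b *m invmx (principal_submx T M))); first exact: extend_supported.
by rewrite subvec_extend mulmxKV.
Qed.

End principal.

(** Here [a1], [a2], [a3] are the values at [w - d], [w], [p], and [d2], [h2] the squared lengths of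
    [d] and [w - p]. A Newton error of at most a quarter of [|w - p|] gives [|d| <= 5/4 |w - p|], so
    the test takes 25/32 of the growth [s * h2]; the other 7/32 bound the value at [w - d]. *)
Lemma sufficient_decrease (R : realType) (s a1 a2 a3 d2 h2 k : R) :
  a1 - a3 <= k -> 2 * s / 2 * h2 <= a2 - a3 -> k <= 7 * s / 32 * h2 ->
  s * d2 <= s * (25 / 16 * h2) -> 0 <= s * h2 -> a1 <= a2 - s / 2 * d2.
Proof. lra. Qed.

Section step.
Context {R : realType} {n : nat}.
Variables (f : 'rV[R]_n -> R) (lambda q sigma gamma : R).
Implicit Types (w x y d p : 'rV[R]_n) (S : {set 'I_n}).

Let F := objective f lambda q.
Let E S := restricted_objective f lambda q S.

Lemma objective_restricted S y : supported S y -> F y = E S y.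
Proof.
move=> yS; rewrite /E restricted_objectiveE /F /objective /lqq; congr (_ + _ * _).
rewrite [RHS]big_mkcond; apply: eq_bigr => i _.
by case: ifPn => // iS; rewrite yS// /abspow eqxx.
Qed.

Lemma supported_supp y : supported (supp y) y.
Proof. by move=> i; rewrite inE negbK => /eqP. Qed.

Lemma newton_eqE w M d :
  newton_eq f lambda q (principal_submx (supp w) M) d <->
  supported (supp w) d /\
  forall i, i \in supp w -> (d *m M) 0 i = grad (E (supp w)) w 0 i.
Proof.
split=> [[eq1 dS]|[dS eq1]]; split => //.
  move=> i iw; move: eq1; rewrite subvec_mul_principal// => /rowP.
  by move=> /(_ (enum_rank_in iw i)); rewrite !mxE enum_rankK_in.
rewrite subvec_mul_principal//; apply/rowP => j.
have := eq1 (enum_val j) (enum_valP j); rewrite /grad_supp /E.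
by move: (d *m M) (grad _ w) => A B AB; rewrite !mxE.
Qed.

Lemma newton_step_le w x' : newton_step f lambda q sigma gamma w x' ->
  F x' <= F w - sigma / 2 * enorm (x' - w) ^+ 2 /\ supported (supp w) x'.
Proof.
have wS := @supported_supp w.
move=> [M _ [[d [s [[_ dS] ar _ ->]]]|[_ ->]]]; last first.
  by rewrite subrr enorm0 expr0n mulr0 subr0.
have dS' : supported (supp w) (gamma ^+ s *: d) by exact: supportedZ.
split; last exact: supportedB.
have -> : w - gamma ^+ s *: d - w = - (gamma ^+ s *: d) by rewrite addrAC subrr sub0r.
by rewrite enormN.
Qed.

Lemma prox_gradient (a : R) x w i : prox_step f lambda q sigma a x w -> w 0 i != 0 ->
  a * (grad f x 0 i + lambda * dpow q (w 0 i)) = x 0 i - w 0 i.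
Proof.
move=> [pw _] /(prox_stationary pw); move: (grad f x) => g.
rewrite !mxE => H; apply/eqP; rewrite -subr_eq0 -[X in _ == X]H; apply/eqP; ring.
Qed.

Section full_step.
Variables (w p : 'rV[R]_n) (L rho r : R).
Let S := supp w.
Hypotheses (L0 : 0 < L) (rho0 : 0 < rho) (sigma0 : 0 < sigma).
Hypothesis pS : supported S p.
Hypothesis Ed : forall y, ball p rho y -> differentiable (E S) y.
Hypothesis GL : forall y z, ball p rho y -> ball p rho z ->
  `|grad (E S) y - grad (E S) z| <= L * `|y - z|.
Hypothesis pd : forall y, ball p rho y -> forall M, gen_hessian (E S) y M ->
  forall v, supported S v -> 2 * sigma * enorm v ^+ 2 <= dot (v *m M) v.
Hypothesis pdE : forall y, ball p rho y -> twice_differentiable (E S) y ->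
  forall v, supported S v -> 2 * sigma * enorm v ^+ 2 <= dot (v *m hessian (E S) y) v.
Hypothesis stat : forall i, i \in S -> grad (E S) p 0 i = 0.
Hypothesis wp : enorm (w - p) < rho.
Hypothesis res : forall M, gen_hessian (E S) w M ->
  enorm (grad (E S) w - grad (E S) p - (w - p) *m M) <= r.
(* The constant makes the full step satisfy the line search condition. *)
Hypothesis r_small : r <= 2 * sigma * (Num.min (1 / 4) (7 * sigma / 32 / (n%:R * L + 1)) * enorm (w - p)).

Lemma newton_full_step x' : newton_step f lambda q sigma gamma w x' ->
  2 * sigma * enorm (x' - p) <= r.
Proof.
have wb : ball p rho w.
  by rewrite -ball_normE /= distrC (le_lt_trans (norm_le_enorm _)).
have s20 : 0 < 2 * sigma by rewrite mulr_gt0.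
have wS := @supported_supp w; have wpS : supported S (w - p) by exact: supportedB.
move=> [_ [M HM <-]] step.
have err d : newton_eq f lambda q (principal_submx S M) d -> 2 * sigma * enorm (w - d - p) <= r.
  move=> /newton_eqE[dS dM]; apply: newton_error (pd wb HM) dS wpS dM stat (res HM).
have arm d : newton_eq f lambda q (principal_submx S M) d -> armijo f lambda q sigma gamma w d 0.
  move=> dN; have [dS _] := (newton_eqE w M d).1 dN; have := err d dN.
  set u := w - d - p => ur; rewrite /armijo expr0 scale1r.
  have wdS : supported S (w - d) by exact: supportedB.
  have uS : supported S (w - d - p) by exact: supportedB.
  have := le_trans ur r_small; rewrite ler_pM2l//.
  set e := Num.min _ _ => ue.
  have h0 := enorm_ge0 (w - p).
  (* The first bound limits [d] to [5/4] of [w - p]; the second, with [e <= 1], keeps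
     [n * L * |w - d - p|^2] below [7 * sigma / 32 * |w - p|^2]. *)
  have [e1 e2] : e <= 1 / 4 /\ e * (n%:R * L + 1) <= 7 * sigma / 32.
    split; first by rewrite ge_min lexx.
    by rewrite -ler_pdivlMr ?ge_min ?lexx ?orbT// ltr_wpDl// mulr_ge0// ltW.
  have e0 : 0 <= e.
    by rewrite le_min !divr_ge0 ?mulr_ge0 ?addr_ge0 ?mulr_ge0 ?(ltW L0) ?(ltW sigma0).
  have ub : ball p rho (w - d).
    rewrite -ball_normE /= distrC (le_lt_trans (norm_le_enorm _))//.
    rewrite (le_lt_trans ue)// (le_lt_trans _ wp)// ler_piMl//; lra.
  rewrite -/F !(@objective_restricted S)//.
  have up := quadratic_upper L0 rho0 Ed GL stat ub uS.
  have gr := quadratic_growth rho0 Ed GL pdE stat wb wpS.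
  have dle : enorm d <= (1 + e) * enorm (w - p).
    have -> : d = (w - p) - (w - d - p) by apply/rowP => i; rewrite !mxE; ring.
    by rewrite (le_trans (enormB _ _))// mulrDl mul1r lerD2l.
  have U2 : n%:R * L * enorm (w - d - p) ^+ 2 <= 7 * sigma / 32 * enorm (w - p) ^+ 2.
    apply: (@le_trans _ _ ((e * (n%:R * L + 1)) * (e * enorm (w - p) ^+ 2))); last first.
      apply: ler_pM => //; rewrite ?mulr_ge0 ?addr_ge0 ?mulr_ge0 ?exprn_ge0 ?(ltW L0)//.
      by rewrite ler_piMl ?exprn_ge0//; lra.
    rewrite [leRHS](_ : _ = (n%:R * L + 1) * (e * enorm (w - p)) ^+ 2); last by ring.
    rewrite ler_pM ?mulr_ge0 ?exprn_ge0 ?enorm_ge0 ?(ltW L0) ?lerDl//.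
    by rewrite ler_pXn2r ?nnegrE ?mulr_ge0 ?enorm_ge0.
  have D2 : enorm d ^+ 2 <= 25 / 16 * enorm (w - p) ^+ 2.
    rewrite (_ : 25 / 16 = (5 / 4) ^+ 2); last by field.
    rewrite -exprMn ler_pXn2r ?nnegrE ?mulr_ge0 ?enorm_ge0//.
    by rewrite (le_trans dle)// ler_wpM2r//; lra.
  have D3 : sigma * enorm d ^+ 2 <= sigma * (25 / 16 * enorm (w - p) ^+ 2).
    by rewrite ler_pM2l.
  have H0 : 0 <= sigma * enorm (w - p) ^+ 2 by rewrite mulr_ge0 ?exprn_ge0 ?(ltW sigma0).
  exact: sufficient_decrease up gr U2 D3 H0.
have sol : exists d, newton_eq f lambda q (principal_submx S M) d.
  have [|d dS dE] := @principal_solvable R n S M (grad_supp f lambda q w).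
    move=> v vS v0; apply: lt_le_trans (pd wb HM vS).
    by rewrite mulr_gt0// exprn_gt0// lt0r enorm_eq0 v0 enorm_ge0.
  by exists d; split.
case: step => [[d [s [dN _ smin ->]]]|[[]]].
(* Exponent 0 passes the test, so it is the least admissible one and the step is taken in full; the
   two fallback cases contradict [sol] and [arm]. *)
- have := smin _ (arm d dN); rewrite leqn0 => /eqP ->.
  by rewrite expr0 scale1r; exact: err.
- by [].
- by move=> [d dN narm]; case: (narm 0%N); exact: arm.
Qed.

End full_step.

End step.

(** * Convergence of the algorithm *)

Lemma lqq_ge0 (R : realType) (q : R) n (y : 'rV[R]_n) : 0 <= lqq q y.
Proof.
by apply: sumr_ge0 => i _; rewrite /abspow; case: ifP => // _; exact: powR_ge0.
Qed.

Lemma near_enorm (R : realType) n (p : 'rV[R]_n) (d : R) : 0 < d ->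
  \forall y \near p, enorm (y - p) <= d.
Proof.
move=> d0; apply/nbhs_ballP; exists (d / n.+1%:R) => /=; first by rewrite divr_gt0.
move=> y; rewrite -ball_normE /= distrC => yd; rewrite (le_trans (enorm_le_norm _))//.
apply: (@le_trans _ _ (n.+1%:R * (d / n.+1%:R))); last by rewrite mulrC divfK.
by rewrite ler_pM// ?ler_nat// ltW.
Qed.

Section descent.
Context {R : realType} {n : nat}.
Variables (f : 'rV[R]_n -> R) (lambda q sigma gamma alpha : R).
Variables (x w : nat -> 'rV[R]_n) (p : 'rV[R]_n).
Hypothesis fd : forall y, differentiable f y.
Hypothesis f_lb : has_lbound (range f).
Hypotheses (lambda0 : 0 < lambda) (q1 : q < 1) (sigma0 : 0 < sigma) (alpha0 : 0 < alpha).

Let F := objective f lambda q.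
Let S := supp p.
Let E := restricted_objective f lambda q S.

Hypothesis w_prox : forall k, prox_step f lambda q sigma alpha (x k) (w k).
Hypothesis x_dec : forall k, F (x k.+1) <= F (w k) - sigma / 2 * enorm (x k.+1 - w k) ^+ 2.
Hypothesis x_supp : forall k, supported (supp (w k)) (x k.+1).
Hypothesis x_newton : forall k, supp (w k) = supp (x k) ->
  newton_step f lambda q sigma gamma (w k) (x k.+1).
Hypothesis p_cluster : cluster (x @ \oo) p.

Let w_dec k : F (w k) <= F (x k) - sigma / 4 * enorm (w k - x k) ^+ 2.
Proof. by have [_] := w_prox k. Qed.

Let gap_ge0 (c : R) (u : 'rV[R]_n) : 0 < c -> 0 <= sigma / c * enorm u ^+ 2.
Proof. by move=> c0; rewrite mulr_ge0 ?exprn_ge0 ?enorm_ge0// divr_ge0// ltW. Qed.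

Lemma objective_w_le k : F (w k) <= F (x k).
Proof. by rewrite (le_trans (w_dec k))// gerBl gap_ge0. Qed.

Lemma objective_x_le k : F (x k.+1) <= F (w k).
Proof. by rewrite (le_trans (x_dec k))// gerBl gap_ge0. Qed.

Lemma objective_noninc : nonincreasing_seq (fun k => F (x k)).
Proof.
apply/nonincreasing_seqP => k.
exact: le_trans (objective_x_le k) (objective_w_le k).
Qed.

Lemma objective_lb : exists m, forall y, m <= F y.
Proof.
have [m mP] := f_lb; exists m => y; rewrite (@le_trans _ _ (f y))//; first by apply: mP; exists y.
by rewrite lerDl mulr_ge0 ?lqq_ge0// ltW.
Qed.

Lemma gaps e : 0 < e -> exists N, forall k, (N <= k)%N ->
  enorm (w k - x k) < e /\ enorm (x k.+1 - w k) < e.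
Proof.
move=> e0; have [m mP] := objective_lb.
have cu : cvgn (fun k => F (x k)).
  by apply: nonincreasing_is_cvgn; [exact: objective_noninc|exists m => _ [k _ <-]].
have lle := nonincreasing_cvgn_ge objective_noninc cu.
set l := limn (fun k => F (x k)) in cu lle.
(* An iteration lowers the objective by at least [sigma / 4] and [sigma / 2] times the squares of
   its two half steps; a total below this threshold makes both shorter than [e]. *)
have d0 : 0 < sigma / 4 * e ^+ 2 by rewrite mulr_gt0 ?exprn_gt0// divr_gt0.
move/cvgrPdist_lt : cu => /(_ _ d0)[N _ NP]; exists N => k Nk.
have lk : l <= F (x k.+1) by exact: lle.
have : F (x k) - F (x k.+1) < sigma / 4 * e ^+ 2.
  have /= := NP k Nk; rewrite distrC => /(le_lt_trans (ler_norm _)).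
  by apply: le_lt_trans; rewrite lerD2l lerN2.
have := w_dec k; have := x_dec k; have := gap_ge0 (w k - x k) (ltr0Sn R 3).
have := gap_ge0 (x k.+1 - w k) (ltr0Sn R 1).
have sq (t : 'rV[R]_n) : enorm t < e = (sigma * enorm t ^+ 2 < sigma * e ^+ 2).
  by rewrite ltr_pM2l// ltr_pXn2r// ?nnegrE ?enorm_ge0// ltW.
have es : 0 < sigma * e ^+ 2 by rewrite mulr_gt0 ?exprn_gt0.
rewrite !sq.
move: (F _) (F _) (F _) (enorm (w k - x k) ^+ 2) (enorm _ ^+ 2) (e ^+ 2) es.
move=> a1 a2 a3 a4 a5 a6 es h1 h2 h3 h4 h5; split; lra.
Qed.

Lemma cluster_ex e N : 0 < e -> exists k, [/\ (N <= k)%N, `|x k - p| < e & `|w k - p| < e].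
Proof.
move=> e0; have e20 : 0 < e / 2 by rewrite divr_gt0.
have [N' N'P] := gaps e20.
pose A := [set y | exists2 k, (maxn N N' <= k)%N & y = x k].
have [|y [[k kN ->]]] := p_cluster (_ : (x @ \oo) A) (nbhsx_ballx p (e / 2) e20).
  by exists (maxn N N') => // k /= kN; exists k.
rewrite -ball_normE /= distrC => xp; move: kN; rewrite geq_max => /andP[Nk N'k].
exists k; split=> //; first by rewrite (lt_trans xp)// ltr_pdivrMr// ltr_pMr// ltr1n.
rewrite -(subrKA (x k)) (le_lt_trans (ler_normD _ _))// (splitr e) ltrD//.
by rewrite (le_lt_trans (norm_le_enorm _))//; have [] := N'P k N'k.
Qed.

Lemma w_support_near : exists2 r, 0 < r & forall k, `|w k - p| < r -> supp (w k) = S.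
Proof.
have [c c0 cP] := @prox_lower_bound R n q (alpha * lambda) ltac:(by rewrite mulr_gt0) q1.
have pn : nonzero_on S p by move=> i; rewrite inE.
have /nbhs_ballP[r /= r0 rP] := near_nonzero_on pn.
exists (Num.min r c); first by rewrite lt_min r0.
move=> k; rewrite lt_min => /andP[wr wc]; apply/setP => i.
have [iS|niS] := boolP (i \in S).
  by rewrite inE; apply: (rP (w k)) => //; rewrite -ball_normE /= distrC.
apply/negP; rewrite inE => wi; move: niS; rewrite inE negbK => /eqP pi.
have [/cP /(_ i wi) + _] := w_prox k; apply/negP; rewrite -ltNge (le_lt_trans _ wc)//.
by have := le_mx_norm (w k - p) 0 i; rewrite !mxE pi subr0.
Qed.

Lemma objective_cluster_le m : F p <= F (w m).
Proof.
have [r r0 rP] := w_support_near.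
have pn : nonzero_on S p by move=> i; rewrite inE.
have [dE _] := restricted_calculus lambda q fd pn.
apply/ler_addgt0Pr => e e0.
move/differentiable_continuous/cvgrPdist_le: dE => /(_ e e0) /nbhs_ballP[d /= d0 dP].
have [k [mk _]] := @cluster_ex (Num.min r d) m.+1 ltac:(by rewrite lt_min r0).
rewrite lt_min => /andP[/rP wS wd].
have /dP /= Ek : ball p d (w k) by rewrite -ball_normE /= distrC.
have wkS : supported S (w k) by rewrite -wS; exact: supported_supp.
rewrite /F (objective_restricted f lambda q (@supported_supp _ _ p)).
apply: (@le_trans _ _ (F (w k) + e)).
  rewrite /F (objective_restricted f lambda q wkS) -lerBlDl.
  exact: le_trans (ler_norm _) Ek.
rewrite lerD2r (le_trans (objective_w_le k))//.
by rewrite (le_trans (objective_noninc mk))// objective_x_le.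
Qed.

(** * The iterates near the accumulation point *)

Section local.
Variables (L rho : R).
Hypotheses (L0 : 0 < L) (rho0 : 0 < rho).
Hypothesis nz : forall y, ball p rho y -> nonzero_on S y.
Hypothesis fL : forall y z, ball p rho y -> ball p rho z ->
  `|grad f y - grad f z| <= L * `|y - z|.
Hypothesis GL : forall y z, ball p rho y -> ball p rho z ->
  `|grad E y - grad E z| <= L * `|y - z|.
Hypothesis pd : forall y, ball p rho y -> twice_differentiable E y ->
  forall v, supported S v -> 2 * sigma * enorm v ^+ 2 <= dot (v *m hessian E y) v.

Let Ed y : ball p rho y -> differentiable E y.
Proof. by move=> /nz yn0; have [] := restricted_calculus lambda q fd yn0. Qed.

Let pS : supported S p. Proof. exact: supported_supp. Qed.

Let ballN y : `|y - p| < rho -> ball p rho y.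
Proof. by rewrite -ball_normE /= distrC. Qed.

Let near_ball y : ball p rho y -> nbhs y (ball p rho).
Proof. by move=> yb; apply: open_nbhs_nbhs; split => //; exact: ball_open. Qed.

Let pdM y : ball p rho y -> forall M, gen_hessian E y M ->
  forall v, supported S v -> 2 * sigma * enorm v ^+ 2 <= dot (v *m M) v.
Proof.
move=> yb M HM v vS; apply: gen_hessian_ge HM.
by apply: filterS (near_ball yb) => z zb Dz; exact: pd.
Qed.

Let C := L + alpha^-1.
Let C0 : 0 < C. Proof. by rewrite addr_gt0// invr_gt0. Qed.

(** The prox condition combines the gradient of [f] at [x k] with that of the penalty at [w k].
    Hence on [S] the gradient of [E] at [w k] is the change of [grad f] from [x k] to [w k] minus
    [(w k - x k) / alpha], which gives [C = L + 1 / alpha]. *)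
Lemma w_gradient k i : ball p rho (x k) -> ball p rho (w k) -> supp (w k) = S ->
  i \in S -> `|grad E (w k) 0 i| <= C * `|w k - x k|.
Proof.
move=> xb wb wS iS.
have [_ ->] := restricted_calculus lambda q fd (nz wb).
have wi : w k 0 i != 0 by move: iS; rewrite -wS inE.
have := prox_gradient (w_prox k) wi; have := fL wb xb.
move: (grad f (w k)) (grad f (x k)) => gw gx gL H.
rewrite !mxE iS.
have -> : gw 0 i + lambda * dpow q (w k 0 i) =
    (gw - gx) 0 i - alpha^-1 * (w k - x k) 0 i.
  rewrite !mxE -(opprB (x k 0 i)) -H; field; exact: lt0r_neq0.
rewrite (le_trans (ler_normB _ _))// mulrDl lerD//.
  by rewrite (le_trans (le_mx_norm _ _ _)).
by rewrite normrM gtr0_norm ?invr_gt0// ler_wpM2l ?invr_ge0 ?le_mx_norm// ltW.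
Qed.

(** [w_gradient] is read at an index where [x k] and [w k] are both close to [p]; as convergence is
    not yet known, the index comes from [cluster_ex]. *)
Lemma stationary i : i \in S -> grad E p 0 i = 0.
Proof.
move=> iS; apply/eqP; rewrite -normr_le0; apply/ler_addgt0Pr => e e0; rewrite add0r.
have [r r0 rP] := w_support_near.
(* [L] is for the move from [p] to [w k], and [2 * C] for the half step, bounded by the two
   distances to [p]. *)
pose D := L + C * 2; have D0 : 0 < D by rewrite addr_gt0// mulr_gt0.
have [k [_]] := @cluster_ex (Num.min (Num.min rho r) (e / D)) 0 ltac:(by rewrite !lt_min rho0 r0 divr_gt0).
rewrite !lt_min => /andP[/andP[xrho _] xe] /andP[/andP[wrho /rP wS] we].
have xb := ballN xrho; have wb := ballN wrho.
have H1 := w_gradient xb wb wS iS.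
have H2 := GL (ballxx p rho0) wb.
have -> : grad E p 0 i = (grad E p - grad E (w k)) 0 i + grad E (w k) 0 i.
  by move: (grad E p) (grad E (w k)) => a b; rewrite !mxE subrK.
rewrite (le_trans (ler_normD _ _))//.
rewrite (le_trans (lerD (le_trans (le_mx_norm _ _ _) H2) H1))//.
have -> : e = L * (e / D) + C * (e / D + e / D) by rewrite /D; field; rewrite gt_eqF.
rewrite lerD//; first by rewrite ler_wpM2l ?(ltW L0)// distrC ltW.
rewrite ler_wpM2l ?(ltW C0)// -(subrKA p) (le_trans (ler_normD _ _))// lerD ?(ltW we)//.
by rewrite distrC ltW.
Qed.

Lemma w_error k : ball p rho (x k) -> ball p rho (w k) -> supp (w k) = S ->
  2 * sigma * enorm (w k - p) <= n%:R * (C * `|w k - x k|).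
Proof.
move=> xb wb wS.
have wpS : supported S (w k - p).
  by apply: supportedB => //; rewrite -wS; exact: supported_supp.
have := strong_monotone rho0 Ed GL pd stationary wb wpS.
have [->|wp] := eqVneq (w k) p.
  by rewrite subrr enorm0 !mulr0 !mulr_ge0// ltW.
have h0 : 0 < enorm (w k - p) by rewrite lt0r enorm_eq0 subr_eq0 wp enorm_ge0.
(* Only the entries in [S] are controlled by [w_gradient]; the others can be zeroed because
   [w k - p] is supported in [S]. *)
pose m : 'rV[R]_n := \row_i if i \in S then grad E (w k) 0 i else 0.
rewrite (@dot_supported _ _ S _ m)//; last by move=> i iS; rewrite [RHS]mxE iS.
move=> /le_trans /(_ (dot_le_enorm _ _)); rewrite expr2 mulrA ler_pM2r// => /le_trans; apply.
rewrite (le_trans (enorm_le_norm _))// ler_wpM2l//.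
apply: mx_norm_le => [|j i]; first by rewrite mulr_ge0// ltW.
rewrite mxE; case: ifP => iS; first exact: w_gradient.
by rewrite normr0 mulr_ge0// ltW.
Qed.

(** An induction on one radius [e1]: [cluster_ex] provides a first iterate inside it after the half
    steps have become short, and [w_error] brings every later one back. Halving in [e1] leaves room
    for [w k], which may be at distance [2 * e1] before [w_error] applies. *)
Lemma sequence_near e : 0 < e -> exists N, forall k, (N <= k)%N ->
  `|x k - p| < e /\ `|w k - p| < e.
Proof.
move=> e0; have [r r0 rP] := w_support_near.
pose e1 := Num.min e (Num.min rho r) / 2.
have min0 : 0 < Num.min e (Num.min rho r) by rewrite !lt_min e0 rho0.
have e10 : 0 < e1 by rewrite divr_gt0.
have e2 : e1 + e1 = Num.min e (Num.min rho r) by rewrite /e1 -splitr.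
pose D := n%:R * C / (2 * sigma).
have D0 : 0 <= D by rewrite divr_ge0 ?mulr_ge0 ?(ltW C0) ?(ltW sigma0).
(* Half steps shorter than [eta] place [w k] within [D * eta] of [p] and the next iterate within
   [eta + D * eta = e1]. *)
pose eta := e1 / (D + 1).
have D10 : 0 < D + 1 by rewrite ltr_wpDl.
have eta0 : 0 < eta by rewrite divr_gt0.
have eta1 : eta <= e1 by rewrite ler_pdivrMr// ler_peMr ?(ltW e10)// lerDr.
have [N NP] := gaps eta0.
have step k : (N <= k)%N -> `|x k - p| < e1 -> `|w k - p| < e1 + e1 /\ `|x k.+1 - p| < e1.
  move=> Nk xk; have [wx xw] := NP k Nk.
  have nwx : `|w k - x k| < eta by rewrite (le_lt_trans (norm_le_enorm _)).
  have nxw : `|x k.+1 - w k| < eta by rewrite (le_lt_trans (norm_le_enorm _)).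
  have wk : `|w k - p| < e1 + e1.
    by rewrite -(subrKA (x k)) (le_lt_trans (ler_normD _ _))// ltrD// (lt_le_trans nwx).
  split => //; move: (wk); rewrite e2 !lt_min => /and3P[_ /ballN wb /rP wS].
  have xb : ball p rho (x k).
    apply: ballN; rewrite (lt_trans xk)// (lt_le_trans _ (_ : e1 + e1 <= _))//.
      by rewrite ltrDl.
    by rewrite e2 !ge_min lexx orbT.
  have := w_error xb wb wS; rewrite mulrC -ler_pdivlMr ?mulr_gt0// => we.
  rewrite -(subrKA (w k)) (le_lt_trans (ler_normD _ _))//.
  have -> : e1 = eta + D * eta by rewrite /eta; field; rewrite gt_eqF.
  rewrite ltr_leD// (le_trans (norm_le_enorm _))// (le_trans we)//.
  by rewrite mulrA mulrAC ler_wpM2l// ltW.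
have [k0 [Nk0 xk0 _]] := cluster_ex N e10.
have xk j : `|x (j + k0)%N - p| < e1.
  elim: j => [//|j IH]; rewrite addSn.
  by have [] := step (j + k0)%N (leq_trans Nk0 (leq_addl _ _)) IH.
exists k0 => k k0k; have := xk (k - k0)%N; rewrite subnK// => xke.
have [wke _] := step k (leq_trans Nk0 k0k) xke; split.
  apply: lt_le_trans xke _; apply: (@le_trans _ _ (e1 + e1)); first by rewrite lerDl ltW.
  by rewrite e2 ge_min lexx.
by apply: lt_le_trans wke _; rewrite e2 ge_min lexx.
Qed.

(** Descent gives [sigma / 4 * |w - x|^2 <= F x - F p <= n * L * |x - p|^2]. Since [t <= (t + 1)^2]
    for [t >= 0], the factor [4 * n * L / sigma + 1] avoids a square root; the triangle inequality
    adds another 1. *)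
Definition prox_error_const := 4 * (n%:R * L) / sigma + 2.

Lemma prox_error_const_gt0 : 0 < prox_error_const.
Proof. by rewrite ltr_wpDl// divr_ge0 ?mulr_ge0 ?(ltW L0) ?(ltW sigma0). Qed.

Lemma eventually_regular : exists N, forall k, (N <= k)%N ->
  [/\ supp (x k) = S, supp (w k) = S, enorm (w k - p) < rho &
      enorm (w k - p) <= prox_error_const * enorm (x k - p)].
Proof.
have [r r0 rP] := w_support_near.
pose e := Num.min (Num.min rho r) (rho / n.+1%:R).
have [N NP] := @sequence_near e ltac:(by rewrite !lt_min rho0 r0 divr_gt0).
have wS k : (N <= k)%N -> supp (w k) = S.
  by move=> /NP[_]; rewrite !lt_min => /andP[/andP[_ /rP]].
(* The support of an iterate is controlled through the preceding prox point, hence the shift of the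
   index. *)
exists N.+1 => -[//|k] Nk; have Nk' := ltnW Nk.
have := NP _ Nk'; rewrite !lt_min => -[/andP[/andP[xrho _] _] /andP[/andP[wrho _] wn]].
have xS : supported S (x k.+1) by rewrite -(wS k Nk); exact: x_supp.
have xb := ballN xrho.
have sxS : supp (x k.+1) = S.
  apply/setP => i; have [iS|niS] := boolP (i \in S).
    by rewrite inE; exact: nz xb i iS.
  by rewrite inE xS// eqxx.
split => //; first exact: wS.
  rewrite (le_lt_trans (enorm_le_norm _))//; move: wn; rewrite ltr_pdivlMr// => wn.
  by rewrite (le_lt_trans _ wn)// mulrC ler_wpM2l// ler_nat.
have xpS : supported S (x k.+1 - p) by exact: supportedB.
have up := quadratic_upper L0 rho0 Ed GL stationary xb xpS.
have := w_dec k.+1; have := objective_cluster_le k.+1.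
have Fx : F (x k.+1) = E (x k.+1) by exact: objective_restricted.
have Fp : F p = E p by exact: objective_restricted.
rewrite Fx Fp => h1 h2.
pose K := 4 * (n%:R * L) / sigma + 1.
have nL0 : 0 <= 4 * (n%:R * L) / sigma.
  by rewrite divr_ge0 ?mulr_ge0 ?(ltW L0) ?(ltW sigma0).
have K1 : 1 <= K by rewrite lerDr.
have h3 : sigma / 4 * enorm (w k.+1 - x k.+1) ^+ 2 <= n%:R * L * enorm (x k.+1 - p) ^+ 2.
  by move: up h1 h2; move: (F _) (E _) (E _) (_ * _ ^+ 2) (_ * _ ^+ 2) => a1 a2 a3 a4 a5; lra.
have h4 : enorm (w k.+1 - x k.+1) <= K * enorm (x k.+1 - p).
  rewrite -(@ler_pXn2r _ 2)// ?nnegrE ?mulr_ge0 ?enorm_ge0 ?(le_trans ler01 K1)//.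
  rewrite exprMn; apply: (@le_trans _ _ (K * enorm (x k.+1 - p) ^+ 2)); last first.
    by rewrite ler_wpM2r ?exprn_ge0 ?enorm_ge0// expr2 ler_peMr// (le_trans ler01).
  rewrite -(ler_pM2l (_ : 0 < sigma / 4)) ?divr_gt0// (le_trans h3)//.
  rewrite [leRHS]mulrA ler_wpM2r ?exprn_ge0 ?enorm_ge0// /K mulrDr mulr1.
  rewrite (_ : sigma / 4 * _ = n%:R * L); last by field; rewrite gt_eqF.
  by rewrite lerDl divr_ge0// ltW.
have -> : prox_error_const * enorm (x k.+1 - p) = K * enorm (x k.+1 - p) + enorm (x k.+1 - p).
  by rewrite /prox_error_const /K; ring.
by rewrite -(subrKA (x k.+1)) (le_trans (enormD _ _))// lerD2r.
Qed.

Lemma gen_hessian_residual_near (b : 'rV[R]_n -> R) : continuous b ->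
  (\forall y \near p, twice_differentiable E y ->
     enorm (grad E y - grad E p - (y - p) *m hessian E y) <= b y) ->
  \forall y \near p, forall M, gen_hessian E y M ->
     enorm (grad E y - grad E p - (y - p) *m M) <= b y.
Proof.
move=> cb /nbhs_ballP[d /= d0 dP]; apply/nbhs_ballP.
exists (Num.min d rho) => /=; first by rewrite lt_min d0.
move=> y; rewrite -ball_normE /= lt_min => /andP[yd yrho] M HM.
have yb : ball p rho y by rewrite -ball_normE.
have yb' : ball p d y by rewrite -ball_normE.
apply: gen_hessian_residual L0 GL (near_ball yb) (cb y) _ _ HM.
have : nbhs y (ball p d) by apply: open_nbhs_nbhs; split => //; exact: ball_open.
by apply: filterS => z; exact: dP.
Qed.

(** Serves both rates: the majorant [b] of the residual is a small multiple of the distance to [p]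
    or a multiple of its square. Its third hypothesis is the smallness that the line search
    demands. *)
Lemma newton_step_bound (b : 'rV[R]_n -> R) : continuous b ->
  (\forall y \near p, twice_differentiable E y ->
     enorm (grad E y - grad E p - (y - p) *m hessian E y) <= b y) ->
  (\forall y \near p, b y <= 2 * sigma *
     (Num.min (1 / 4) (7 * sigma / 32 / (n%:R * L + 1)) * enorm (y - p))) ->
  exists N, forall k, (N <= k)%N -> 2 * sigma * enorm (x k.+1 - p) <= b (w k) /\
    enorm (w k - p) <= prox_error_const * enorm (x k - p).
Proof.
move=> cb /(gen_hessian_residual_near cb) res bs.
have /nbhs_ballP[d1 /= d10 d1P] := res; have /nbhs_ballP[d2 /= d20 d2P] := bs.
have d0 : 0 < Num.min d1 d2 by rewrite lt_min d10.
have [N1 N1P] := eventually_regular; have [N2 N2P] := sequence_near d0.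
exists (maxn N1 N2) => k; rewrite geq_max => /andP[/N1P[xS wS wrho wx] /N2P[_]].
rewrite lt_min => /andP[wd1 wd2]; split => //.
have /d1P resw : ball p d1 (w k) by rewrite -ball_normE /= distrC.
have /d2P bw : ball p d2 (w k) by rewrite -ball_normE /= distrC.
have step := x_newton (etrans wS (esym xS)).
by apply: (newton_full_step (p := p) (rho := rho) (r := b (w k))
  L0 rho0 sigma0 _ _ _ _ _ _ wrho _ bw step);
  rewrite wS //; exact: stationary.
Qed.

Let m0 := Num.min (1 / 4) (7 * sigma / 32 / (n%:R * L + 1)).

Let m0_gt0 : 0 < m0.
Proof.
rewrite lt_min !divr_gt0 ?mulr_gt0//.
by rewrite ltr_wpDl// mulr_ge0// ltW.
Qed.

Lemma superlinear : (forall e, 0 < e -> \forall y \near p, twice_differentiable E y ->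
     enorm (grad E y - grad E p - (y - p) *m hessian E y) <= e * enorm (y - p)) ->
  forall e, 0 < e -> exists N, forall k, (N <= k)%N ->
    enorm (x k.+1 - p) <= e * enorm (x k - p).
Proof.
move=> res e e0; have K0 := prox_error_const_gt0.
have s20 : 0 < 2 * sigma by rewrite mulr_gt0.
(* [m0] is for the line search; the other bound yields the factor [e] once the distance of [w k] is
   expressed by that of [x k]. *)
pose e1 := 2 * sigma * Num.min m0 (e / prox_error_const).
have e10 : 0 < e1 by rewrite mulr_gt0// lt_min m0_gt0 divr_gt0.
have [|||N NP] := newton_step_bound (b := fun y => e1 * enorm (y - p)).
- by move=> y; exact: (cvgM (cvg_cst e1) (@enorm_dist_continuous R n p y)).
- exact: res.
- apply: filterS (near_ball (ballxx p rho0)) => y _.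
  rewrite /e1 -[leLHS]mulrA ler_pM2l// ler_wpM2r ?enorm_ge0//.
  by rewrite -/m0 ge_min lexx.
exists N => k /NP[H1 H2]; rewrite -(ler_pM2l s20) (le_trans H1)//.
rewrite /e1 -[leLHS]mulrA ler_pM2l//.
apply: (@le_trans _ _ (e / prox_error_const * (prox_error_const * enorm (x k - p)))).
  rewrite ler_pM ?enorm_ge0//; last by rewrite ge_min lexx orbT.
  by rewrite le_min (ltW m0_gt0) divr_ge0// ltW.
by rewrite mulrA divfK// gt_eqF.
Qed.

Lemma quadratic D : 0 <= D ->
  (\forall y \near p, twice_differentiable E y ->
     enorm (grad E y - grad E p - (y - p) *m hessian E y) <= D * enorm (y - p) ^+ 2) ->
  exists2 D', 0 < D' & exists N, forall k, (N <= k)%N ->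
    enorm (x k.+1 - p) <= D' * enorm (x k - p) ^+ 2.
Proof.
move=> D0 res; have K0 := prox_error_const_gt0.
have s20 : 0 < 2 * sigma by rewrite mulr_gt0.
have D10 : 0 < D + 1 by rewrite ltr_wpDl.
(* [D + 1] instead of [D] keeps the factor positive for the divisions below. *)
have [|||N NP] := newton_step_bound (b := fun y => (D + 1) * enorm (y - p) ^+ 2).
- move=> y; have H := @enorm_dist_continuous R n p y.
  exact: (cvgM (cvg_cst (D + 1)) (cvgM H H)).
- apply: filterS res => y H /H /le_trans; apply.
  by rewrite ler_wpM2r ?exprn_ge0 ?enorm_ge0// lerDl.
- have : 0 < 2 * sigma * m0 / (D + 1) by rewrite divr_gt0// mulr_gt0.
  move=> /(near_enorm p); apply: filterS => y yl.
  rewrite -/m0 expr2 !mulrA ler_wpM2r ?enorm_ge0//.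
  by rewrite mulrC -ler_pdivlMr.
exists ((D + 1) * prox_error_const ^+ 2 / (2 * sigma)).
  by rewrite divr_gt0// mulr_gt0// exprn_gt0.
exists N => k /NP[H1 H2]; rewrite -(ler_pM2l s20) (le_trans H1)//.
have -> : 2 * sigma * ((D + 1) * prox_error_const ^+ 2 / (2 * sigma) * enorm (x k - p) ^+ 2) =
    (D + 1) * (prox_error_const * enorm (x k - p)) ^+ 2.
  by field; rewrite gt_eqF.
by rewrite ler_pM2l// ler_pXn2r ?nnegrE ?mulr_ge0 ?enorm_ge0// ltW.
Qed.

End local.

End descent.

(** * From the hypotheses of the theorem to the local estimates *)

Lemma enorm_subvec (R : realType) n (T : {set 'I_n}) (v : 'rV[R]_n) :
  supported T v -> enorm (subvec T v) = enorm v.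
Proof.
move=> vT; apply/eqP; rewrite -(@eqrXn2 _ 2)// ?enorm_ge0//.
by rewrite !enorm_sqr dot_subvec.
Qed.

(** Vectors supported in the support of [p] correspond isometrically to subvectors. The gap between
    [2 * sigma] and [c] is what [hessian_pd_near] needs. *)
Lemma sigma_star_lower (R : realType) n (f : 'rV[R]_n -> R) (lambda q sigma : R) (p : 'rV[R]_n) :
  (sigma%:E < sigma_star f lambda q p)%E ->
  exists2 c, 2 * sigma < c &
    forall M, gen_hessian (restricted_objective f lambda q (supp p)) p M ->
    forall v, supported (supp p) v -> enorm v = 1 -> c <= dot (v *m M) v.
Proof.
rewrite /sigma_star; set I := ereal_inf _ => sI.
have Ile M v : gen_hessian (restricted_objective f lambda q (supp p)) p M ->
    supported (supp p) v -> enorm v = 1 -> (I <= (dot (v *m M) v)%:E)%E.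
  move=> HM vS v1.
  apply: (@le_trans _ _ (ereal_inf [set (dot (u *m principal_submx (supp p) M) u)%:E
    | u in [set u : 'rV[R]_#|supp p| | enorm u = 1]])).
    by apply: ereal_inf_lbound; exists (principal_submx (supp p) M) => //; exists M.
  apply: ereal_inf_lbound; exists (subvec (supp p) v); first by rewrite /= enorm_subvec.
  by rewrite subvec_mul_principal// dot_subvec.
case: I sI Ile => [r| |].
- rewrite -EFinM lte_fin => sr Ile; exists r; first by lra.
  by move=> M HM v vS v1; have := Ile M v HM vS v1; rewrite lee_fin.
(* An infimum equal to [+oo] means that there is no pair of a generalized Hessian and a supported
   unit vector, as for an empty support; any [c] will do. *)
- move=> _ Ile; exists (2 * sigma + 1); first by rewrite ltrDl.
  by move=> M HM v vS v1; have := Ile M v HM vS v1; rewrite leye_eq.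
- by rewrite gt0_muleNy ?lte_fin ?invr_gt0// ltNge leNye.
Qed.

(** The factor 5 makes the inequality strict when [p] is nonzero; at [p = 0] the gradient term does
    so instead, because [grad f 0] is nonzero. *)
Lemma cluster_in_sqball (R : realType) n (f : 'rV[R]_n -> R) (lambda q tau : R) (x0 p : 'rV[R]_n) :
  0 < lambda -> 0 < tau -> grad f 0 != 0 -> sublevel f lambda q x0 p ->
  sqball 0 (c0_bound f lambda q tau x0) p.
Proof.
move=> l0 t0 gf0 px0; rewrite /sqball /= sub0r enormN.
apply: (@lt_le_trans _ _ (5 * (enorm p ^+ 2 + tau ^+ 2 * enorm (grad f p) ^+ 2
                       + tau * lambda * lqq q p))%:E); last first.
  by apply: ereal_sup_ubound; exists p.
rewrite lte_fin; have h1 : 0 <= tau * lambda * lqq q p by rewrite !mulr_ge0 ?lqq_ge0// ltW.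
have h2 : 0 <= tau ^+ 2 * enorm (grad f p) ^+ 2 by rewrite mulr_ge0 ?exprn_ge0 ?enorm_ge0// ltW.
have h3 : 0 <= enorm p ^+ 2 by rewrite exprn_ge0 ?enorm_ge0.
have [p0|pn0] := eqVneq p 0.
  have h4 : 0 < tau ^+ 2 * enorm (grad f p) ^+ 2.
    by rewrite mulr_gt0 ?exprn_gt0// lt0r enorm_ge0 p0 enorm_eq0 gf0.
  by move: (tau ^+ 2 * _) (_ * lqq q p) (enorm p ^+ 2) h1 h4 h3 => a b c; lra.
have h4 : 0 < enorm p ^+ 2 by rewrite exprn_gt0// lt0r enorm_ge0 enorm_eq0 pn0.
by move: (tau ^+ 2 * _) (_ * lqq q p) (enorm p ^+ 2) h1 h2 h4 => a b c; lra.
Qed.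

Theorem theorem4p2 (R : realType) (n : nat) (f : 'rV[R]_n -> R)
    (lambda q sigma gamma tau alpha : R)
    (x0 : 'rV[R]_n) (x : nat -> 'rV[R]_n) (xstar : 'rV[R]_n) :
  C1_on f setT ->
  has_lbound (range f) ->
  0 < lambda ->
  0 <= q < 1 ->
  0 < sigma ->
  0 < gamma < 1 ->
  0 < tau ->
  grad f 0 != 0 ->
  (* `| grad f 0 | is the maximum norm *)
  lambda < alpha `^ (1 - q) / 2 * `| grad f 0 | `^ (2 - q) ->
  0 < alpha ->
  (alpha%:E <= mine tau%:E
                 (sigma%:E + sigma0_bound f lambda q tau x0)^-1)%E ->
  PSNP f lambda q sigma gamma (fun=> alpha) x0 x \/
    PCSNP f lambda q sigma gamma (fun=> alpha) x0 x ->
  SC1_on f (sqball 0 (c0_bound f lambda q tau x0)) ->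
  (q = 0 -> coercive f) ->
  cluster (x @ \oo) xstar ->
  (forall M, gen_hessian_supp f lambda q xstar M ->
     forall v, v != 0 -> 0 < dot (v *m M) v) ->
  (sigma%:E < sigma_star f lambda q xstar)%E ->
  [/\ x @ \oo --> xstar,
      (fun k => enorm (x k.+1 - xstar) : R^o)
        =o_\oo (fun k => enorm (x k - xstar) : R^o)
    & SC2_on f (sqball 0 (c0_bound f lambda q tau x0)) ->
      (fun k => enorm (x k.+1 - xstar) : R^o)
        =O_\oo (fun k => enorm (x k - xstar) ^+ 2 : R^o)].
Proof.
move=> C1f f_lb l0 /andP[_ q1] s0 _ t0 gf0 _ a0 _ alg SC1f _ cl _ sstar.
have fd y : differentiable f y by have [] := C1f y I.
(* A description common to both algorithms: PCSNP may return [w] itself, and a Newton step is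
   certain only when the supports of [w] and [x k] agree. *)
have [x00 step] : x 0%N = x0 /\ forall k, exists w,
    [/\ prox_step f lambda q sigma alpha (x k) w,
        newton_step f lambda q sigma gamma w (x k.+1) \/ x k.+1 = w
      & supp w = supp (x k) -> newton_step f lambda q sigma gamma w (x k.+1)].
  case: alg => -[x00 xP]; split => // k; have [w pw nw] := xP k; exists w; split => //.
  - by left.
  - by move: nw; case: ifP => _; [left|right].
  - by move=> sw; move: nw; rewrite sw eqxx.
have /choice[w wP] := step.
have w_prox k : prox_step f lambda q sigma alpha (x k) (w k) by have [] := wP k.
have x_newton k : supp (w k) = supp (x k) ->
  newton_step f lambda q sigma gamma (w k) (x k.+1) by have [] := wP k.
have xle k : objective f lambda q (x k.+1) <=
      objective f lambda q (w k) - sigma / 2 * enorm (x k.+1 - w k) ^+ 2 /\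
    supported (supp (w k)) (x k.+1).
  have [_ [/newton_step_le//|->] _] := wP k.
  rewrite subrr enorm0 expr0n mulr0 subr0; split => //; exact: supported_supp.
have x_dec k := (xle k).1; have x_supp k := (xle k).2.
have psub : sublevel f lambda q x0 xstar.
  rewrite /sublevel /= -x00.
  exact: le_trans (objective_cluster_le fd f_lb l0 q1 s0 a0 w_prox x_dec cl 0)
    (objective_w_le s0 w_prox 0).
have pball := cluster_in_sqball l0 t0 gf0 psub.
have ss : semismooth (grad f) xstar by have [_] := SC1f; apply.
pose S := supp xstar; pose E := restricted_objective f lambda q S.
have pn : nonzero_on S xstar by move=> i; rewrite inE.
have [L [rho1 [L0 rho10 nz1 fL1 GL1]]] := restricted_grad_lipschitz lambda q fd ss.1 pn.
have [c sc cP] := sigma_star_lower sstar.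
have /nbhs_ballP[rho2 /= rho20 pd2] : \forall y \near xstar, twice_differentiable E y ->
    forall v, supported S v -> 2 * sigma * enorm v ^+ 2 <= dot (v *m hessian E y) v.
  apply: (hessian_pd_near L0 rho10 GL1 sc) => M HM.
  by apply: cP; exact: sub_gen_smallest.
pose rho := Num.min rho1 rho2.
have rho0 : 0 < rho by rewrite lt_min rho10.
have sub1 y : ball xstar rho y -> ball xstar rho1 y.
  by apply: le_ball; rewrite ge_min lexx.
have sub2 y : ball xstar rho y -> ball xstar rho2 y.
  by apply: le_ball; rewrite ge_min lexx orbT.
have nz y : ball xstar rho y -> nonzero_on S y by move=> /sub1; exact: nz1.
have fL y z : ball xstar rho y -> ball xstar rho z -> `|grad f y - grad f z| <= L * `|y - z|.
  by move=> /sub1 ? /sub1 ?; exact: fL1.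
have GL y z : ball xstar rho y -> ball xstar rho z -> `|grad E y - grad E z| <= L * `|y - z|.
  by move=> /sub1 ? /sub1 ?; exact: GL1.
have pd y : ball xstar rho y -> twice_differentiable E y ->
    forall v, supported S v -> 2 * sigma * enorm v ^+ 2 <= dot (v *m hessian E y) v.
  by move=> /sub2; exact: pd2.
split.
- apply/cvgrPdist_lt => e e0.
  have [N NP] := sequence_near fd f_lb l0 q1 s0 a0 w_prox x_dec cl L0 rho0 nz fL GL pd e0.
  by exists N => // k /NP[xe _]; rewrite distrC.
- apply/eqoP => e e0.
  have res e' : 0 < e' -> \forall y \near xstar, twice_differentiable E y ->
      enorm (grad E y - grad E xstar - (y - xstar) *m hessian E y) <= e' * enorm (y - xstar).
    (* Half of [e'] covers the semismooth residual of [grad f]; near [xstar] the other half absorbs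
       the quadratic residual of the penalty. *)
    move=> e'0; have e2 : 0 < e' / 2 by rewrite divr_gt0.
    have [D D0 Dres] := restricted_residual q fd (ltW l0) pn (semismooth_jacobian L0 rho0 fL ss e2).
    have D1 : 0 < D + 1 by rewrite ltr_wpDl.
    have := near_enorm xstar (divr_gt0 e2 D1).
    apply: filterS2 Dres => y resy yl /resy /le_trans; apply.
    rewrite [X in _ <= X * _](splitr e') mulrDl lerD2l expr2 mulrA ler_wpM2r ?enorm_ge0//.
    move: yl; rewrite ler_pdivlMr//; apply: le_trans.
    by rewrite mulrC ler_wpM2l ?enorm_ge0// lerDl.
  have [N NP] := superlinear fd f_lb l0 q1 s0 a0 w_prox x_dec x_supp x_newton
    cl L0 rho0 nz fL GL pd res e0.
  by exists N => // k /NP; rewrite /= !ger0_norm ?enorm_ge0.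
- move=> SC2f; have sss : strongly_semismooth (grad f) xstar by have [_] := SC2f; apply.
  have [D1 fres] := strongly_semismooth_jacobian sss.
  have [D2 D20 Dres] := restricted_residual q fd (ltW l0) pn fres.
  have res : \forall y \near xstar, twice_differentiable E y ->
      enorm (grad E y - grad E xstar - (y - xstar) *m hessian E y)
        <= (`|D1| + D2) * enorm (y - xstar) ^+ 2.
    apply: filterS Dres => y resy /resy /le_trans; apply.
    by rewrite -mulrDl ler_wpM2r ?exprn_ge0 ?enorm_ge0// lerD2r ler_norm.
  have D0 : 0 <= `|D1| + D2 by rewrite addr_ge0.
  have [D D'0 [N NP]] := quadratic fd f_lb l0 q1 s0 a0 w_prox x_dec x_supp x_newton
    cl L0 rho0 nz fL GL pd D0 res.
  apply/eqO_exP; exists D => //.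
  by exists N => // k /NP; rewrite /= !ger0_norm ?exprn_ge0 ?enorm_ge0.
Qed.
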